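(* Let $\Omega\subset\mathbb{R}^2$ be an open set and let $1\leq p\leq\infty$ with $p\neq 2$. Then the space $\mathcal{H}(\Omega,l^p,dx)$ of strongly harmonic functions in $\Omega$ with respect to the $l^p$-distance and the Lebesgue measure is spanned by $8$ linearly independent harmonic polynomials; namely (writing $(x,y)$ for the coordinates in $\mathbb{R}^2$) $$\mathcal{H}(\Omega,l^p,dx)=\operatorname{span}\left\{1,\ x,\ y,\ xy,\ x^2-y^2,\ xy^2-\frac{x^3}{3},\ xy^3-x^3y,\ x^2y-\frac{y^3}{3}\right\},$$ and the dimension of $\mathcal{H}(\Omega,l^p,dx)$ is equal to $8$.
   Context: The $l^p$-distance on $\mathbb{R}^2$ is the metric induced by the norm $\|z\|_p=(|z_1|^p+|z_2|^p)^{1/p}$ for $1\le p<\infty$ and $\|z\|_\infty=\max(|z_1|,|z_2|)$. With $B(z,r)=\{\zeta\in\mathbb{R}^2:\|\zeta-z\|_p<r\}$, a locally integrable function $u:\Omega\to\mathbb{R}$ is called strongly harmonic in $\Omega$ (with respect to the $l^p$-distance and Lebesgue measure) if for all balls $B(z,r)\Subset\Omega$ (closure compact and contained in $\Omega$) there holds $$u(z)=\frac{1}{|B(z,r)|}\int_{B(z,r)}u(\zeta)\,d\zeta,$$ where $|\cdot|$ denotes Lebesgue measure. The space of all such functions is denoted by $\mathcal{H}(\Omega,l^p,dx)$; the span is over $\mathbb{R}$, with polynomials regarded as functions on $\Omega$.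
   Formalization: The open set Ω is additionally assumed nonempty and connected; for Ω empty the space has dimension 0, and for disconnected Ω the indicator of a component is strongly harmonic but not in the span, so the claim fails in every excluded case. *)

(* Defs.v *)
From HB Require Import structures.
From mathcomp Require Import all_boot all_order all_algebra.
From mathcomp Require Import all_classical all_reals all_analysis.

Set Implicit Arguments.
Unset Strict Implicit.
Unset Printing Implicit Defensive.

Import Order.TTheory GRing.Theory Num.Theory.
Import numFieldNormedType.Exports.

Local Open Scope classical_set_scope.
Local Open Scope ring_scope.

Section linear_span.
Context (R : pzRingType) (V : lmodType R).

Definition linearly_independent n (b : n.-tuple V) : Prop :=
  forall c : 'I_n -> R, \sum_(i < n) c i *: tnth b i = 0 -> forall i, c i = 0.

Definition linear_span n (b : n.-tuple V) : set V :=
  [set v | exists c : 'I_n -> R, v = \sum_(i < n) c i *: tnth b i].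

Definition has_dimension (S : set V) (n : nat) : Prop :=
  exists b : n.-tuple V, linearly_independent b /\ S = linear_span b.

End linear_span.

Section plane.
Context (R : realType).

(* The value at p = -oo is a dummy. *)
Definition lp_norm (p : \bar R) (z : R * R) : R :=
  match p with
  | q%:E => (`|z.1| `^ q + `|z.2| `^ q) `^ q^-1
  | +oo%E => Num.max `|z.1| `|z.2|
  | -oo%E => 0
  end.

Definition lp_ball (p : \bar R) (z : R * R) (r : R) : set (R * R) :=
  [set w | lp_norm p (w - z) < r].

Definition borel_plane_measure :
    {measure set (measurableTypeR R * measurableTypeR R) -> \bar R} :=
  (@lebesgue_measure R \x @lebesgue_measure R)%E.

(* The completion, on the Caratheodory sigma-algebra, so that a locally
   integrable function need only be Lebesgue (not Borel) measurable. *)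
Definition plane_measure :
    {measure set (caratheodory_type (borel_plane_measure^*)%mu) -> \bar R} :=
  @completed_measure_extension _ _ R borel_plane_measure.

(* A function on Omega is integrated through its extension ['valL_0 u] by 0,
   and only over subsets of Omega. *)
Definition locally_integrable_on (Omega : set (R * R)) (u : Omega -> R) : Prop :=
  forall K : set (R * R), compact K -> K `<=` Omega ->
    plane_measure.-integrable K (EFin \o 'valL_0 u).

Definition strongly_harmonic (p : \bar R) (Omega : set (R * R))
    (u : Omega -> R) : Prop :=
  locally_integrable_on u /\
  forall (z : Omega) (r : R), let B := lp_ball p (val z) r in
    0 < r -> compact (closure B) -> closure B `<=` Omega ->
    u z = (fine (plane_measure B))^-1 * \int[plane_measure]_(w in B) 'valL_0 u w.

Definition strongly_harmonic_space (p : \bar R) (Omega : set (R * R)) :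
    set (Omega -> R) :=
  [set u | strongly_harmonic p u].

Definition e1 : R * R := (1, 0).
Definition e2 : R * R := (0, 1).

Definition twice_continuously_differentiable (f : R * R -> R) : Prop :=
  forall v w : R * R, v \in [:: e1; e2] -> w \in [:: e1; e2] ->
    [/\ forall z, derivable f z v,
        forall z, derivable ('D_v f) z w &
        continuous ('D_w ('D_v f))].

Definition harmonic_function (f : R * R -> R) : Prop :=
  twice_continuously_differentiable f /\
  forall z, 'D_e1 ('D_e1 f) z + 'D_e2 ('D_e2 f) z = 0.

Definition harmonic_polynomials : 8.-tuple (R * R -> R) :=
  [tuple (fun=> 1);
         (fun z => z.1);
         (fun z => z.2);
         (fun z => z.1 * z.2);
         (fun z => z.1 ^+ 2 - z.2 ^+ 2);
         (fun z => z.1 * z.2 ^+ 2 - z.1 ^+ 3 / 3);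
         (fun z => z.1 * z.2 ^+ 3 - z.1 ^+ 3 * z.2);
         (fun z => z.1 ^+ 2 * z.2 - z.2 ^+ 3 / 3)].

Definition harmonic_polynomials_on (Omega : set (R * R)) :
    8.-tuple (Omega -> R) :=
  [tuple of map (sigL Omega) harmonic_polynomials].

End plane.

(* Main.v *)
From HB Require Import structures.
Require Import Defs.
From mathcomp Require Import all_boot all_order all_algebra.
From mathcomp Require Import all_classical all_reals all_analysis.
From mathcomp Require Import measurable_realfun.
From mathcomp Require Import ring lra.

Set Implicit Arguments.
Unset Strict Implicit.
Unset Printing Implicit Defensive.

Import Order.TTheory GRing.Theory Num.Theory.
Import numFieldNormedType.Exports.

Local Open Scope classical_set_scope.
Local Open Scope ring_scope.

(* Translations, reflections and the coordinate swap preserve Lebesgue measure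
   and the l^p balls centred at 0, so every odd moment of such a ball vanishes,
   the second moments along the axes agree, and each of the eight polynomials
   has the mean value property.

   Conversely, a strongly harmonic u is continuous, by dominated convergence,
   since l^p spheres are null sets. Replacing u near a point by its iterated
   averages over [0, h] in each coordinate (Steklov means) preserves the mean
   value property and provides enough derivatives F_ij to expand the mean
   value over a ball of radius r up to o(r^4). The r^2 term gives the Laplace
   equation, and with it the r^4 term reads
     F_40 * \int_B (x^4 - 6 x^2 y^2 + y^4) = 0.
   In the coordinates (x, t = y / x) this integral is a multiple of
     \int_0^1 (1 - 6 t^2 + t^4) / (1 + t^p)^(6/p) dt.
   For p = 2 it vanishes, and for p <> 2 the ratio of the l^p and l^2 norms of
   (1, t) is monotone and not constant (convexity of the power function), which
   makes it nonzero. Hence F_40 = 0, and a harmonic function with vanishing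
   fourth x-derivative is a combination of the eight polynomials. Coefficients
   of such combinations are finite differences, so they survive the limit
   h -> 0; connectedness then makes the local combinations agree. *)

(** * Changes of variables in the plane *)

Section affine.
Context {R : realType}.
Notation mu := (@lebesgue_measure R).
Local Notation RM := (measurableTypeR R).

(** The exponent enters through two interfaces: [symmetric_gauge], which covers the integration over
    balls for every p including infinity, and [monotone_slope_ratio], which makes the quartic moment
    nonzero. The jets, the means and the local form are stated for any gauge [N] with these
    properties. The obstacle is regularity: u is merely locally integrable for the completed
    measure, and lives on Omega only. Once u is known to be continuous, it is composed near a point
    with the projection onto a closed square. This gives a bounded, uniformly continuous function on
    the whole plane, so that Borel measure and total functions suffice; the price is a mean value
    property restricted to centres in a square and to small radii. Steklov means fit this setting:
    the derivative of a mean is a difference quotient, so each derivative consumes one average and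
    is bounded for fixed h. These bounds blow up as h tends to 0, which is harmless: for each h the
    conclusion is an exact polynomial identity, and the limit uses only uniform closeness of
    values. *)

Definition affine (a b : R) : RM -> RM := fun x => a * x + b.

Lemma measurable_affine (a b : R) : measurable_fun [set: RM] (affine a b).
Proof.
apply: (@measurable_funD _ _ R); last exact: measurable_cst.
by apply: (@measurable_funM _ _ R); [exact: measurable_cst|exact: measurable_id].
Qed.

(** The rescaled pushforward is a measure that agrees with [mu] on the generating intervals []x,
    y]], so uniqueness of Lebesgue measure applies. A negative slope exchanges the open and closed
    ends, hence the sign cases. *)
Lemma lebesgue_measure_affine (a b : R) (A : set RM) : a != 0 -> measurable A ->
  mu A = (`|a|%:E * mu (affine a b @^-1` A))%E.
Proof.
move=> a0 mA.
have a_gt0 : 0 < `|a| by rewrite normr_gt0.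
pose phi := affine a b.
have mphi : measurable_fun [set: RM] phi := measurable_affine a b.
pose m : {measure set RM -> \bar R} :=
  mscale (NngNum (ltW a_gt0)) (pushforward mu phi).
rewrite -[RHS]/(m mphi A); apply: lebesgue_measure_unique => // _ [[x y] _ <-].
rewrite -[RHS]/(`|a|%:E * mu (phi @^-1` `]x, y]))%E.
have [a_pos|a_neg|a_eq] := ltgtP 0 a; last by rewrite -a_eq eqxx in a0.
- rewrite (_ : _ @^-1` _ = `](x - b) / a, (y - b) / a]%classic); last first.
    apply/seteqP; split => z /=; rewrite !in_itv/= ltr_pdivrMr// ler_pdivlMr// /phi /affine;
      rewrite [z * a]mulrC; lra.
  rewrite !lebesgue_measure_itv/= !lte_fin gtr0_norm//.
  rewrite ltr_pdivrMr// mulfVK ?gt_eqF// ltrD2r.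
  case: ltP => // _; last by rewrite mule0.
  by rewrite -!EFinB -EFinM; congr (_%:E); field.
- rewrite (_ : _ @^-1` _ = `[(y - b) / a, (x - b) / a[%classic); last first.
    apply/seteqP; split => z /=; rewrite !in_itv/= ler_ndivrMr// ltr_ndivlMr// /phi /affine;
      rewrite [z * a]mulrC; lra.
  rewrite !lebesgue_measure_itv/= !lte_fin ltr0_norm//.
  rewrite ltr_ndivrMr// mulfVK ?lt_eqF// ltrD2r.
  case: ltP => // _; last by rewrite mule0.
  by rewrite -!EFinB -EFinM; congr (_%:E); field.
Qed.

Lemma ge0_integral_affine (a b : R) (f : R -> \bar R) : a != 0 ->
  measurable_fun [set: RM] f -> (forall x, 0 <= f x)%E ->
  (\int[mu]_x f x = `|a|%:E * \int[mu]_x f (affine a b x))%E.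
Proof.
move=> a0 mf f0.
have a_gt0 : 0 < `|a| by rewrite normr_gt0.
pose phi := affine a b.
have mphi : measurable_fun [set: RM] phi := measurable_affine a b.
pose m : {measure set RM -> \bar R} :=
  mscale (NngNum (ltW a_gt0)) (pushforward mu phi).
transitivity (\int[m mphi]_x f x)%E.
  by apply: eq_measure_integral => A mA _; exact: lebesgue_measure_affine.
by rewrite /m ge0_integral_mscale//= ge0_integral_pushforward.
Qed.

End affine.

Section plane_maps.
Context {R : realType}.
Notation mu := (@lebesgue_measure R).
Local Notation RM := (measurableTypeR R).
Local Notation M := (borel_plane_measure R).

Definition measure_preserving (phi : RM * RM -> RM * RM) : Prop :=
  measurable_fun setT phi /\
  forall A, measurable A -> M (phi @^-1` A) = M A.

(** Integrability is not assumed: the positive and negative parts are transformed separately, and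
    the integral is their difference by definition. *)
Lemma integral_measure_preserving phi (D : set (RM * RM)) (f : RM * RM -> \bar R) :
  measure_preserving phi -> measurable D -> measurable_fun setT f ->
  (\int[M]_(x in D) f x = \int[M]_(x in phi @^-1` D) f (phi x))%E.
Proof.
move=> [mphi pres] mD mf.
have ge0 g : measurable_fun setT g -> (forall x, 0 <= g x)%E ->
    (\int[M]_(x in D) g x = \int[M]_(x in phi @^-1` D) g (phi x))%E.
  move=> mg g0; transitivity (\int[pushforward M phi]_(x in D) g x)%E.
    by apply: eq_measure_integral => A mA _; exact/esym/pres.
  by rewrite ge0_integral_pushforward//; exact: measurable_funTS.
rewrite integralE ge0//; last exact: measurable_funepos.
rewrite [X in (_ - X)%E]ge0//; last exact: measurable_funeneg.
by rewrite [RHS](integralE _ _ (f \o phi)) [in RHS]funepos_comp [in RHS]funeneg_comp.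
Qed.

Lemma Rintegral_measure_preserving phi (D : set (RM * RM)) (f : RM * RM -> R) :
  measure_preserving phi -> measurable D -> measurable_fun setT f ->
  \int[M]_(x in D) f x = \int[M]_(x in phi @^-1` D) f (phi x).
Proof.
move=> pphi mD mf; rewrite /Rintegral (integral_measure_preserving pphi)//.
exact/measurable_EFinP.
Qed.

(** Rectangles determine a product measure, so the pushforward by [phi] is identified by its values
    on them. *)
Lemma measure_preserving_rect phi : measurable_fun setT phi ->
  (forall A B, measurable A -> measurable B ->
     M (phi @^-1` (A `*` B)) = (mu A * mu B)%E) ->
  measure_preserving phi.
Proof.
move=> mphi H; split => // A mA.
by rewrite [RHS](@product_measure_unique _ _ _ _ _ mu mu (pushforward M phi)).
Qed.

Lemma measure_preserving_affine (a b : R * R) : `|a.1| = 1 -> `|a.2| = 1 ->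
  measure_preserving (fun z => (a.1 * z.1 + b.1, a.2 * z.2 + b.2)).
Proof.
move=> a1 a2.
have a10 : a.1 != 0 by rewrite -normr_gt0 a1.
have a20 : a.2 != 0 by rewrite -normr_gt0 a2.
apply: measure_preserving_rect.
  apply/measurable_fun_pair => /=.
    exact: (measurableT_comp (measurable_affine a.1 b.1) measurable_fst).
  exact: (measurableT_comp (measurable_affine a.2 b.2) measurable_snd).
move=> A B mA mB.
rewrite (_ : _ @^-1` _ = (affine a.1 b.1 @^-1` A) `*`
  (affine a.2 b.2 @^-1` B))//.
have mp (c : R * R) (C : set RM) : measurable C ->
    measurable (affine c.1 c.2 @^-1` C).
  by move=> mC; rewrite -[X in measurable X]setTI; exact: measurable_affine.
rewrite /M/= product_measure1E; [|exact: (mp (a.1, b.1))|exact: (mp (a.2, b.2))].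
rewrite [mu A](lebesgue_measure_affine b.1 a10)// a1 mul1e.
by rewrite [mu B](lebesgue_measure_affine b.2 a20)// a2 mul1e.
Qed.

Lemma measure_preserving_swap : measure_preserving (fun z => (z.2, z.1)).
Proof.
apply: measure_preserving_rect.
  by apply/measurable_fun_pair => /=; [exact: measurable_snd|exact: measurable_fst].
move=> A B mA mB.
rewrite (_ : _ @^-1` _ = B `*` A); last by apply/seteqP; split => -[x y] [].
by rewrite /M/= product_measure1E// muleC.
Qed.

Lemma open_rect (O : set (R * R)) (z : R * R) : open O -> O z ->
  exists2 e : R, 0 < e & forall w : R * R,
    `|w.1 - z.1| < e -> `|w.2 - z.2| < e -> O w.
Proof.
move=> oO Oz; have : nbhs z O by exact: open_nbhs_nbhs.
move=> /nbhs_ballP[e e0 eO]; exists e => // w w1 w2; apply: eO.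
by split; rewrite /= /ball/= distrC.
Qed.

(** The sigma-algebra of the plane is generated by measurable rectangles, so an open set has to be
    written as a countable union of them: the rational squares that it contains. *)
Lemma open_plane_measurable (O : set (R * R)) :
  open O -> measurable (O : set (RM * RM)).
Proof.
move=> oO.
pose box (k : rat * rat * rat) : set (RM * RM) :=
  `](ratr k.1.1 - ratr k.2), (ratr k.1.1 + ratr k.2)[%classic `*`
  `](ratr k.1.2 - ratr k.2), (ratr k.1.2 + ratr k.2)[%classic.
have -> : O = \bigcup_(k in [set k | box k `<=` O]) box k.
  apply/seteqP; split => [z Oz|z [k kO]]; last exact: kO.
  have [e e0 eO] := open_rect oO Oz.
  have e4 : 0 < e / 4 by rewrite divr_gt0.
  (* The centre is chosen within e / 4 of [z] in each coordinate and the half-side between e / 4 and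
     e / 2: the square then contains [z] and stays within 3 e / 4 of it. *)
  have [d /= /itvP d_]:= @rat_in_itvoo R (e / 4) (e / 2) ltac:(lra).
  have dgt : e / 4 < ratr d by rewrite d_.
  have dlt : ratr d < e / 2 :> R by rewrite d_.
  have [q1 /= /itvP q1_] := @rat_in_itvoo R (z.1 - e / 4) (z.1 + e / 4) ltac:(lra).
  have [q2 /= /itvP q2_] := @rat_in_itvoo R (z.2 - e / 4) (z.2 + e / 4) ltac:(lra).
  have h11 : z.1 - e / 4 < ratr q1 by rewrite q1_.
  have h12 : ratr q1 < z.1 + e / 4 by rewrite q1_.
  have h21 : z.2 - e / 4 < ratr q2 by rewrite q2_.
  have h22 : ratr q2 < z.2 + e / 4 by rewrite q2_.
  exists (q1, q2, d).
    move=> w [/=]; rewrite !in_itv/= => /andP[? ?] /andP[? ?].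
    by apply: eO; rewrite ltr_norml; lra.
  by split; rewrite /= in_itv/=; lra.
rewrite bigcup_mkcond; apply: countable_bigcupT_measurable; first exact: countableP.
move=> k; case: ifPn => _; last exact: measurable0.
by apply: measurableX; exact: measurable_itv.
Qed.

Lemma continuous_plane_measurable (f : R * R -> R) :
  continuous f -> measurable_fun setT (f : RM * RM -> R).
Proof.
move=> cf; apply: (measurability _ (RGenOpens.measurableE R)).
move=> _ [_ [a [b ->]] <-]; rewrite setTI.
apply: open_plane_measurable; apply: open_comp; first by move=> x _; exact: cf.
exact: interval_open.
Qed.
End plane_maps.

(** * Gauges and their balls *)

Section gauge.
Context {R : realType}.

(** The features shared by all l^p norms with p at least 1. Continuity and the comparison with the
    max norm do the work of a triangle inequality; the factor 2 in [gauge_le] is attained at p =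
    1. *)
Record symmetric_gauge (N : R * R -> R) : Prop := {
  gauge_continuous : continuous N;
  gauge_ge_fst : forall z : R * R, `|z.1| <= N z;
  gauge_le : forall (z : R * R) e, `|z.1| <= e -> `|z.2| <= e -> N z <= 2 * e;
  gaugeZ : forall a (z : R * R), N (a * z.1, a * z.2) = `|a| * N z;
  gauge_norm : forall z : R * R, N (`|z.1|, `|z.2|) = N z;
  gauge_swap : forall z : R * R, N (z.2, z.1) = N z }.

(** Away from 0 the power is differentiable; at 0 it need not be, and the explicit radius
    [e ^ (1 / c)] is used instead. *)
Lemma continuous_norm_powR (c : R) : 0 < c -> continuous (fun x : R => `|x| `^ c).
Proof.
move=> c0 x; have [->|x0] := eqVneq x 0.
  apply/cvgrPdist_lt => e e0 /=.
  have d0 : 0 < e `^ c^-1 by exact: powR_gt0.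
  near=> y.
  rewrite normr0 powR0 ?gt_eqF// sub0r normrN ger0_norm ?powR_ge0//.
  have /(gt0_ltr_powR c0) : `|y| < e `^ c^-1.
    by near: y; exact: (@cvgr0_norm_lt _ _ _ _ _ id).
  rewrite !nnegrE normr_ge0 powR_ge0 => /(_ isT isT).
  by rewrite -powRrM mulVf ?gt_eqF// powRr1// ltW.
apply: (cvg_comp _ (fun y : R => y `^ c) (cvg_norm cvg_id)).
suff : {for `|x|, continuous (fun y : R => y `^ c)} by [].
apply: differentiable_continuous; apply/derivable1_diffP.
by apply: derivable_powR; rewrite in_itv/= andbT normr_gt0.
Unshelve. all: by end_near. Qed.

Lemma continuous_fst_norm_powR (c : R) : 0 < c ->
  continuous (fun z : R * R => `|z.1| `^ c).
Proof.
move=> c0 z; apply: (cvg_comp _ (fun y : R => `|y| `^ c) cvg_fst).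
exact: continuous_norm_powR.
Qed.

Lemma continuous_snd_norm_powR (c : R) : 0 < c ->
  continuous (fun z : R * R => `|z.2| `^ c).
Proof.
move=> c0 z; apply: (cvg_comp _ (fun y : R => `|y| `^ c) cvg_snd).
exact: continuous_norm_powR.
Qed.

Lemma powRVK (q x : R) : q != 0 -> 0 <= x -> (x `^ q) `^ q^-1 = x.
Proof. by move=> q0 x0; rewrite -powRrM mulfV// powRr1. Qed.

Lemma ler_powR_base (c x y : R) : 0 <= c -> 0 <= x -> x <= y -> x `^ c <= y `^ c.
Proof.
move=> c0 x0 xy; apply: ge0_ler_powR => //; rewrite nnegrE//.
exact: le_trans xy.
Qed.

Lemma lp_norm_gauge (p : \bar R) : (1%:E <= p)%E -> symmetric_gauge (lp_norm p).
Proof.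
case: p => [q| |]; [rewrite lee_fin => q1|move=> _|by rewrite leeNy_eq].
- have q0 : 0 < q by lra.
  have qV0 : 0 < q^-1 by rewrite invr_gt0.
  have qn0 : q != 0 by rewrite gt_eqF.
  split => /=.
  + move=> z.
    rewrite (_ : lp_norm q%:E =
      (fun x : R => `|x| `^ q^-1) \o (fun z : R * R => `|z.1| `^ q + `|z.2| `^ q)).
      apply: continuous_comp; last exact: continuous_norm_powR.
      by apply: cvgD; [exact: continuous_fst_norm_powR|exact: continuous_snd_norm_powR].
    by apply/funext => w /=; rewrite (@ger0_norm _ (_ + _)) //; apply: addr_ge0; exact: powR_ge0.
  + move=> z; rewrite -{1}(@powRVK q `|z.1|)//; apply: ler_powR_base.
    * exact: ltW.
    * exact: powR_ge0.
    * by rewrite lerDl powR_ge0.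
  + move=> z e z1 z2; have e0 : 0 <= e := le_trans (normr_ge0 _) z1.
    rewrite -[leRHS](@powRVK q)// ?mulr_ge0//; apply: ler_powR_base.
    * exact: ltW.
    * by apply: addr_ge0; exact: powR_ge0.
    (* Here 1 <= q enters, through 2 <= 2 ^ q. *)
    rewrite powRM//; apply: (@le_trans _ _ (2 * e `^ q)).
      by rewrite mulr_natl mulr2n lerD// ler_powR_base// ltW.
    by rewrite ler_wpM2r ?powR_ge0// le1r_powR// ler1n.
  + move=> a z; by rewrite !normrM !powRM// -mulrDr powRM ?powRVK// addr_ge0 ?powR_ge0.
  + by move=> z; rewrite !normr_id.
  + by move=> z; rewrite addrC.
- split => /=.
  + move=> z; rewrite (_ : lp_norm +oo%E = (fun z : R * R => Num.max `|z.1| `|z.2|))//.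
    apply: (@continuous_max _ _ (fun z : R * R => `|z.1|) (fun z : R * R => `|z.2|)) => w.
      by apply: cvg_norm; exact: cvg_fst.
    by apply: cvg_norm; exact: cvg_snd.
  + by move=> z; rewrite le_max lexx.
  + move=> z e z1 z2; have e0 : 0 <= e := le_trans (normr_ge0 _) z1.
    by rewrite ge_max; apply/andP; split; lra.
  + by move=> a z; rewrite !normrM maxr_pMr.
  + by move=> z; rewrite !normr_id.
  + by move=> z; rewrite maxC.
Qed.

End gauge.

Section tame.
Context {R : realType}.
Notation mu := (@lebesgue_measure R).
Local Notation RM := (measurableTypeR R).
Local Notation M := (borel_plane_measure R).
Implicit Types f g : R * R -> R.

(** A class containing the polynomials and the bounded continuous functions, closed under the
    operations used below, whose members are integrable on every gauge ball. *)
Definition tame (f : R * R -> R) : Prop :=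
  measurable_fun setT (f : RM * RM -> R) /\
  forall r, exists C, forall w : R * R, `|w.1| <= r -> `|w.2| <= r -> `|f w| <= C.

Lemma tame_cst c : tame (fun=> c).
Proof. by split; [exact: measurable_cst|move=> r; exists `|c|]. Qed.

Lemma tame_fst : tame fst.
Proof. by split; [exact: measurable_fst|move=> r; exists r]. Qed.

Lemma tame_snd : tame snd.
Proof. by split; [exact: measurable_snd|move=> r; exists r]. Qed.

Lemma tameD f g : tame f -> tame g -> tame (fun w => f w + g w).
Proof.
move=> [mf bf] [mg bg]; split; first exact: measurable_funD.
move=> r; have [C fC] := bf r; have [D gD] := bg r; exists (C + D) => w w1 w2.
by rewrite (le_trans (ler_normD _ _))// lerD ?fC ?gD.
Qed.

Lemma tameM f g : tame f -> tame g -> tame (fun w => f w * g w).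
Proof.
move=> [mf bf] [mg bg]; split; first exact: measurable_funM.
move=> r; have [C fC] := bf r; have [D gD] := bg r; exists (C * D) => w w1 w2.
by rewrite normrM ler_pM ?fC ?gD.
Qed.

Lemma tameX f n : tame f -> tame (fun w => f w ^+ n).
Proof.
move=> tf; elim: n => [|n IH]; first exact: tame_cst.
rewrite (_ : (fun w => _) = (fun w => f w * f w ^+ n)); first exact: tameM.
by apply/funext => w; rewrite exprS.
Qed.

Lemma tameN f : tame f -> tame (fun w => - f w).
Proof.
move=> tf; rewrite (_ : (fun w => _) = (fun w => -1 * f w)).
  exact: tameM (tame_cst _) tf.
by apply/funext => w; rewrite mulN1r.
Qed.

Lemma tameB f g : tame f -> tame g -> tame (fun w => f w - g w).
Proof. by move=> tf tg; exact: tameD tf (tameN tg). Qed.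

Lemma tame_sum n (F : nat -> R * R -> R) : (forall i, (i < n)%N -> tame (F i)) ->
  tame (fun w => \sum_(i < n) F i w).
Proof.
elim: n => [_|n IH tF].
  rewrite (_ : (fun w => _) = (fun=> 0)); first exact: tame_cst.
  by apply/funext => w; rewrite big_ord0.
rewrite (_ : (fun w => _) = (fun w => (\sum_(i < n) F i w) + F n w)).
  by apply: tameD; [apply: IH => i ni; apply: tF; rewrite ltnS ltnW|exact: tF].
by apply/funext => w; rewrite big_ord_recr.
Qed.

Lemma tame_affine f (a b : R * R) : tame f ->
  tame (fun w => f (a.1 * w.1 + b.1, a.2 * w.2 + b.2)).
Proof.
move=> [mf bf]; split.
  apply: (measurableT_comp mf); apply/measurable_fun_pair.
    exact: (measurableT_comp (measurable_affine a.1 b.1) measurable_fst).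
  exact: (measurableT_comp (measurable_affine a.2 b.2) measurable_snd).
move=> r; have [C fC] := bf (Num.max (`|a.1| * r + `|b.1|) (`|a.2| * r + `|b.2|)).
exists C => w w1 w2; apply: fC => /=; rewrite le_max; apply/orP; [left|right];
by rewrite (le_trans (ler_normD _ _))// lerD2r normrM ler_wpM2l.
Qed.

Lemma tame_translate f (z : R * R) : tame f -> tame (fun w => f (z + w)).
Proof.
move=> /(@tame_affine _ (1, 1) z); congr (tame _); apply/funext => w /=.
by congr f; rewrite !mul1r [w.1 + _]addrC [w.2 + _]addrC; case: z w => [? ?] [].
Qed.

End tame.

Section gauge_ball.
Context {R : realType}.
Notation mu := (@lebesgue_measure R).
Local Notation RM := (measurableTypeR R).
Local Notation M := (borel_plane_measure R).
Variable N : R * R -> R.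
Hypothesis gN : symmetric_gauge N.
Implicit Types (f g : R * R -> R) (r : R).

Definition gauge_ball r : set (RM * RM) := [set w | N w < r].

Definition ball_integral r f : R := \int[M]_(w in gauge_ball r) f w.

Lemma measurable_gauge : measurable_fun setT (N : RM * RM -> R).
Proof. exact: continuous_plane_measurable (gauge_continuous gN). Qed.

Lemma measurable_gauge_ball r : measurable (gauge_ball r).
Proof.
rewrite (_ : gauge_ball r = setT `&` N @^-1` `]-oo, r[).
  by apply: measurable_gauge => //; exact: measurable_itv.
by rewrite setTI; apply/seteqP; split => w /=; rewrite in_itv.
Qed.
Hint Resolve measurable_gauge_ball : core.

Lemma gauge_ge_snd (z : R * R) : `|z.2| <= N z.
Proof. by rewrite -(gauge_swap gN); exact: (gauge_ge_fst gN (z.2, z.1)). Qed.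

Lemma gauge_ball_fst r w : gauge_ball r w -> `|w.1| < r.
Proof. exact/le_lt_trans/gauge_ge_fst. Qed.

Lemma gauge_ball_snd r w : gauge_ball r w -> `|w.2| < r.
Proof. exact/le_lt_trans/gauge_ge_snd. Qed.

Lemma plane_measure_rect (A B : set RM) : measurable A -> measurable B ->
  M (A `*` B) = (mu A * mu B)%E.
Proof. by move=> mA mB; rewrite /M/= product_measure1E. Qed.

Lemma plane_measure_square (a b : R) : a <= b ->
  M (`]a, b[ `*` `]a, b[) = ((b - a) ^+ 2)%:E.
Proof.
move=> ab; rewrite plane_measure_rect// !lebesgue_measure_itv/= lte_fin.
case: ltP => [_|ba]; first by rewrite -EFinB -EFinM.
by have -> : b = a by [apply/le_anti; rewrite ab ba]; rewrite subrr mule0 expr0n.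
Qed.

Lemma gauge_ball_measure_le r : 0 <= r -> (M (gauge_ball r) <= (4 * r ^+ 2)%:E)%E.
Proof.
move=> r0; have -> : 4 * r ^+ 2 = (r - - r) ^+ 2 by ring.
rewrite -(@plane_measure_square (- r) r) ?ge0_cp//.
apply: le_measure; rewrite ?inE//; first exact: measurableX.
move=> w Nw; split => /=; rewrite in_itv/= -ltr_norml.
  exact: gauge_ball_fst.
exact: gauge_ball_snd.
Qed.

Lemma gauge_ball_sub0 r : r <= 0 -> gauge_ball r = set0.
Proof.
move=> r0; apply/seteqP; split => // w /gauge_ball_fst; apply: contraPP => _.
by apply/negP; rewrite -leNgt (le_trans r0).
Qed.

Lemma gauge_ball_measure_fin r : (M (gauge_ball r) < +oo)%E.
Proof.
have [r0|r0] := leP 0 r; last by rewrite gauge_ball_sub0 ?measure0// ltW.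
by rewrite (le_lt_trans (gauge_ball_measure_le r0))// ltry.
Qed.

(** By [gauge_le], [N] is at most twice the max norm. This off-axis square gives both the positive
    measure of the ball and, since the first coordinate exceeds r / 4 on it, a lower bound for the
    second moment. *)
Lemma square_sub_gauge_ball r :
  `]r / 4, r / 2[%classic `*` `]r / 4, r / 2[%classic `<=` gauge_ball r.
Proof.
move=> w [/=]; rewrite !in_itv/= => /andP[a1 a2] /andP[b1 b2].
have w1 : 0 < w.1 by lra.
have w2 : 0 < w.2 by lra.
apply: (@le_lt_trans _ _ (2 * Num.max w.1 w.2)).
  by apply: (gauge_le gN); rewrite gtr0_norm// le_max lexx ?orbT.
suff : Num.max w.1 w.2 < r / 2 by lra.
by rewrite gt_max a2.
Qed.

Lemma gauge_ball_measure_gt0 r : 0 < r -> 0 < fine (M (gauge_ball r)).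
Proof.
move=> r0; apply: fine_gt0; rewrite gauge_ball_measure_fin andbT.
apply: (@lt_le_trans _ _ (M (`]r / 4, r / 2[ `*` `]r / 4, r / 2[))).
  rewrite plane_measure_square; last lra.
  by rewrite lte_fin exprn_gt0//; lra.
apply: le_measure; rewrite ?inE//; first exact: measurableX.
exact: square_sub_gauge_ball.
Qed.

Lemma tame_integrable r f : tame f -> M.-integrable (gauge_ball r) (EFin \o f).
Proof.
move=> [mf bf]; apply: measurable_bounded_integrable => //.
- exact: gauge_ball_measure_fin.
- exact: measurable_funTS.
have [C fC] := bf r; exists C; split; first exact: num_real.
move=> D CD w Bw; apply: (le_trans (fC w _ _)); rewrite ltW//.
  exact: gauge_ball_fst Bw.
exact: gauge_ball_snd Bw.
Qed.

Lemma ball_integralD r f g : tame f -> tame g ->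
  ball_integral r (fun w => f w + g w) = ball_integral r f + ball_integral r g.
Proof. by move=> tf tg; apply: RintegralD => //; exact: tame_integrable. Qed.

Lemma ball_integralB r f g : tame f -> tame g ->
  ball_integral r (fun w => f w - g w) = ball_integral r f - ball_integral r g.
Proof. by move=> tf tg; apply: RintegralB => //; exact: tame_integrable. Qed.

Lemma ball_integralZ r c f : tame f ->
  ball_integral r (fun w => c * f w) = c * ball_integral r f.
Proof. by move=> tf; apply: RintegralZl => //; exact: tame_integrable. Qed.

Lemma ball_integral_cst r c :
  ball_integral r (fun=> c) = c * fine (M (gauge_ball r)).
Proof. exact: Rintegral_cst. Qed.

Lemma ball_integral_sum r n (F : nat -> R * R -> R) :
  (forall i, (i < n)%N -> tame (F i)) ->
  ball_integral r (fun w => \sum_(i < n) F i w) =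
  \sum_(i < n) ball_integral r (F i).
Proof.
elim: n => [_|n IH tF].
  rewrite big_ord0 -[RHS](mul0r (fine (M (gauge_ball r)))) -ball_integral_cst.
  by apply: eq_Rintegral => w _; rewrite big_ord0.
rewrite big_ord_recr/= -IH; last by move=> i ni; apply: tF; rewrite ltnS ltnW.
rewrite -ball_integralD; last exact: tF.
  by apply: eq_Rintegral => w _; rewrite big_ord_recr.
by apply: tame_sum => i ni; apply: tF; rewrite ltnS ltnW.
Qed.

Lemma ball_integral_le r f (C : R) : 0 <= r -> tame f -> 0 <= C ->
  (forall w, `|w.1| <= r -> `|w.2| <= r -> `|f w| <= C) ->
  `|ball_integral r f| <= C * (4 * r ^+ 2).
Proof.
move=> r0 tf C0 fC.
apply: le_trans (le_normr_Rintegral _ _) _ => //; first exact: tame_integrable.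
apply: (@le_trans _ _ (ball_integral r (fun=> C))).
  apply: le_Rintegral => //.
  - by apply: integrable_norm => //; exact: tame_integrable.
  - exact/tame_integrable/tame_cst.
  - move=> w Bw; apply: fC; apply: ltW.
      exact: gauge_ball_fst.
    exact: gauge_ball_snd.
rewrite ball_integral_cst ler_wpM2l// -lee_fin fineK ?gauge_ball_measure_le//.
by rewrite ge0_fin_numE// gauge_ball_measure_fin.
Qed.

Lemma ball_integral_sym r f phi : measure_preserving phi -> tame f ->
  (forall w, N (phi w) = N w) ->
  ball_integral r f = ball_integral r (fun w => f (phi w)).
Proof.
move=> mp [mf _] Nphi; rewrite /ball_integral (Rintegral_measure_preserving mp)//.
by congr Rintegral; apply/seteqP; split => w; rewrite /gauge_ball/= Nphi.
Qed.

Lemma ball_integral_swap r f : tame f ->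
  ball_integral r f = ball_integral r (fun w => f (w.2, w.1)).
Proof.
move=> tf; apply: (ball_integral_sym r measure_preserving_swap) => // w.
exact: gauge_swap.
Qed.

Lemma ball_integral_sign r f (a : R * R) : `|a.1| = 1 -> `|a.2| = 1 -> tame f ->
  ball_integral r f = ball_integral r (fun w => f (a.1 * w.1, a.2 * w.2)).
Proof.
move=> a1 a2 tf.
rewrite (ball_integral_sym r (measure_preserving_affine (0, 0) a1 a2))//=.
  by apply: eq_Rintegral => w _; rewrite !addr0.
move=> w; rewrite !addr0 -(gauge_norm gN)/= !normrM a1 a2 !mul1r.
exact: gauge_norm.
Qed.

Definition moment r i j : R := ball_integral r (fun w => w.1 ^+ i * w.2 ^+ j).

Lemma tame_monomial i j : @tame R (fun w => w.1 ^+ i * w.2 ^+ j).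
Proof.
by apply: tameM; apply: tameX; [exact: tame_fst|exact: tame_snd].
Qed.

Lemma moment_odd_fst r i j : odd i -> moment r i j = 0.
Proof.
move=> oi; suff : moment r i j = - moment r i j by lra.
rewrite -[RHS]mulN1r -ball_integralZ; last exact: tame_monomial.
rewrite /moment (@ball_integral_sign _ _ (-1, 1)) ?normrN ?normr1//=; last first.
  exact: tame_monomial.
by apply: eq_Rintegral => w _ /=; rewrite !mulN1r mul1r exprNn -signr_odd oi; ring.
Qed.

Lemma moment_swap r i j : moment r i j = moment r j i.
Proof.
rewrite /moment ball_integral_swap; last exact: tame_monomial.
by apply: eq_Rintegral => w _ /=; rewrite mulrC.
Qed.

Lemma moment_odd_snd r i j : odd j -> moment r i j = 0.
Proof. by move=> oj; rewrite moment_swap moment_odd_fst. Qed.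

(** On the square of [square_sub_gauge_ball], of area r^2 / 16, the integrand is at least r^2 / 16.
    A lower bound of exact order r^4 allows the Laplacian to be isolated from moments of order
    r^6. *)
Lemma moment20_ge r : 0 < r -> r ^+ 4 / 256 <= moment r 2 0.
Proof.
move=> r0; set Q := `]r / 4, r / 2[%classic `*` `]r / 4, r / 2[%classic : set (RM * RM).
have mQ : measurable Q by exact: measurableX.
have := @tame_integrable r _ (tame_monomial 2 0); rewrite /moment/ball_integral/Rintegral.
move=> /(integrable_fin_num (measurable_gauge_ball r))/= => fin.
rewrite -lee_fin fineK//.
apply: (@le_trans _ _ (\int[M]_(w in Q) (r ^+ 2 / 16)%:E)%E).
  rewrite (integral_cst M mQ (r ^+ 2 / 16)%:E) plane_measure_square; last lra.
  by rewrite -EFinM lee_fin le_eqVlt; apply/orP; left; apply/eqP; field.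
have mf D : measurable_fun D (fun w : RM * RM => (w.1 ^+ 2 * w.2 ^+ 0)%:E).
  by apply/measurable_EFinP/measurable_funTS; case: (tame_monomial 2 0).
apply: le_trans (ge0_subset_integral _ mQ (measurable_gauge_ball r) (mf _) _ _).
- apply: ge0_le_integral => //.
  + by move=> w _; rewrite lee_fin divr_ge0// exprn_ge0// ltW.
  + by move=> w [/=]; rewrite !in_itv/= lee_fin expr0 mulr1 => /andP[a1 a2] _; nra.
- by move=> w _; rewrite lee_fin expr0 mulr1 sqr_ge0.
- exact: square_sub_gauge_ball.
Qed.

End gauge_ball.

(** * The quartic moment of a gauge ball *)

Section slopes.
Context {R : realType}.
Notation mu := (@lebesgue_measure R).
Local Notation RM := (measurableTypeR R).
Local Notation M := (borel_plane_measure R).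

Lemma measurable_slope :
  measurable_fun setT (fun z : RM * RM => (z.1, z.1 * z.2 : RM) : RM * RM).
Proof.
apply/measurable_fun_pair; first exact: measurable_fst.
by apply: (@measurable_funM _ _ R); [exact: measurable_fst|exact: measurable_snd].
Qed.

Lemma measurable_slope_fun (F : RM * RM -> \bar R) : measurable_fun setT F ->
  measurable_fun setT (fun z : RM * RM => `|z.1|%:E * F (z.1, (z.1 * z.2)%R))%E.
Proof.
move=> mF; apply: emeasurable_funM.
  by apply/measurable_EFinP; apply: measurableT_comp => //; exact: measurable_fst.
exact: (measurableT_comp mF measurable_slope).
Qed.

(* The substitution y = t x. *)
Lemma ge0_integral_slope (F : RM * RM -> \bar R) :
  measurable_fun setT F -> (forall z, 0 <= F z)%E ->
  (\int[M]_z F z = \int[mu]_t \int[mu]_x (`|x|%:E * F (x, (x * t)%R)))%E.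
Proof.
move=> mF F0; have mG := measurable_slope_fun mF.
have G0 z : (0 <= `|z.1|%:E * F (z.1, (z.1 * z.2)%R))%E by rewrite mule_ge0.
rewrite -(fubini_tonelli (fun z : RM * RM => `|z.1|%:E * F (z.1, (z.1 * z.2)%R))%E)//.
rewrite [LHS](fubini_tonelli1 F)//.
apply: ge0_ae_eq_integral => //.
- exact: measurable_fun_fubini_tonelli_F.
- exact: (measurable_fun_fubini_tonelli_F _ mG).
- by move=> x _; exact: integral_ge0.
- by move=> x _; apply: integral_ge0 => t _; exact: (G0 (x, t)).
exists [set 0]; split; [exact: measurable_set1|exact: lebesgue_measure_set1|].
move=> x /= /not_implyP[_ +] /=; apply: contra_notP => /eqP x0.
rewrite /fubini_F (ge0_integral_affine 0 x0)//; last exact: measurableT_comp.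
rewrite -ge0_integralZl_EFin//.
- by apply: eq_integral => t _; rewrite /affine addr0.
- apply: (measurableT_comp mF); apply/measurable_fun_pair => //.
  exact: measurable_affine.
Qed.

Variable N : R * R -> R.
Hypothesis gN : symmetric_gauge N.

Lemma gauge_slope (x t : R) : N (x, x * t) = `|x| * N (1, t).
Proof. by rewrite -(gaugeZ gN)/= mulr1. Qed.

Lemma gauge_slope_ge1 (t : R) : 1 <= N (1, t).
Proof. by apply: le_trans (gauge_ge_fst gN _); rewrite /= normr1. Qed.

(** Each section along a line y = t x is null, so the inner integral given by the substitution
    vanishes for every slope [t]. *)
Lemma slope_null (S : set (RM * RM)) : measurable S ->
  (forall t, mu [set x : R | S (x, x * t)] = 0%E) -> M S = 0%E.
Proof.
move=> mS S0; rewrite -[X in M X](setIT S) -integral_indic//.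
have mS1 : measurable_fun setT (fun z : RM * RM => (\1_S z : R)%:E) by exact/measurable_EFinP/measurable_indic.
rewrite ge0_integral_slope//.
apply: integral0_eq => t _; pose St := [set x : R | S (x, x * t)].
have mSt : measurable (St : set RM).
  rewrite (_ : St = setT `&` (fun x : RM => (x, affine t 0 x)) @^-1` S); last first.
    by rewrite setTI; apply/funext => x; rewrite /St/= /affine addr0 mulrC.
  suff mphi : measurable_fun setT (fun x : RM => (x, affine t 0 x)) by exact: mphi.
  by apply/measurable_fun_pair => //; exact: measurable_affine.
transitivity (\int[mu]_(x in St) `|x|%:E)%E; last first.
  apply: (null_set_integral mSt _ (S0 t)).
  by apply/measurable_EFinP; exact: normr_measurable.
rewrite [RHS]integral_mkcond; apply: eq_integral => x _; rewrite patchE /indic.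
case: ifPn; first by rewrite inE => Sx; rewrite mem_set// mule1.
by rewrite notin_setE => Sx; rewrite memNset// mule0.
Qed.

(** By homogeneity a line of slope [t] meets the sphere only at abscissas of modulus r / N (1, t),
    that is in at most two points. *)
Lemma gauge_sphere_null (r : R) : M [set w | N w = r] = 0%E.
Proof.
apply: slope_null => [|t].
  rewrite (_ : [set w | _] = setT `&` N @^-1` [set r]); last by rewrite setTI.
  exact: measurable_gauge.
have Nt := gauge_slope_ge1 t; have Nt0 : N (1, t) != 0 by rewrite gt_eqF// (lt_le_trans _ Nt).
apply: countable_lebesgue_measure0.
apply: (@sub_countable _ _ _ [set r / N (1, t); - (r / N (1, t))]); last first.
  by apply/finite_set_countable; exact: finite_set2.
apply: subset_card_le => x /=; rewrite gauge_slope => xr.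
have {}xr : `|x| = r / N (1, t) by rewrite -xr mulfK.
have [x0|x0] := leP 0 x; [left|right]; rewrite -xr.
  by rewrite ger0_norm.
by rewrite ltr0_norm// opprK.
Qed.

(** The diagonals are what the cone below and its mirror image leave out of the plane. *)
Lemma diagonal_null : M [set w | `|w.1| = `|w.2|] = 0%E.
Proof.
rewrite /M/= /product_measure1; apply: integral0_eq => x _ /=.
apply: countable_lebesgue_measure0; apply: (@sub_countable _ _ _ [set x; - x]); last first.
  by apply/finite_set_countable; exact: finite_set2.
apply: subset_card_le => y; rewrite /xsection/= inE/= => xy.
have [y0|y0] := leP 0 y; have [x0|x0] := leP 0 x; move: xy;
  rewrite ?(ger0_norm y0) ?(ltr0_norm y0) ?(ger0_norm x0) ?(ltr0_norm x0) => xy;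
  by [left; lra|right; lra].
Qed.

(** In the coordinates (x, t = y / x) these are the slopes in []-1, 1[]. Cutting here keeps the
    slopes bounded, in the range where the ratio of norms is monotone in |t|. *)
Definition cone : set (RM * RM) := [set w | `|w.2| < `|w.1|].

Lemma measurable_cone : measurable cone.
Proof.
rewrite (_ : cone = setT `&` (fun w : RM * RM => `|w.1| - `|w.2|) @^-1` `]0, +oo[).
  suff mf : measurable_fun setT (fun w : RM * RM => `|w.1| - `|w.2| : R).
    exact: mf.
  by apply: measurable_funB; apply: measurableT_comp.
by rewrite setTI; apply/seteqP; split => w; rewrite /cone/= in_itv/= andbT subr_gt0.
Qed.

(** The fifth power is the Jacobian |x| of y = t x times the factor x^4 of a homogeneous quartic. It
    is kept as an extended real because the cone formula is proved for nonnegative extended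
    integrals. *)
Definition quintic_mass : \bar R := \int[mu]_(x in `](-1)%R, 1%R[) (`|x| ^+ 5)%:E.

Lemma integral_norm_pow5 (rho : R) : 0 < rho ->
  (\int[mu]_(x in `](- rho)%R, rho%R[) (`|x| ^+ 5)%:E = (rho ^+ 6)%:E * quintic_mass)%E.
Proof.
move=> rho0; have mabs5 D : measurable_fun D (fun x : RM => (`|x| ^+ 5 : R)%:E).
  by apply/measurable_funTS/measurable_EFinP/measurable_funX; exact: normr_measurable.
have mind a b : measurable_fun setT ((fun x : RM => (`|x| ^+ 5)%:E) \_ `]a, b[)%E.
  by apply/(measurable_restrictT _ _).1 => //; exact: mabs5.
have rho_neq0 : rho != 0 by rewrite gt_eqF.
rewrite integral_mkcond (ge0_integral_affine 0 rho_neq0); last 2 first.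
- exact: mind.
- by move=> x; rewrite patchE; case: ifPn => // _; rewrite lee_fin exprn_ge0.
transitivity (`|rho|%:E * \int[mu]_(x in `](-1)%R, 1%R[) ((rho ^+ 5)%:E * (`|x| ^+ 5)%:E))%E.
  congr (_ * _)%E; rewrite [RHS]integral_mkcond; apply: eq_integral => x _.
  rewrite !patchE /affine addr0.
  have -> : (rho * x \in `](- rho)%R, rho%R[%classic) = (x \in `](-1)%R, 1%R[%classic).
    apply/idP/idP; rewrite !inE/= !in_itv/= => /andP[h1 h2]; apply/andP; split; nra.
  by case: ifPn => // _; rewrite -EFinM normrM exprMn gtr0_norm.
rewrite ge0_integralZl_EFin//; last by rewrite exprn_ge0// ltW.
by rewrite muleA -EFinM gtr0_norm// -exprS.
Qed.

(** At slope [t] the ball restricts x to |x| < r / N (1, t); integrating |x|^5 over that interval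
    yields (r / N (1, t))^6, which is the origin of the sixth power. The radial and angular parts
    then separate. *)
Lemma ge0_integral_ball_cone (r : R) (P : R * R -> R) : 0 < r ->
  measurable_fun setT (P : RM * RM -> R) -> (forall z, 0 <= P z) ->
  (forall x t, P (x, x * t) = x ^+ 4 * P (1, t)) ->
  (\int[M]_(w in gauge_ball N r `&` cone) (P w)%:E =
   (r ^+ 6)%:E * quintic_mass *
   \int[mu]_(t in `](-1)%R, 1%R[) (P (1, t)%R / N (1, t)%R ^+ 6)%:E)%E.
Proof.
move=> r0 mP P0 Phom; pose S : set (RM * RM) := gauge_ball N r `&` cone.
have mB : measurable S.
  by apply: measurableI; [exact: measurable_gauge_ball|exact: measurable_cone].
have mPS : measurable_fun setT (fun z : RM * RM => (P z * (\1_S z : R))%:E).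
  by apply/measurable_EFinP/measurable_funM => //; exact: measurable_indic.
have K0 : (0 <= quintic_mass)%E.
  by apply: integral_ge0 => x _; rewrite lee_fin exprn_ge0.
transitivity (\int[M]_w (P w * (\1_S w : R))%:E)%E.
  by rewrite integral_mkcond epatch_indic; apply: eq_integral => w _; rewrite EFinM.
rewrite ge0_integral_slope//; last by move=> z; rewrite lee_fin mulr_ge0.
have mline (G : RM * RM -> R) : measurable_fun setT G ->
    measurable_fun setT (fun t : RM => G ((1 : RM), t)).
  move=> mG; apply: (measurableT_comp mG); apply/measurable_fun_pair => //.
rewrite -ge0_integralZl//; last 3 first.
- apply/measurable_EFinP/measurable_funTS/measurable_funM; first exact: mline.
  rewrite (_ : (fun x => _) = (fun t => (N (1, t) `^ (-1)) ^+ 6)); last first.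
    by apply/funext => t; rewrite powR_inv1 ?exprVn// (le_trans ler01)// gauge_slope_ge1.
  apply: measurable_funX; apply: (measurableT_comp (measurable_powR (-1))).
  by apply: mline; exact: measurable_gauge.
- move=> t _; rewrite lee_fin divr_ge0// exprn_ge0// (le_trans ler01)//.
  exact: gauge_slope_ge1.
- by rewrite mule_ge0// lee_fin exprn_ge0// ltW.
rewrite [in RHS]integral_mkcond; apply: eq_integral => t _; rewrite patchE.
have Nt := gauge_slope_ge1 t; have Nt0 : 0 < N (1, t) by rewrite (lt_le_trans _ Nt).
have memS x : x != 0 -> ((x, x * t) \in S) = (`|x| < r / N (1, t)) && (`|t| < 1).
  move=> x0; apply/idP/idP.
    rewrite inE => -[]; rewrite /gauge_ball/cone/= gauge_slope ltr_pdivlMr// => ->/=.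
    by rewrite normrM gtr_pMr ?normr_gt0.
  rewrite ltr_pdivlMr// => /andP[x1 t1]; rewrite inE; split.
    by rewrite /gauge_ball/= gauge_slope.
  by rewrite /cone/= normrM gtr_pMr ?normr_gt0.
case: ifPn => [|]; last first.
  rewrite notin_setE/= in_itv/= -ltr_norml => /negP/negbTE t1.
  apply: integral0_eq => x _; rewrite -EFinM.
  have [->|x0] := eqVneq x 0; first by rewrite normr0 mul0r.
  by rewrite /indic memS// t1 andbF !mulr0.
rewrite inE/= in_itv/= -ltr_norml => t1.
transitivity (\int[mu]_(x in `](- (r / N (1, t)))%R, (r / N (1, t))%R[)
    ((P (1, t)%R)%:E * (`|x| ^+ 5)%:E))%E.
  rewrite [RHS]integral_mkcond; apply: eq_integral => x _; rewrite patchE -!EFinM.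
  have [->|x0] := eqVneq x 0; first by rewrite normr0 mul0r expr0n/= mulr0; case: ifPn.
  rewrite (_ : (x \in `]_, _[%classic) = (`|x| < r / N (1, t))); last first.
    by rewrite ltr_norml; apply/idP/idP; rewrite inE/= in_itv.
  rewrite /indic memS// t1 andbT Phom; case: ifPn => _; last by rewrite !mulr0.
  have -> : x ^+ 4 = `|x| ^+ 4 by rewrite -normrX ger0_norm// exprn_even_ge0.
  by congr (_%:E); rewrite mulr1; ring.
rewrite ge0_integralZl_EFin//; last first.
  by apply/measurable_funTS/measurable_EFinP/measurable_funX; exact: normr_measurable.
rewrite integral_norm_pow5 ?divr_gt0// muleA -EFinM [RHS]muleAC -EFinM.
by congr (_%:E * _)%E; rewrite expr_div_n; ring.
Qed.

End slopes.

Section derivation_rules.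
Context {R : realType} {V : normedModType R}.
Implicit Types (f g : V -> R) (x v : V).

Lemma is_derive_funM f g x v df dg : is_derive x v f df -> is_derive x v g dg ->
  is_derive x v (fun y => f y * g y) (f x * dg + g x * df).
Proof. exact: is_deriveM. Qed.

Lemma is_derive_funD f g x v df dg : is_derive x v f df -> is_derive x v g dg ->
  is_derive x v (fun y => f y + g y) (df + dg).
Proof. exact: is_deriveD. Qed.

Lemma is_derive_funN f x v df : is_derive x v f df ->
  is_derive x v (fun y => - f y) (- df).
Proof. exact: is_deriveN. Qed.

Lemma is_derive_funX f n x v df : is_derive x v f df ->
  is_derive x v (fun y => f y ^+ n) (n%:R * f x ^+ n.-1 * df).
Proof.
move=> fdf; have := is_deriveX n fdf; congr is_derive.
by apply/funext => y; elim: n => [//|n IH]; rewrite !exprS -IH.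
Qed.

Lemma is_derive_funV f x v df : f x != 0 -> is_derive x v f df ->
  is_derive x v (fun y => (f y)^-1) (- df / f x ^+ 2).
Proof.
move=> fx0 [fd dfE]; split; first exact: derivableV.
by rewrite deriveV// dfE /GRing.scale/= mulrC mulrN mulNr.
Qed.

End derivation_rules.

(** * The Euclidean weight of slopes against a monotone factor *)

Section profile.
Context {R : realType}.
Notation mu := (@lebesgue_measure R).
Implicit Types (f rho : R -> R).

Lemma continuous_itv_integrable (a b : R) f : continuous f ->
  mu.-integrable `[a, b] (EFin \o f).
Proof.
move=> cf; apply: continuous_compact_integrable; first exact: segment_compact.
exact: continuous_subspaceT.
Qed.

(** By continuity [f] exceeds f c / 2 on a short interval ending at [c]. Working to the left of [c]
    allows c = 1, an endpoint that is needed below. *)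
Lemma Rintegral_itv_gt0 f c : continuous f -> -1 < c -> c <= 1 ->
  (forall x, -1 <= x <= 1 -> 0 <= f x) -> 0 < f c ->
  0 < \int[mu]_(x in `[-1, 1]) f x.
Proof.
move=> cf c1 c2 f0 fc.
have /cvgrPdist_lt/(_ (f c / 2) ltac:(lra)) /nbhs_ballP[d d0 dP] := cf c.
pose e := Num.min d (c + 1).
have e0 : 0 < e by rewrite lt_min; apply/andP; split => //; lra.
have ed : e <= d by rewrite ge_min lexx.
have ec : e <= c + 1 by rewrite ge_min lexx orbT.
have mf D : measurable_fun D (EFin \o f).
  apply/measurable_EFinP; apply: measurable_funTS.
  exact: continuous_measurable_fun.
apply: (@lt_le_trans _ _ (f c / 2 * e)); first by rewrite mulr_gt0// divr_gt0.
have fin : (\int[mu]_(x in `[(-1)%R, 1%R]) (f x)%:E)%E \is a fin_num.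
  by apply: integrable_fin_num => //; exact: continuous_itv_integrable.
rewrite /Rintegral -lee_fin fineK//.
apply: (@le_trans _ _ (\int[mu]_(x in `](c - e)%R, c[) (f x)%:E)%E); last first.
  apply: ge0_subset_integral => //; first exact: mf.
  by move=> x /=; rewrite !in_itv/= => /andP[x1 x2]; apply/andP; split; lra.
apply: (@le_trans _ _ (\int[mu]_(x in `](c - e)%R, c[) (f c / 2)%:E)%E).
  rewrite (integral_cst _ _ (f c / 2)%:E)//.
  rewrite [X in (_ * X)%E](_ : _ = lebesgue_measure `](c - e)%R, c[%classic)//.
  rewrite lebesgue_measure_itv/= lte_fin.
  rewrite ifT; last lra.
  by rewrite -EFinB -EFinM lee_fin le_eqVlt; apply/orP; left; apply/eqP; ring.
apply: ge0_le_integral => //.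
- by move=> x _; rewrite lee_fin; lra.
- exact: mf.
move=> x xI; rewrite lee_fin; move: xI; rewrite /= in_itv/= => /andP[x1 x2].
have /dP/= : ball c d x by rewrite /ball/= gtr0_norm; lra.
by rewrite ltr_norml; lra.
Qed.

(** The integrand (1 - 6 t^2 + t^4) / N (1, t)^6 for the Euclidean norm. With t = tan a,
    [sector_weight t] dt is cos (4 a) da. *)
Definition sector_weight (t : R) : R := (1 - 6 * t ^+ 2 + t ^+ 4) / (1 + t ^+ 2) ^+ 3.

Lemma onepsqr_gt0 (t : R) : 0 < 1 + t ^+ 2.
Proof. by rewrite ltr_pwDl// sqr_ge0. Qed.

(** This is sin (4 a) / 4 expressed in t = tan a; it vanishes at 1 and at -1. *)
Definition sector_primitive (t : R) : R := t * (1 - t ^+ 2) / (1 + t ^+ 2) ^+ 2.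

Lemma is_derive_sector_primitive (t : R) :
  is_derive t 1 sector_primitive (sector_weight t).
Proof.
have h := onepsqr_gt0 t; have h0 : 1 + t ^+ 2 != 0 by rewrite gt_eqF.
have h2 : (1 + t ^+ 2) ^+ 2 != 0 by rewrite expf_neq0.
have -> : sector_weight t = t * (1 - t ^+ 2) *
    (- (2%:R * (1 + t ^+ 2) ^+ 1 * (0 + 2%:R * t ^+ 1 * 1)) / ((1 + t ^+ 2) ^+ 2) ^+ 2) +
  ((1 + t ^+ 2) ^+ 2)^-1 *
    (t * (0 - 2%:R * t ^+ 1 * 1) + (1 - t ^+ 2) * 1).
  by rewrite /sector_weight; field.
have dsqr : is_derive t 1 (fun t : R => t ^+ 2) (2%:R * t ^+ 1 * 1).
  exact: (is_derive_funX 2 (is_derive_id t 1)).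
apply: is_derive_funM.
  apply: (is_derive_funM (is_derive_id t 1)).
apply: is_derive_funV => //.
suff : is_derive t 1 (fun t : R => (1 + t ^+ 2) ^+ 2)
  (2%:R * (1 + t ^+ 2) ^+ 1 * (0 + 2%:R * t ^+ 1 * 1)).
  by congr is_derive; ring.
exact: (is_derive_funX 2 (is_derive_funD (is_derive_cst (1 : R) t 1) dsqr)).
Qed.

Lemma continuous_sector_weight : continuous sector_weight.
Proof.
move=> t; apply: cvgM.
  apply: cvgD; last exact: exprn_continuous.
  by apply: cvgB; [exact: cvg_cst|apply: cvgM; [exact: cvg_cst|exact: exprn_continuous]].
apply: cvgV; first by rewrite expf_neq0// gt_eqF// onepsqr_gt0.
apply: (cvg_comp (fun t : R => 1 + t ^+ 2) (fun x : R => x ^+ 3)).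
  by apply: cvgD; [exact: cvg_cst|exact: exprn_continuous].
exact: exprn_continuous.
Qed.

Lemma Rintegral_sector_weight : \int[mu]_(t in `[-1, 1]) sector_weight t = 0.
Proof.
have ltN11 : (-1 : R) < 1 by lra.
rewrite /Rintegral (@continuous_FTC2 _ sector_weight sector_primitive)//=.
- by rewrite /sector_primitive !sqrrN !expr1n subrr !mulr0 !mul0r subrr.
- by apply: continuous_subspaceT; exact: continuous_sector_weight.
- have cF t : {for t, continuous sector_primitive}.
    apply/differentiable_continuous/derivable1_diffP.
    by case: (is_derive_sector_primitive t).
  split.
  + by move=> t _; case: (is_derive_sector_primitive t).
  + exact/cvg_at_right_filter/cF.
  + exact/cvg_at_left_filter/cF.
- by move=> t _; rewrite derive1E; case: (is_derive_sector_primitive t).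
Qed.

Lemma sector_weight_even t : sector_weight (- t) = sector_weight t.
Proof. by rewrite /sector_weight sqrrN; congr (_ / _); ring. Qed.

(** The only sign change on [0, 1] is at tan (pi / 8) = sqrt 2 - 1, because the numerator is (1 -
    t^2)^2 - (2 t)^2, with factors 1 - t^2 + 2 t and 2 - (1 + t)^2. *)
Lemma sector_weight_sign (t : R) : 0 <= t <= 1 ->
  if t <= Num.sqrt 2 - 1 then 0 <= sector_weight t else sector_weight t <= 0.
Proof.
move=> /andP[t0 t1].
have s2 : Num.sqrt 2 ^+ 2 = 2 :> R by rewrite sqr_sqrtr.
have s0 : 0 <= Num.sqrt 2 :> R by exact: sqrtr_ge0.
have D0 := exprn_gt0 3 (onepsqr_gt0 t).
have -> : sector_weight t = (1 - t ^+ 2 + 2 * t) *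
    ((Num.sqrt 2 - 1 - t) * (Num.sqrt 2 + 1 + t)) / (1 + t ^+ 2) ^+ 3.
  rewrite /sector_weight; congr (_ / _).
  have -> : (Num.sqrt 2 - 1 - t) * (Num.sqrt 2 + 1 + t) = Num.sqrt 2 ^+ 2 - (1 + t) ^+ 2 by ring.
  by rewrite s2; ring.
have h1 : 0 <= 1 - t ^+ 2 + 2 * t by nra.
have h2 : 0 <= Num.sqrt 2 + 1 + t by lra.
case: leP => ts.
  by rewrite divr_ge0 ?(ltW D0)// mulr_ge0// mulr_ge0//; lra.
rewrite pmulr_lle0 ?invr_gt0//; apply: mulr_ge0_le0 => //.
by apply: mulr_le0_ge0 => //; lra.
Qed.

(** Since the weight has integral zero, the constant [rho t0] may be subtracted from [rho], with
    [t0] the sign change of the weight. The product [H] then has a constant sign by monotonicity,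
    and it suffices that it is nonzero somewhere. *)
Lemma Rintegral_sector_weight_mono_neq0 rho : continuous rho ->
  (forall t, rho (- t) = rho t) ->
  (forall s t, 0 <= s -> s <= t -> t <= 1 -> rho s <= rho t) ->
  rho 0 != rho 1 ->
  \int[mu]_(t in `[-1, 1]) (sector_weight t * rho t) != 0.
Proof.
move=> crho rho_even rho_mono rho01.
have s2 : Num.sqrt 2 ^+ 2 = 2 :> R by rewrite sqr_sqrtr.
have s0 : 0 <= Num.sqrt 2 :> R by exact: sqrtr_ge0.
pose t0 : R := Num.sqrt 2 - 1.
have t00 : 0 <= t0 by rewrite /t0; nra.
have t01 : t0 <= 1 by rewrite /t0; nra.
pose H t := sector_weight t * (rho t0 - rho t).
have cW := continuous_sector_weight.
have cH : continuous H.
  by move=> t; apply: cvgM; [exact: cW|apply: cvgB; [exact: cvg_cst|exact: crho]].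
have H0 t : -1 <= t <= 1 -> 0 <= H t.
  have pos s : 0 <= s <= 1 -> 0 <= H s.
    move=> s01; have := sector_weight_sign s01; case/andP: s01 => s_ge0 s_le1.
    rewrite -/t0; case: leP => [st ws|/ltW ts ws].
      by rewrite mulr_ge0// subr_ge0 rho_mono.
    by rewrite mulr_le0// subr_le0 rho_mono.
  case/andP => t1 t2; have [tge|tlt] := leP 0 t; first by apply: pos; rewrite tge.
  have -> : H t = H (- t) by rewrite /H sector_weight_even rho_even.
  by apply: pos; apply/andP; split; lra.
have Hint : \int[mu]_(t in `[-1, 1]) H t =
    - \int[mu]_(t in `[-1, 1]) (sector_weight t * rho t).
  transitivity (\int[mu]_(t in `[-1, 1]) (rho t0 * sector_weight t - sector_weight t * rho t)).
    by apply: eq_Rintegral => t _; rewrite /H; ring.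
  rewrite RintegralB//.
  - by rewrite RintegralZl ?Rintegral_sector_weight ?mulr0 ?sub0r//;
      exact: continuous_itv_integrable.
  - apply: continuous_itv_integrable => t.
    by apply: cvgM; [exact: cvg_cst|exact: cW].
  - apply: continuous_itv_integrable => t.
    by apply: cvgM; [exact: cW|exact: crho].
suff : 0 < \int[mu]_(t in `[-1, 1]) H t by rewrite Hint oppr_gt0 => /lt_eqF ->.
(* As [rho] takes different values at 0 and 1, it differs from [rho t0] at one of them, and the
   weight there is 1 or -1/2. *)
have [c0|c0] := eqVneq (rho 0) (rho t0).
  apply: (@Rintegral_itv_gt0 _ 1 cH _ _ H0); [lra|lra|].
  have : rho t0 < rho 1 by rewrite lt_neqAle -c0 rho01 c0 rho_mono.
  have -> : H 1 = 2^-1 * (rho 1 - rho t0).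
    by rewrite /H /sector_weight !expr1n; field.
  by rewrite pmulr_rgt0 ?subr_gt0.
apply: (@Rintegral_itv_gt0 _ 0 cH _ _ H0); [lra|lra|].
have : rho 0 < rho t0 by rewrite lt_neqAle c0 rho_mono.
have -> : H 0 = rho t0 - rho 0 by rewrite /H /sector_weight; field.
by rewrite subr_gt0.
Qed.

End profile.

(** * Comparison of the l^p and l^2 norms along slopes *)

Section lp_profile.
Context {R : realType}.
Implicit Types (q x y : R).
Local Opaque powR.

Lemma le_subst (x x' y y' : R) : x = x' -> y = y' -> x <= y -> x' <= y'.
Proof. by move=> -> ->. Qed.

(* Karamata's inequality for the convex function x^q and the pairs
   (1 + a, b + ab), (a + ab, 1 + b), which have the same sum. *)
Lemma powR_ratio_le q (a b : R) : 1 <= q -> 0 <= b -> b <= a -> a <= 1 ->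
  (1 + a `^ q) * (1 + b) `^ q <= (1 + b `^ q) * (1 + a) `^ q.
Proof.
move=> q1 b0 ba a1; have a0 : 0 <= a by exact: le_trans ba.
have a10 : 0 <= 1 + a by rewrite addr_ge0.
have b10 : 0 <= 1 + b by rewrite addr_ge0.
rewrite !mulrDl !mul1r -!powRM//.
(* If the extreme values 1 + a and b + ab coincide, then a = b = 1 and no division is possible. *)
have [ab|ab] := eqVneq (b * (1 + a)) (1 + a).
  have bE : b = 1 by nra.
  have -> : a = 1 by lra.
  by rewrite bE.
have ba0 : 0 < (1 + a) - b * (1 + a) by nra.
(* The weight that writes 1 + b as a convex combination of 1 + a and b + ab. Both pairs having the
   same sum, the complementary weight gives a + ab, and adding the two convexity inequalities
   eliminates [s]. *)
pose s := ((1 + b) - b * (1 + a)) / ((1 + a) - b * (1 + a)).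
have s01 : 0 <= s <= 1.
  by rewrite divr_ge0 ?ler_pdivrMr//; nra.
have sE : s * ((1 + a) - b * (1 + a)) = (1 + b) - b * (1 + a).
  by rewrite /s divfK// gt_eqF.
pose t := Itv01 (proj1 (andP s01)) (proj2 (andP s01)).
have P0 : (1 + a) \in `[0, +oo[%classic by rewrite inE/= in_itv/= a10.
have Q0 : (b * (1 + a)) \in `[0, +oo[%classic by rewrite inE/= in_itv/= mulr_ge0.
have h1 : (s * (1 + a) + (1 - s) * (b * (1 + a))) `^ q <=
    s * (1 + a) `^ q + (1 - s) * (b * (1 + a)) `^ q := convex_powR q1 t P0 Q0.
have h2 : (s * (b * (1 + a)) + (1 - s) * (1 + a)) `^ q <=
    s * (b * (1 + a)) `^ q + (1 - s) * (1 + a) `^ q := convex_powR q1 t Q0 P0.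
have e1 : s * (1 + a) + (1 - s) * (b * (1 + a)) = 1 + b by lra.
have e2 : s * (b * (1 + a)) + (1 - s) * (1 + a) = a * (1 + b) by lra.
rewrite e1 in h1; rewrite e2 in h2.
lra.
Qed.

(** The sixth power of the ratio of the l^2 norm to [N] at (1, t): the factor by which the slope
    integrand for [N] differs from [sector_weight]. *)
Definition slope_ratio (N : R * R -> R) (t : R) : R :=
  (1 + t ^+ 2) ^+ 3 / N (1, t) ^+ 6.

Lemma lp_norm_slope_pow6 q t : 1 <= q -> 0 <= t ->
  lp_norm q%:E (1, t) ^+ 6 = (1 + t `^ q) `^ (6 / q).
Proof.
move=> q1 t0; rewrite -powR_mulrn; last exact: powR_ge0.
by rewrite /lp_norm/= normr1 powR1 ger0_norm// -powRrM mulrC.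
Qed.

Lemma lp_norm_slope_gt0 q t : 1 <= q -> 0 <= t -> 0 < lp_norm q%:E (1, t) ^+ 6.
Proof.
move=> q1 t0; rewrite lp_norm_slope_pow6// powR_gt0// ltr_pwDl// powR_ge0//.
Qed.

(** For q >= 2, [powR_ratio_le] with exponent q / 2 at s^2 <= t^2, raised to the power 6 / q, is the
    claim with denominators cleared. *)
Lemma lp_slope_ratio_mono q s t : 2 <= q -> 0 <= s -> s <= t -> t <= 1 ->
  slope_ratio (lp_norm q%:E) s <= slope_ratio (lp_norm q%:E) t.
Proof.
move=> q2 s0 st t1; have t0 : 0 <= t by exact: le_trans st.
have q1 : 1 <= q by lra.
have q0 : q != 0 by rewrite gt_eqF//; lra.
have e1 : 1 <= q / 2 by lra.
have half x : 0 <= x -> (x ^+ 2) `^ (q / 2) = x `^ q.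
  by move=> x0; rewrite -powR_mulrn// -powRrM mulrC divfK.
have third x : 0 <= x -> (1 + x ^+ 2) `^ (q / 2) `^ (6 / q) = (1 + x ^+ 2) ^+ 3.
  move=> x0; rewrite -powRrM -[RHS]powR_mulrn ?addr_ge0 ?sqr_ge0//.
  by congr (_ `^ _); field.
have st2 : s ^+ 2 <= t ^+ 2 by rewrite lerXn2r.
have t21 : t ^+ 2 <= 1 by rewrite expr_le1.
have := powR_ratio_le e1 (sqr_ge0 s) st2 t21.
rewrite (half t t0) (half s s0) => h0.
have q6 : 0 <= 6 / q by rewrite divr_ge0//; lra.
have onep x y : 0 <= (1 + x `^ y) by rewrite addr_ge0 ?powR_ge0.
have onepR x : 0 <= (1 + x ^+ 2) `^ (q / 2) by exact: powR_ge0.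
have powE x y : 0 <= x -> 0 <= y -> ((1 + x `^ q) * (1 + y ^+ 2) `^ (q / 2)) `^ (6 / q) =
    lp_norm q%:E (1, x) ^+ 6 * (1 + y ^+ 2) ^+ 3.
  move=> x0 y0; apply: (etrans (powRM _ (onep x q) (onepR y))).
  exact: (congr2 *%R (esym (lp_norm_slope_pow6 q1 x0)) (third y y0)).
have := ler_powR_base q6 (mulr_ge0 (onep t q) (onepR s)) h0.
rewrite (powE t s t0 s0) (powE s t s0 t0) => h; rewrite /slope_ratio.
have Ps := lp_norm_slope_gt0 q1 s0; have Pt := lp_norm_slope_gt0 q1 t0.
rewrite (ler_pdivrMr _ _ Ps) mulrAC (ler_pdivlMr _ _ Pt).
by rewrite mulrC [leRHS]mulrC.
Qed.

(** For q <= 2 the roles of the two norms are exchanged: exponent 2 / q at s^q <= t^q, then a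
    cube. *)
Lemma lp_slope_ratio_antimono q s t : 1 <= q -> q <= 2 ->
  0 <= s -> s <= t -> t <= 1 ->
  slope_ratio (lp_norm q%:E) t <= slope_ratio (lp_norm q%:E) s.
Proof.
move=> q1 q2 s0 st t1; have t0 : 0 <= t by exact: le_trans st.
have q0 : 0 < q by lra.
have qn0 : q != 0 by rewrite gt_eqF.
have e1 : 1 <= 2 / q by rewrite ler_pdivlMr// mul1r.
have two x : 0 <= x -> (x `^ q) `^ (2 / q) = x ^+ 2.
  by move=> x0; rewrite -powRrM mulrC divfK// powR_mulrn.
have six x : 0 <= x -> ((1 + x `^ q) `^ (2 / q)) ^+ 3 = lp_norm q%:E (1, x) ^+ 6.
  move=> x0; apply: (etrans _ (esym (lp_norm_slope_pow6 q1 x0))).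
  apply: (etrans (esym (powR_mulrn 3 (powR_ge0 _ _)))); rewrite -powRrM.
  by congr (_ `^ _); field.
have stq : s `^ q <= t `^ q := ler_powR_base (ltW q0) s0 st.
have t1q : t `^ q <= 1.
  by have := ler_powR_base (ltW q0) t0 t1; rewrite powR1.
have := powR_ratio_le e1 (powR_ge0 s q) stq t1q.
rewrite (two t t0) (two s s0) => h.
have nn x y : 0 <= (1 + x ^+ 2) * (1 + y `^ q) `^ (2 / q).
  by apply: mulr_ge0; [apply: addr_ge0; rewrite ?sqr_ge0|exact: powR_ge0].
have powE x y : 0 <= y -> ((1 + x ^+ 2) * (1 + y `^ q) `^ (2 / q)) ^+ 3 =
    (1 + x ^+ 2) ^+ 3 * lp_norm q%:E (1, y) ^+ 6.
  by move=> y0; apply: (etrans (exprMn _ _ _)); congr (_ * _); exact: six.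
have {}h := le_subst (powE t s s0) (powE s t t0) (lerXn2r 3 (nn t s) (nn s t) h).
rewrite /slope_ratio.
have Ps := lp_norm_slope_gt0 q1 s0; have Pt := lp_norm_slope_gt0 q1 t0.
rewrite (ler_pdivrMr _ _ Pt) mulrAC (ler_pdivlMr _ _ Ps).
exact: h.
Qed.

(** The values are 1 and 2^3 / 2^(6 / q); equality forces 6 / q = 3 after taking logarithms. *)
Lemma lp_slope_ratio01 q : 1 <= q -> q != 2 ->
  slope_ratio (lp_norm q%:E) 0 != slope_ratio (lp_norm q%:E) 1.
Proof.
move=> q1 q2; have q0 : 0 < q by lra.
have two0 : 0 <= 1 + 1 :> R by lra.
have lt12 : 1 < 1 + 1 :> R by lra.
have ln2 : 0 < ln (1 + 1 : R) by exact: ln_gt0.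
have N0 : lp_norm q%:E (1, 0) ^+ 6 = 1.
  by rewrite (lp_norm_slope_pow6 q1 (lexx 0)) powR0 ?gt_eqF// addr0 powR1.
have N1 : lp_norm q%:E (1, 1) ^+ 6 = (1 + 1) `^ (6 / q).
  by rewrite (lp_norm_slope_pow6 q1 ler01) powR1.
have E0 : slope_ratio (lp_norm q%:E) 0 = 1.
  apply: (etrans (congr1 (fun x => (1 + 0 ^+ 2) ^+ 3 / x) N0)).
  by rewrite expr0n addr0 expr1n divr1.
have E1 : slope_ratio (lp_norm q%:E) 1 = (1 + 1) ^+ 3 / (1 + 1) `^ (6 / q).
  by apply: (etrans (congr1 (fun x => (1 + 1 ^+ 2) ^+ 3 / x) N1)); rewrite [1 ^+ 2]expr1n.
rewrite E0 E1.
have n0 : (1 + 1) `^ (6 / q) != 0 :> R by rewrite gt_eqF// powR_gt0.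
apply/negP => /eqP e.
have {}e : (1 + 1) `^ (6 / q) = (1 + 1) ^+ 3 :> R.
  by have := congr1 (fun x => x * (1 + 1) `^ (6 / q)) e; rewrite /= mul1r (divfK n0).
have : (6 / q) * ln (1 + 1) = 3%:R * ln (1 + 1).
  apply: (etrans (esym (ln_powR (1 + 1) (6 / q)))).
  exact: (etrans (congr1 (@ln R) (etrans e (esym (powR_mulrn 3 two0)))) (ln_powR _ _)).
move=> /(mulIf (lt0r_neq0 ln2)) e6; move/eqP: q2; apply.
have {e6} : 6 = 3%:R * q by rewrite -e6 divfK// gt_eqF.
by clear; lra.
Qed.

Lemma linf_slope_ratio t : 0 <= t <= 1 ->
  slope_ratio (lp_norm +oo%E) t = (1 + t ^+ 2) ^+ 3.
Proof.
move=> /andP[t0 t1]; rewrite /slope_ratio /lp_norm/= normr1 ger0_norm//.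
by rewrite max_l// expr1n divr1.
Qed.

(** The two directions correspond to exponents above and below 2; distinct values at 0 and 1 exclude
    the Euclidean norm, whose ratio is constant. *)
Definition monotone_slope_ratio (N : R * R -> R) : Prop :=
  ((forall s t, 0 <= s -> s <= t -> t <= 1 -> slope_ratio N s <= slope_ratio N t) \/
   (forall s t, 0 <= s -> s <= t -> t <= 1 -> slope_ratio N t <= slope_ratio N s))
  /\ slope_ratio N 0 != slope_ratio N 1.

Lemma lp_monotone_slope_ratio (p : \bar R) : (1%:E <= p)%E -> p <> 2%:E ->
  monotone_slope_ratio (lp_norm p).
Proof.
case: p => [q| |]; [rewrite lee_fin => q1 q2|move=> _ _|by rewrite leeNy_eq].
- split; last by apply: lp_slope_ratio01 => //; apply/eqP => q2'; apply: q2; rewrite q2'.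
  have [q_le2|q_ge2] := leP q 2; [right|left] => s t s0 st t1.
    exact: lp_slope_ratio_antimono.
  exact: lp_slope_ratio_mono (ltW q_ge2) s0 st t1.
- split; last by rewrite !linf_slope_ratio ?lexx ?ler01//; apply/eqP; lra.
  left => s t s0 st t1; rewrite !linf_slope_ratio.
  + by rewrite lerXn2r ?nnegrE ?addr_ge0 ?sqr_ge0// lerD2l lerXn2r ?nnegrE// (le_trans s0).
  + by rewrite t1 (le_trans s0).
  + by rewrite s0 (le_trans st).
Qed.

End lp_profile.

(** * Reduction of the quartic moment to an integral over slopes *)

Section quartic_moment.
Context {R : realType}.
Notation mu := (@lebesgue_measure R).
Local Notation RM := (measurableTypeR R).
Local Notation M := (borel_plane_measure R).
Variable N : R * R -> R.
Hypothesis gN : symmetric_gauge N.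

Lemma tame_indic (S : set (RM * RM)) : measurable S -> tame (\1_S : R * R -> R).
Proof.
move=> mS; split; first exact: measurable_indic.
by move=> r; exists 1 => w _ _; rewrite indicE; case: (_ \in _); rewrite ?normr1 ?normr0.
Qed.

Lemma ball_integral_indic r f (S : set (RM * RM)) : measurable S ->
  ball_integral N r (fun w => f w * \1_S w) =
  \int[M]_(w in gauge_ball N r `&` S) f w.
Proof.
move=> mS; rewrite Rintegral_mkcondr; apply: eq_Rintegral => w _.
by rewrite patch_indic.
Qed.

(** The plane splits into the cone, its image under the swap and the null diagonals; by symmetry of
    [f] the first two contribute equally. *)
Lemma ball_integral_cone r f : tame f -> (forall w, f (w.2, w.1) = f w) ->
  ball_integral N r f = 2 * \int[M]_(w in gauge_ball N r `&` cone) f w.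
Proof.
move=> tf fsym; pose D : set (RM * RM) := [set w | `|w.1| = `|w.2|].
have mC := @measurable_cone R.
have mD : measurable D.
  rewrite (_ : D = setT `&` (fun w : RM * RM => `|w.1| - `|w.2|) @^-1` [set 0]).
    suff mf : measurable_fun setT (fun w : RM * RM => `|w.1| - `|w.2| : R).
      exact: mf.
    by apply: measurable_funB; apply: measurableT_comp.
  rewrite setTI; apply/seteqP; split => w; rewrite /D/=; first by move=> ->; rewrite subrr.
  by move/eqP; rewrite subr_eq0 => /eqP.
have tC := tameM tf (tame_indic mC); have tD := tameM tf (tame_indic mD).
have tC' : tame (fun w => f w * \1_(@cone R) (w.2, w.1)).
  apply: tameM => //; case: (tame_indic mC) => m b; split.
    exact: (measurableT_comp m (proj1 (@measure_preserving_swap R))).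
  by move=> r'; have [C CP] := b r'; exists C => w w1 w2; exact: CP.
have -> : ball_integral N r f = ball_integral N r
    (fun w => (f w * \1_(@cone R) w + f w * \1_(@cone R) (w.2, w.1)) + f w * \1_D w).
  apply: eq_Rintegral => w _; rewrite -!mulrDr -[LHS]mulr1; congr (_ * _).
  have coneE v : (v \in @cone R) = (`|v.2| < `|v.1|) by apply/idP/idP; rewrite inE.
  have DE v : (v \in D) = (`|v.1| == `|v.2|) by apply/idP/eqP; rewrite inE.
  rewrite !indicE !coneE DE/=.
  by case: ltgtP => _; rewrite ?add0r ?addr0.
rewrite ball_integralD//; last exact: tameD.
rewrite ball_integralD// [X in _ + X + _](_ : _ = ball_integral N r (fun w => f w * \1_(@cone R) w)).
  rewrite [X in _ + X = _](_ : _ = 0).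
    by rewrite addr0 ball_integral_indic// mulr_natl mulr2n.
  rewrite ball_integral_indic// /Rintegral null_set_integral//.
  - by apply: measurableI => //; exact: measurable_gauge_ball.
  - by apply/measurable_EFinP; apply: measurable_funTS; case: tf.
  - apply/eqP; rewrite -measure_le0 -(@diagonal_null R); apply: le_measure.
    + by rewrite inE; apply: measurableI => //; exact: measurable_gauge_ball.
    + by rewrite inE.
    + by move=> w [].
rewrite [RHS](ball_integral_swap gN)//.
by apply: eq_Rintegral => w _ /=; rewrite fsym.
Qed.

Lemma continuous_slope : continuous (fun t : R => N (1, t)).
Proof.
move=> t; have h : ((1 : R), x) @[x --> t] --> ((1 : R), t).
  exact: (cvg_pair (cvg_cst _) cvg_id).
have cN : continuous N by exact: gauge_continuous gN.
exact: (cvg_comp _ N h (cN (1, t))).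
Qed.

Lemma slope_pow6_gt0 t : 0 < N (1, t) ^+ 6.
Proof. by rewrite exprn_gt0// (lt_le_trans ltr01)// gauge_slope_ge1. Qed.

Lemma continuous_slope_div (f : R -> R) : continuous f -> continuous (fun t => f t / N (1, t) ^+ 6).
Proof.
move=> cf t; apply: cvgM; first exact: cf.
apply: cvgV; first by rewrite gt_eqF// slope_pow6_gt0.
apply: (cvg_comp (fun t => N (1, t)) (fun x : R => x ^+ 6)); first exact: continuous_slope.
exact: exprn_continuous.
Qed.

Lemma slope_even t : N (1, - t) = N (1, t).
Proof. by rewrite -[LHS](gauge_norm gN)/= normrN (gauge_norm gN (1, t)). Qed.

Lemma Rintegral_itvoo_itvcc (a b : R) (f : R -> R) : continuous f ->
  \int[mu]_(t in `]a, b[) f t = \int[mu]_(t in `[a, b]) f t.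
Proof.
move=> cf; have ic := continuous_itv_integrable a b cf.
rewrite Rintegral_itv_bndo_bndc; last first.
  by apply: integrableS ic => //; exact: subset_itv_oo_cc.
by rewrite Rintegral_itv_obnd_cbnd//; apply: integrableS ic => //; exact: subset_itv_oc_cc.
Qed.

Definition quintic_const : R := \int[mu]_(x in `[-1, 1]) `|x| ^+ 5.

Lemma continuous_norm_pow5 : continuous (fun x : R => `|x| ^+ 5).
Proof.
move=> x; apply: (cvg_comp _ (fun x : R => x ^+ 5) (cvg_norm cvg_id)).
exact: exprn_continuous.
Qed.

Lemma quintic_const_gt0 : 0 < quintic_const.
Proof.
apply: (Rintegral_itv_gt0 (c := 1) continuous_norm_pow5).
- lra.
- by [].
- by move=> x _; rewrite exprn_ge0.
- by rewrite normr1 expr1n.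
Qed.

Lemma quintic_massE : @quintic_mass R = quintic_const%:E.
Proof.
rewrite /quintic_const -Rintegral_itvoo_itvcc; last exact: continuous_norm_pow5.
rewrite /Rintegral fineK//; apply: integrable_fin_num => //.
apply: integrableS (continuous_itv_integrable (-1) 1 continuous_norm_pow5) => //.
exact: subset_itv_oo_cc.
Qed.

Lemma Rintegral_ball_cone (r : R) (P : R * R -> R) : 0 < r ->
  tame P -> (forall z, 0 <= P z) -> (forall x t, P (x, x * t) = x ^+ 4 * P (1, t)) ->
  continuous (fun t => P (1, t)) ->
  \int[M]_(w in gauge_ball N r `&` cone) P w =
  r ^+ 6 * quintic_const * \int[mu]_(t in `[-1, 1]) (P (1, t) / N (1, t) ^+ 6).
Proof.
move=> r0 [mP _] P0 Phom cP.
rewrite {1}/Rintegral ge0_integral_ball_cone// quintic_massE -EFinM.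
have cQ := continuous_slope_div cP.
rewrite -Rintegral_itvoo_itvcc// /Rintegral -[r ^+ 6 * quintic_const]/(fine (r ^+ 6 * quintic_const)%:E) -fineM//.
apply: integrable_fin_num => //.
apply: integrableS (continuous_itv_integrable (-1) 1 cQ) => //.
exact: subset_itv_oo_cc.
Qed.

(** The real part of (x + i y)^4. *)
Definition quartic (w : R * R) : R := w.1 ^+ 4 - 6 * (w.1 ^+ 2 * w.2 ^+ 2) + w.2 ^+ 4.

Hypothesis mN : monotone_slope_ratio N.

Lemma slope_integral_neq0 :
  \int[mu]_(t in `[-1, 1]) (quartic (1, t) / N (1, t) ^+ 6) != 0.
Proof.
have crho : continuous (slope_ratio N).
  apply: continuous_slope_div => t.
  apply: (cvg_comp (fun t : R => 1 + t ^+ 2) (fun x : R => x ^+ 3)).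
    by apply: cvgD; [exact: cvg_cst|exact: exprn_continuous].
  exact: exprn_continuous.
have rho_even t : slope_ratio N (- t) = slope_ratio N t.
  by rewrite /slope_ratio slope_even sqrrN.
rewrite (_ : Rintegral _ _ _ =
    \int[mu]_(t in `[-1, 1]) (sector_weight t * slope_ratio N t)); last first.
  apply: eq_Rintegral => t _.
  rewrite /quartic/= /sector_weight /slope_ratio.
  have h0 : (1 + t ^+ 2) ^+ 3 != 0 by rewrite expf_neq0// gt_eqF// onepsqr_gt0.
  by rewrite [RHS]mulrA divfK// !expr1n mul1r.
have [[up|down] ne] := mN; first exact: Rintegral_sector_weight_mono_neq0.
(* A decreasing ratio is replaced by its opposite, which increases. *)
suff : \int[mu]_(t in `[-1, 1]) (sector_weight t * - slope_ratio N t) != 0.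
  apply: contra_neq => h.
  transitivity (\int[mu]_(t in `[-1, 1]) (-1 * (sector_weight t * slope_ratio N t))).
    by apply: eq_Rintegral => t _; ring.
  rewrite RintegralZl ?h ?mulr0//; apply: continuous_itv_integrable => t.
  by apply: cvgM; [exact: continuous_sector_weight|exact: crho].
apply: Rintegral_sector_weight_mono_neq0.
- by move=> t; apply: cvgN; exact: crho.
- by move=> t; rewrite rho_even.
- by move=> s t s0 st t1; rewrite lerN2 down.
- by rewrite eqr_opp.
Qed.

(** The exponent 6 is the degree plus the dimension. What matters is that [c] does not depend on
    [r]: the moment is then of exact order r^6. *)
Lemma ball_integral_quartic : exists2 c : R, c != 0 &
  forall r, 0 < r -> ball_integral N r quartic = r ^+ 6 * c.
Proof.
exists (2 * quintic_const * \int[mu]_(t in `[-1, 1]) (quartic (1, t) / N (1, t) ^+ 6)).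
  by rewrite !mulf_neq0// ?slope_integral_neq0// gt_eqF// quintic_const_gt0.
move=> r r0.
(* The cone formula asks for nonnegative integrands, so [quartic] is split into two nonnegative
   quartics. *)
pose P (w : R * R) := w.1 ^+ 4 + w.2 ^+ 4.
pose Q (w : R * R) := 6 * (w.1 ^+ 2 * w.2 ^+ 2).
have tX i : tame (fun w : R * R => w.1 ^+ i) by apply: tameX; exact: tame_fst.
have tY i : tame (fun w : R * R => w.2 ^+ i) by apply: tameX; exact: tame_snd.
have tP : tame P by exact: tameD.
have tQ : tame Q by apply: tameM; [exact: tame_cst|exact: tameM].
have qE : quartic = (fun w => P w - Q w).
  by apply/funext => w; rewrite /quartic /P /Q; ring.
have P0 z : 0 <= P z by rewrite addr_ge0// exprn_even_ge0.
have Q0 z : 0 <= Q z by rewrite mulr_ge0// mulr_ge0// sqr_ge0.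
have cP : continuous (fun t : R => P (1, t)).
  rewrite (_ : (fun t => _) = (fun t : R => 1 ^+ 4 + t ^+ 4))// => t.
  by apply: cvgD; [exact: cvg_cst|exact: exprn_continuous].
have cQ : continuous (fun t : R => Q (1, t)).
  rewrite (_ : (fun t => _) = (fun t : R => 6 * (1 ^+ 2 * t ^+ 2)))// => t.
  apply: cvgM; first exact: cvg_cst.
  by apply: cvgM; [exact: cvg_cst|exact: exprn_continuous].
have tq : tame quartic by rewrite qE; exact: tameB.
rewrite ball_integral_cone//; last first.
  by move=> w; rewrite /quartic/=; ring.
have mBC : measurable (gauge_ball N r `&` cone).
  by apply: measurableI; [exact: measurable_gauge_ball|exact: measurable_cone].
have tI f : tame f -> M.-integrable (gauge_ball N r `&` cone) (EFin \o f).
  move=> tf; apply: integrableS (tame_integrable gN r tf) => //.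
  exact: measurable_gauge_ball.
have -> : \int[M]_(w in gauge_ball N r `&` cone) quartic w =
    \int[M]_(w in gauge_ball N r `&` cone) P w - \int[M]_(w in gauge_ball N r `&` cone) Q w.
  by rewrite qE RintegralB//; exact: tI.
rewrite !Rintegral_ball_cone//; last 2 first.
- by move=> x t; rewrite /Q/=; ring.
- by move=> x t; rewrite /P/=; ring.
have -> : \int[mu]_(t in `[-1, 1]) (quartic (1, t) / N (1, t) ^+ 6) =
    \int[mu]_(t in `[-1, 1]) (P (1, t) / N (1, t) ^+ 6) -
    \int[mu]_(t in `[-1, 1]) (Q (1, t) / N (1, t) ^+ 6).
  rewrite -RintegralB//.
  - by apply: eq_Rintegral => t _; rewrite qE mulrBl.
  - exact/continuous_itv_integrable/continuous_slope_div.
  - exact/continuous_itv_integrable/continuous_slope_div.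
ring.
Qed.

End quartic_moment.

(** * Jets with the mean value property *)

Section taylor.
Context {R : realType}.
Implicit Types (g : nat -> R -> R) (a : nat -> R).

Lemma sum_ord1 (f : nat -> R) : \sum_(i < 1) f i = f 0%N.
Proof. by rewrite big_ord1. Qed.

Lemma sum_ord2 (f : nat -> R) : \sum_(i < 2) f i = f 0%N + f 1%N.
Proof. by rewrite big_ord_recr/= sum_ord1. Qed.

Lemma sum_ord3 (f : nat -> R) : \sum_(i < 3) f i = f 0%N + f 1%N + f 2%N.
Proof. by rewrite big_ord_recr/= sum_ord2. Qed.

Lemma sum_ord4 (f : nat -> R) : \sum_(i < 4) f i = f 0%N + f 1%N + f 2%N + f 3%N.
Proof. by rewrite big_ord_recr/= sum_ord3. Qed.

Lemma sum_ord5 (f : nat -> R) : \sum_(i < 5) f i = f 0%N + f 1%N + f 2%N + f 3%N + f 4%N.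
Proof. by rewrite big_ord_recr/= sum_ord4. Qed.

(** With [n] terms the degree is at most n - 1; [a i] stands for the i-th derivative at the base
    point. *)
Definition taylor_sum n a (s : R) : R := \sum_(i < n) a i * (s ^+ i / i`!%:R).

Lemma taylor_sum0 n a : taylor_sum n.+1 a 0 = a 0.
Proof.
rewrite /taylor_sum big_ord_recl/= expr0 fact0 divr1 mulr1 big1 ?addr0// => i _.
by rewrite expr0n/= mul0r mulr0.
Qed.

Lemma is_derive_taylor_sum n a (s : R) :
  is_derive s 1 (taylor_sum n.+1 a) (taylor_sum n (fun i => a i.+1) s).
Proof.
elim: n => [|n IH].
  rewrite /taylor_sum big_ord0.
  rewrite (_ : (fun s => _) = cst (a 0)); first exact: is_derive_cst.
  by apply/funext => x; rewrite big_ord1 fact0 expr0 divr1 mulr1.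
rewrite (_ : taylor_sum n.+2 a =
    (fun s => taylor_sum n.+1 a s + a n.+1 / n.+1`!%:R * s ^+ n.+1)); last first.
  by apply/funext => x; rewrite /taylor_sum [LHS]big_ord_recr/=; congr (_ + _); ring.
have -> : taylor_sum n.+1 (fun i => a i.+1) s = taylor_sum n (fun i => a i.+1) s +
    (a n.+1 / n.+1`!%:R * (n.+1%:R * s ^+ n * 1) + s ^+ n.+1 * 0).
  rewrite /taylor_sum big_ord_recr/=; congr (_ + _).
  have h1 : n`!%:R != 0 :> R by rewrite pnatr_eq0 -lt0n fact_gt0.
  have h2 : n.+1%:R != 0 :> R by rewrite pnatr_eq0.
  by rewrite factS natrM; move: (n.+1%:R) h2 => c h2; field; rewrite h1 h2.
apply: is_derive_funD.
apply: is_derive_funM; exact: is_derive_funX.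
Qed.

Lemma mvt_bound (f df : R -> R) (s C : R) :
  (forall x : R, is_derive x 1 f (df x)) -> f 0 = 0 ->
  (forall x, `|x| <= `|s| -> `|df x| <= C) -> `|f s| <= C * `|s|.
Proof.
move=> fdf f0 dfC.
have cf x : {for x, continuous f}.
  by apply/differentiable_continuous/derivable1_diffP; case: (fdf x).
have cfw (a b : R) : {within `[a, b], continuous f}.
  by apply: continuous_subspaceT => x; exact: cf.
have [s0|s0] := leP 0 s.
  have [c /=] := MVT_segment s0 (fun x _ => fdf x) (cfw _ _).
  rewrite in_itv/= f0 !subr0 => /andP[c0 cs] ->.
  by rewrite normrM ler_wpM2r// dfC// !ger0_norm.
have [c /=] := MVT_segment (ltW s0) (fun x _ => fdf x) (cfw _ _).
rewrite in_itv/= f0 !sub0r => /andP[sc c0] fsE.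
by rewrite -normrN fsE normrM normrN ler_wpM2r// dfC// (ler0_norm c0) (ltr0_norm s0) lerN2.
Qed.

(** The remainder vanishes at 0 and its derivative is the remainder, one order lower, of the shifted
    sequence [g i.+1]. The mean value theorem at each stage costs a factor |s|; the factor 1 / n! is
    given up for simplicity. *)
Lemma taylor_bound n g (x s B : R) :
  (forall i (y : R), (i < n)%N -> is_derive y 1 (g i) (g i.+1 y)) ->
  (forall t, `|t| <= `|s| -> `|g n (x + t)| <= B) ->
  `|g 0 (x + s) - taylor_sum n (fun i => g i x) s| <= B * `|s| ^+ n.
Proof.
elim: n g s => [|n IH] g s dg gB.
  by rewrite /taylor_sum big_ord0 subr0 expr0 mulr1; exact: gB.
rewrite exprSr mulrA.
pose h t := g 0 (x + t) - taylor_sum n.+1 (fun i => g i x) t.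
pose dh t := g 1%N (x + t) - taylor_sum n (fun i => g i.+1 x) t.
apply: (@mvt_bound h dh).
- move=> t; apply: is_derive_funD.
    have -> : g 1%N (x + t) = g 1%N (x + t) * (0 + 1) by rewrite add0r mulr1.
    apply: (@is_derive1_comp _ (g 0) (fun t => x + t)); first exact: dg.
  by apply: is_derive_funN; exact: is_derive_taylor_sum.
- by rewrite /h addr0 taylor_sum0 subrr.
move=> t ts; apply: (@le_trans _ _ (B * `|t| ^+ n)).
  apply: (IH (fun i => g i.+1)) => [i y ni|t' t't]; first exact: dg.
  exact/gB/(le_trans t't).
rewrite ler_wpM2l//; first exact: le_trans (gB s (lexx _)).
by rewrite lerXn2r.
Qed.

Lemma is_derive_near0 (f : R -> R) (x d e : R) : 0 < e ->
  is_derive x 1 f d -> (forall y, `|y - x| < e -> f y = 0) -> d = 0.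
Proof.
move=> e0 [_ <-] f0; rewrite (near_eq_derive (g := cst 0)); first exact: derive_cst.
apply/nbhs_ballP; exists e => //= y; rewrite /ball/= => xy; apply: f0.
by rewrite distrC.
Qed.

End taylor.

Section jets.
Context {R : realType}.
Local Notation M := (borel_plane_measure R).

(** [F i j] plays the mixed partial derivative of order i in x and j in y. Giving the derivatives as
    a single family builds in the symmetry of mixed partials: both rules land in the same array. *)
Record jet (F : nat -> nat -> R * R -> R) (B : R) : Prop := {
  jet_tame : forall i j, (i <= 6)%N -> (j <= 6)%N -> tame (F i j);
  jet_bound : forall i j z, (i <= 6)%N -> (j <= 6)%N -> `|F i j z| <= B;
  jet_fst : forall i j (x y : R), (i < 6)%N -> (j <= 6)%N ->
    is_derive x 1 (fun x => F i j (x, y)) (F i.+1 j (x, y));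
  jet_snd : forall i j (x y : R), (i <= 6)%N -> (j < 6)%N ->
    is_derive y 1 (fun y => F i j (x, y)) (F i j.+1 (x, y)) }.

(** The range [delta] of the centres and the range [rho] of the radii are separate because averaging
    shrinks the former and keeps the latter. *)
Definition mean_value N (f : R * R -> R) (z0 : R * R) (delta rho : R) : Prop :=
  forall z : R * R, `|z.1 - z0.1| < delta -> `|z.2 - z0.2| < delta ->
  forall r, 0 < r -> r < rho ->
    ball_integral N r (fun w => f (z + w)) = fine (M (gauge_ball N r)) * f z.

Lemma eq0_of_small (L C rho : R) : 0 < rho ->
  (forall r, 0 < r -> r < rho -> `|L| <= C * r) -> L = 0.
Proof.
move=> rho0 LC; apply/eqP; rewrite -normr_le0; apply/ler_addgt0Pr => e e0.
rewrite add0r; pose r := Num.min (rho / 2) (e / (`|C| + 1)).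
have C1 : 0 < `|C| + 1 by rewrite ltr_wpDl.
have r0 : 0 < r by rewrite lt_min !divr_gt0.
have rr : r < rho by rewrite gt_min ltr_pdivrMr// ltr_pMr// ltr1n.
apply: le_trans (LC r r0 rr) _; apply: (@le_trans _ _ ((`|C| + 1) * r)).
  by rewrite ler_pM2r// (le_trans (ler_norm _))// lerDl.
by rewrite mulrC -ler_pdivlMr// ge_min lexx orbT.
Qed.

Section jet_theory.
Variables (F : nat -> nat -> R * R -> R) (B : R).
Hypothesis jF : jet F B.

Lemma jet_bound_ge0 : 0 <= B.
Proof. by apply: le_trans (jet_bound jF (0, 0) (leq0n 6) (leq0n 6)). Qed.

(** An expansion in y nested in one in x; the length 5 - i keeps the total degree at most 4. *)
Definition taylor_plane (z w : R * R) : R :=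
  \sum_(i < 5) (taylor_sum (5 - i) (fun j => F i j z) w.2) * (w.1 ^+ i / i`!%:R).

Lemma pow_fact_le (x e : R) i : `|x| <= e -> `|x ^+ i / i`!%:R| <= e ^+ i.
Proof.
move=> xe; have f0 : 1 <= i`!%:R :> R by rewrite ler1n fact_gt0.
rewrite normrM normfV normrX (@ger0_norm _ i`!%:R)//.
rewrite ler_pdivrMr ?(lt_le_trans ltr01)//.
apply: (@le_trans _ _ (e ^+ i)); first by rewrite lerXn2r ?nnegrE// (le_trans _ xe).
by rewrite ler_peMr// exprn_ge0// (le_trans _ xe).
Qed.

(** The function is expanded in x at the shifted height [y], then each of the five coefficients is
    expanded in y. Each of these six remainders is at most [B * e ^+ 5], hence the constant 6. *)
Lemma taylor_plane_bound (z w : R * R) (e : R) : `|w.1| <= e -> `|w.2| <= e ->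
  `|F 0 0 (z + w) - taylor_plane z w| <= 6 * B * e ^+ 5.
Proof.
move=> w1 w2; have e0 : 0 <= e by exact: le_trans w1.
have B0 := jet_bound_ge0; pose y := z.2 + w.2.
have -> : F 0 0 (z + w) - taylor_plane z w =
  (F 0 0 (z.1 + w.1, y) - taylor_sum 5 (fun i => F i 0 (z.1, y)) w.1) +
  \sum_(i < 5) (F i 0 (z.1, y) - taylor_sum (5 - i) (fun j => F i j z) w.2) *
    (w.1 ^+ i / i`!%:R).
  rewrite [X in _ = _ + X](eq_bigr (fun i : 'I_5 => F i 0 (z.1, y) * (w.1 ^+ i / i`!%:R) -
    taylor_sum (5 - i) (fun j => F i j z) w.2 * (w.1 ^+ i / i`!%:R))); last first.
    by move=> i _; rewrite mulrBl.
  by rewrite sumrB /taylor_plane /taylor_sum addrA subrK.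
have -> : 6 * B * e ^+ 5 = B * e ^+ 5 + \sum_(i < 5) B * e ^+ 5.
  by rewrite (@sum_ord5 _ (fun=> B * e ^+ 5)); ring.
apply: le_trans (ler_normD _ _) _; apply: lerD.
  apply: (@le_trans _ _ (B * `|w.1| ^+ 5)); last first.
    by rewrite ler_wpM2l// lerXn2r.
  apply: (@taylor_bound _ 5 (fun i x => F i 0 (x, y))).
    by move=> i x i5; apply: (jet_fst jF) => //; exact: ltn_trans i5 _.
  by move=> t _; exact: (jet_bound jF).
apply: le_trans (ler_norm_sum _ _ _) _; apply: ler_sum => i _.
have i5 : (i < 5)%N by [].
have i6 : (i <= 6)%N by rewrite ltnW// ltnW// ltnW.
rewrite normrM -[in leRHS](subnK (ltnW i5)) exprD mulrA.
apply: ler_pM => //; last exact: pow_fact_le.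
apply: (@le_trans _ _ (B * `|w.2| ^+ (5 - i))); last first.
  by rewrite ler_wpM2l// lerXn2r.
have := @taylor_bound _ (5 - i) (fun j x => F i j (z.1, x)) z.2 w.2 B.
rewrite -/y; case: {+}z y => z1 z2 y /=; apply.
  move=> j x j5; apply: (jet_snd jF) => //.
  by rewrite (leq_trans j5)// (leq_trans (leq_subr _ _)).
by move=> t _; apply: (jet_bound jF) => //; rewrite (leq_trans (leq_subr _ _)).
Qed.

Variable N : R * R -> R.
Hypothesis gN : symmetric_gauge N.
Hypothesis mN : monotone_slope_ratio N.

Lemma ball_integral_poly r (c : nat -> nat -> R) :
  ball_integral N r (fun w => \sum_(i < 5) \sum_(j < 5) c i j * (w.1 ^+ i * w.2 ^+ j)) =
  \sum_(i < 5) \sum_(j < 5) c i j * moment N r i j.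
Proof.
have tm i j : tame (fun w : R * R => c i j * (w.1 ^+ i * w.2 ^+ j)).
  exact: tameM (tame_cst _) (tame_monomial i j).
rewrite (@ball_integral_sum _ _ gN r 5 (fun i w => \sum_(j < 5) c i j * (w.1 ^+ i * w.2 ^+ j))).
  apply: eq_bigr => i _.
  rewrite (@ball_integral_sum _ _ gN r 5 (fun j w => c i j * (w.1 ^+ i * w.2 ^+ j)))//.
  by apply: eq_bigr => j _; rewrite ball_integralZ//; exact: tame_monomial.
move=> i _; exact: (@tame_sum _ 5 (fun j w => c i j * (w.1 ^+ i * w.2 ^+ j))).
Qed.

Lemma moment00 r : moment N r 0 0 = fine (M (gauge_ball N r)).
Proof.
rewrite -[RHS]mul1r -(ball_integral_cst gN); apply: eq_Rintegral => w _.
by rewrite !expr0 mulr1.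
Qed.

Lemma ball_integral_taylor_plane r z :
  ball_integral N r (taylor_plane z) = F 0 0 z * fine (M (gauge_ball N r)) +
  (F 2 0 z + F 0 2 z) / 2 * moment N r 2 0 +
  (F 4 0 z + F 0 4 z) / 24 * moment N r 4 0 + F 2 2 z / 4 * moment N r 2 2.
Proof.
(* The cutoff pads the triangular sum to a 5 by 5 square, so that one lemma on double sums
   applies. *)
pose c i j := if (i + j < 5)%N then F i j z / (i`!%:R * j`!%:R) else 0.
have tE : taylor_plane z = (fun w => \sum_(i < 5) \sum_(j < 5) c i j * (w.1 ^+ i * w.2 ^+ j)).
  apply/funext => w; rewrite (@sum_ord5 _ (fun i => \sum_(j < 5) c i j * (w.1 ^+ i * w.2 ^+ j))).
  rewrite /taylor_plane (@sum_ord5 _ (fun i =>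
    taylor_sum (5 - i) (F i ^~ z) w.2 * (w.1 ^+ i / i`!%:R))).
  rewrite /taylor_sum.
  rewrite (@sum_ord5 _ (fun j => F 0%N j z * (w.2 ^+ j / j`!%:R))).
  rewrite (@sum_ord4 _ (fun j => F 1%N j z * (w.2 ^+ j / j`!%:R))).
  rewrite (@sum_ord3 _ (fun j => F 2%N j z * (w.2 ^+ j / j`!%:R))).
  rewrite (@sum_ord2 _ (fun j => F 3%N j z * (w.2 ^+ j / j`!%:R))).
  rewrite (@sum_ord1 _ (fun j => F 4%N j z * (w.2 ^+ j / j`!%:R))).
  rewrite (@sum_ord5 _ (fun j => c 0%N j * (w.1 ^+ 0 * w.2 ^+ j))).
  rewrite (@sum_ord5 _ (fun j => c 1%N j * (w.1 ^+ 1 * w.2 ^+ j))).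
  rewrite (@sum_ord5 _ (fun j => c 2%N j * (w.1 ^+ 2 * w.2 ^+ j))).
  rewrite (@sum_ord5 _ (fun j => c 3%N j * (w.1 ^+ 3 * w.2 ^+ j))).
  rewrite (@sum_ord5 _ (fun j => c 4%N j * (w.1 ^+ 4 * w.2 ^+ j))).
  rewrite /c /=.
  have [f2 f3 f4] : [/\ 2`! = 2%N, 3`! = 6%N & 4`! = 24%N] by [].
  by rewrite f2 f3 f4 !fact0 !(factS 0) !fact0 !mul1n; field.
rewrite tE ball_integral_poly//.
rewrite (@sum_ord5 _ (fun i => \sum_(j < 5) c i j * moment N r i j)).
rewrite (@sum_ord5 _ (fun j => c 0%N j * moment N r 0%N j)).
rewrite (@sum_ord5 _ (fun j => c 1%N j * moment N r 1%N j)).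
rewrite (@sum_ord5 _ (fun j => c 2%N j * moment N r 2%N j)).
rewrite (@sum_ord5 _ (fun j => c 3%N j * moment N r 3%N j)).
rewrite (@sum_ord5 _ (fun j => c 4%N j * moment N r 4%N j)).
rewrite !(moment_odd_fst gN _ _ (isT : odd 1)) !(moment_odd_fst gN _ _ (isT : odd 3)).
rewrite !(moment_odd_snd gN _ _ (isT : odd 1)) !(moment_odd_snd gN _ _ (isT : odd 3)).
rewrite (moment_swap gN r 0 2) (moment_swap gN r 0 4) (moment00).
rewrite /c /=.
have [f1 f2 f3 f4] : [/\ 1`! = 1%N, 2`! = 2%N, 3`! = 6%N & 4`! = 24%N] by [].
by rewrite f1 f2 f3 f4 !fact0; field.
Qed.

Variables (z0 : R * R) (delta rho : R).
Hypothesis rho0 : 0 < rho.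
Hypothesis mvF : mean_value N (F 0 0) z0 delta rho.

Local Notation in_square z := (`|z.1 - z0.1| < delta /\ `|z.2 - z0.2| < delta).

(** The mean value property cancels the constant term of the expansion. The remainder
    [6 * B * r ^+ 5], integrated over a ball of area at most 4 r^2, gives 24. *)
Lemma mean_value_taylor (z : R * R) r : in_square z -> 0 < r -> r < rho ->
  `|(F 2 0 z + F 0 2 z) / 2 * moment N r 2 0 +
    (F 4 0 z + F 0 4 z) / 24 * moment N r 4 0 + F 2 2 z / 4 * moment N r 2 2|
  <= 24 * B * r ^+ 7.
Proof.
move=> [z1 z2] r0 rrho.
have tF : tame (fun w => F 0 0 (z + w)) by apply: tame_translate; exact: (jet_tame jF).
have tT : tame (taylor_plane z).
  apply: (@tame_sum _ 5 (fun i w =>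
    taylor_sum (5 - i) (fun j => F i j z) w.2 * (w.1 ^+ i / i`!%:R))) => i _.
  apply: tameM; last by apply: tameM; [apply: tameX; exact: tame_fst|exact: tame_cst].
  apply: (@tame_sum _ (5 - i) (fun j w => F i j z * (w.2 ^+ j / j`!%:R))) => j _.
  apply: tameM; first exact: tame_cst.
  by apply: tameM; [apply: tameX; exact: tame_snd|exact: tame_cst].
have := mvF z1 z2 r0 rrho => mv.
have := ball_integral_taylor_plane r z => tE.
have le : `|ball_integral N r (fun w => F 0 0 (z + w) - taylor_plane z w)| <=
    (6 * B * r ^+ 5) * (4 * r ^+ 2).
  apply: ball_integral_le => //.
  - exact: ltW.
  - exact: tameB.
  - by rewrite mulr_ge0 ?exprn_ge0 ?mulr_ge0 ?jet_bound_ge0// ltW.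
  - by move=> w w1 w2; exact: taylor_plane_bound.
rewrite ball_integralB// mv tE distrC in le.
have -> : 24 * B * r ^+ 7 = (6 * B * r ^+ 5) * (4 * r ^+ 2) by ring.
by congr (`|_| <= _) : le; ring.
Qed.

Lemma moment_pow_le r i j : 0 <= r -> `|moment N r i j| <= r ^+ (i + j) * (4 * r ^+ 2).
Proof.
move=> r0; apply: ball_integral_le => //; first exact: tame_monomial.
  by rewrite exprn_ge0.
move=> w w1 w2; rewrite normrM !normrX exprD.
by apply: ler_pM; rewrite ?exprn_ge0// lerXn2r.
Qed.

Lemma jet_laplace z : in_square z -> F 2 0 z + F 0 2 z = 0.
Proof.
move=> zin; pose L := (F 2 0 z + F 0 2 z) / 2.
suff : L = 0 by rewrite /L => /eqP; rewrite mulf_eq0 invr_eq0 (pnatr_eq0 _ 2) orbF => /eqP.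
have B0 := jet_bound_ge0.
pose A := `|(F 4 0 z + F 0 4 z) / 24|; pose D := `|F 2 2 z / 4|.
(* The factor 256 inverts the lower bound of [moment20_ge], the factors 4 bound the area of the
   ball, and r < 1 reduces r^2 and r^3 to r. *)
apply: (@eq0_of_small L (256 * (24 * B + 4 * A + 4 * D)) (Num.min rho 1)).
  by rewrite lt_min rho0 ltr01.
move=> r r0; rewrite lt_min => /andP[rrho r1].
have := mean_value_taylor zin r0 rrho; rewrite -/L.
have m20 := moment20_ge gN r0.
have m40 := moment_pow_le 4 0 (ltW r0); have m22 := moment_pow_le 2 2 (ltW r0).
have r4 : 0 < r ^+ 4 by rewrite exprn_gt0.
set T := L * _; set U := _ * moment N r 4 0; set V := _ * moment N r 2 2 => h.
have hU : `|U| <= A * (r ^+ 4 * (4 * r ^+ 2)) by rewrite /U normrM ler_wpM2l.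
have hV : `|V| <= D * (r ^+ 4 * (4 * r ^+ 2)) by rewrite /V normrM ler_wpM2l.
have hT : `|T| <= 24 * B * r ^+ 7 + A * (r ^+ 4 * (4 * r ^+ 2)) + D * (r ^+ 4 * (4 * r ^+ 2)).
  have -> : T = (T + U + V) - U - V by ring.
  apply: le_trans (ler_normB _ _) _; apply: lerD => //.
  apply: le_trans (ler_normB _ _) _; exact: lerD.
have hL : `|L| * (r ^+ 4 / 256) <= `|T|.
  by rewrite /T (normrM L) ler_wpM2l// (le_trans m20)// ler_norm.
have {}hL : `|L| * r ^+ 4 <= (256 * (24 * B * r ^+ 3 + 4 * A * r ^+ 2 + 4 * D * r ^+ 2)) * r ^+ 4.
  apply: (@le_trans _ _ (256 * `|T|)).
    by move: `|L| `|T| hL => l t; lra.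
  rewrite -mulrA ler_wpM2l//; apply: le_trans hT _.
  by rewrite le_eqVlt; apply/orP; left; apply/eqP; ring.
rewrite ler_pM2r// in hL; apply: le_trans hL _; rewrite -[leRHS]mulrA ler_wpM2l//.
have A0 : 0 <= A by exact: normr_ge0.
have D0 : 0 <= D by exact: normr_ge0.
have r2 : r ^+ 2 <= r by rewrite expr2 ler_piMr// ltW.
have r3 : r ^+ 3 <= r by rewrite exprS (le_trans _ r2)// expr2 ler_pM2l// (le_trans r2)// lexx.
have h1 : 24 * B * r ^+ 3 <= 24 * B * r by apply: ler_wpM2l => //; exact: mulr_ge0.
have h2 : 4 * A * r ^+ 2 <= 4 * A * r by apply: ler_wpM2l => //; exact: mulr_ge0.
have h3 : 4 * D * r ^+ 2 <= 4 * D * r by apply: ler_wpM2l => //; exact: mulr_ge0.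
apply: le_trans (lerD (lerD h1 h2) h3) _.
by rewrite le_eqVlt; apply/orP; left; apply/eqP; ring.
Qed.

(** The square is open, so a linear relation valid throughout it may be differentiated. A relation
    with a single term is treated as the case c2 = 0. *)
Lemma jet_vanish_fst (c1 c2 : R) i1 j1 i2 j2 :
  (i1 < 6)%N -> (j1 <= 6)%N -> (i2 < 6)%N -> (j2 <= 6)%N ->
  (forall z : R * R, in_square z -> c1 * F i1 j1 z + c2 * F i2 j2 z = 0) ->
  forall z : R * R, in_square z -> c1 * F i1.+1 j1 z + c2 * F i2.+1 j2 z = 0.
Proof.
move=> hi1 hj1 hi2 hj2 V [x y] [/= x1 y1].
have d1 := jet_fst jF x y hi1 hj1; have d2 := jet_fst jF x y hi2 hj2.
have D : is_derive x 1 (fun x => c1 * F i1 j1 (x, y) + c2 * F i2 j2 (x, y))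
    (c1 * F i1.+1 j1 (x, y) + c2 * F i2.+1 j2 (x, y)).
  have := is_derive_funD (is_derive_funM (is_derive_cst c1 x (1 : R)) d1)
    (is_derive_funM (is_derive_cst c2 x (1 : R)) d2).
  by congr is_derive; rewrite !mulr0 !addr0.
have e0 : 0 < delta - `|x - z0.1| by rewrite subr_gt0.
apply: (is_derive_near0 e0 D).
move=> t tx; apply: (V (t, y)); split => //=.
have -> : t - z0.1 = (t - x) + (x - z0.1) by ring.
by rewrite (le_lt_trans (ler_normD _ _))// -ltrBrDr.
Qed.

Lemma jet_vanish_snd (c1 c2 : R) i1 j1 i2 j2 :
  (i1 <= 6)%N -> (j1 < 6)%N -> (i2 <= 6)%N -> (j2 < 6)%N ->
  (forall z : R * R, in_square z -> c1 * F i1 j1 z + c2 * F i2 j2 z = 0) ->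
  forall z : R * R, in_square z -> c1 * F i1 j1.+1 z + c2 * F i2 j2.+1 z = 0.
Proof.
move=> hi1 hj1 hi2 hj2 V [x y] [/= x1 y1].
have d1 := jet_snd jF x y hi1 hj1; have d2 := jet_snd jF x y hi2 hj2.
have D : is_derive y 1 (fun y => c1 * F i1 j1 (x, y) + c2 * F i2 j2 (x, y))
    (c1 * F i1 j1.+1 (x, y) + c2 * F i2 j2.+1 (x, y)).
  have := is_derive_funD (is_derive_funM (is_derive_cst c1 y (1 : R)) d1)
    (is_derive_funM (is_derive_cst c2 y (1 : R)) d2).
  by congr is_derive; rewrite !mulr0 !addr0.
have e0 : 0 < delta - `|y - z0.2| by rewrite subr_gt0.
apply: (is_derive_near0 e0 D).
move=> t ty; apply: (V (x, t)); split => //=.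
have -> : t - z0.2 = (t - y) + (y - z0.2) by ring.
by rewrite (le_lt_trans (ler_normD _ _))// -ltrBrDr.
Qed.

Lemma jet_relations (z : R * R) : in_square z ->
  [/\ F 4 0 z + F 2 2 z = 0, F 2 2 z + F 0 4 z = 0, F 3 0 z + F 1 2 z = 0,
     F 2 1 z + F 0 3 z = 0 & F 3 1 z + F 1 3 z = 0].
Proof.
have V z' : in_square z' -> 1 * F 2 0 z' + 1 * F 0 2 z' = 0.
  by move=> /jet_laplace; rewrite !mul1r.
have V1 := @jet_vanish_fst 1 1 2 0 0 2 isT isT isT isT V.
have V2 := @jet_vanish_snd 1 1 2 0 0 2 isT isT isT isT V.
have V11 := @jet_vanish_fst 1 1 3 0 1 2 isT isT isT isT V1.
have V12 := @jet_vanish_snd 1 1 3 0 1 2 isT isT isT isT V1.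
have V22 := @jet_vanish_snd 1 1 2 1 0 3 isT isT isT isT V2.
move=> zin; move: (V11 z zin) (V12 z zin) (V22 z zin) (V1 z zin) (V2 z zin).
by rewrite !mul1r.
Qed.

(** With [F 2 2] and [F 0 4] expressed by [F 4 0], the surviving moments combine into that of
    [quartic]. It equals r^6 c, against a remainder of order r^7, so division by r^6 leaves a
    constant of order r. *)
Lemma jet_fourth z : in_square z -> F 4 0 z = 0.
Proof.
move=> zin; have [c c0 cE] := ball_integral_quartic gN mN.
have [h40 h04 _ _ _] := jet_relations zin; have h2 := jet_laplace zin.
suff : F 4 0 z / 24 * c = 0.
  by move/eqP; rewrite !mulf_eq0 (negbTE c0) invr_eq0 (pnatr_eq0 _ 24) !orbF => /eqP.
apply: (@eq0_of_small _ (24 * B) rho rho0) => r r0 rrho.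
have r6 : 0 < r ^+ 6 by rewrite exprn_gt0.
have h := mean_value_taylor zin r0 rrho.
rewrite -(ler_pM2r r6); apply: le_trans (le_trans _ h) _; last first.
  by rewrite le_eqVlt; apply/orP; left; apply/eqP; ring.
have q : ball_integral N r quartic = 2 * moment N r 4 0 - 6 * moment N r 2 2.
  rewrite /quartic.
  pose m i j (w : R * R) := w.1 ^+ i * w.2 ^+ j.
  have tm i j : tame (m i j) by exact: tame_monomial.
  transitivity (ball_integral N r (fun w => (m 4%N 0%N w + m 0%N 4%N w) - 6 * m 2%N 2%N w)).
    by apply: eq_Rintegral => w _; rewrite /m; ring.
  rewrite ball_integralB//; [|exact: tameD|exact: tameM (tame_cst _) _].
  rewrite ball_integralD// ball_integralZ//.
  by rewrite -/(moment N r 4 0) -/(moment N r 0 4) (moment_swap gN r 0 4) -/(moment N r 2 2); ring.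
rewrite cE// in q.
have F04 : F 0 4 z = F 4 0 z by lra.
have F22 : F 2 2 z = - F 4 0 z by lra.
rewrite h2 F04 F22 le_eqVlt; apply/orP; left; apply/eqP.
rewrite -[X in _ * X = _](gtr0_norm r6) -normrM; congr (`|_|).
have -> : F 4 0 z / 24 * c * r ^+ 6 = F 4 0 z / 24 * (r ^+ 6 * c) by ring.
by rewrite q; field.
Qed.

(* The jet on the square is therefore the Taylor polynomial of bidegree (3, 3),
   in which only the eight coefficients of harmonic polynomials survive. *)
Definition jet_coef (i : nat) : R :=
  nth 0 [:: F 0 0 z0; F 1 0 z0; F 0 1 z0; F 1 1 z0; F 2 0 z0 / 2;
            F 1 2 z0 / 2; F 1 3 z0 / 6; F 2 1 z0 / 2] i.

(** These derivatives are the remainders of the cubic expansions in x and then in y, which their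
    vanishing makes exact. *)
Lemma jet_square_zero :
  (forall z, in_square z -> F 4 0 z = 0) /\
  (forall i, (i <= 3)%N -> forall z, in_square z -> F i 4 z = 0).
Proof.
have V40 z : in_square z -> F 4 0 z = 0 by exact: jet_fourth.
split => //.
have V04 z : in_square z -> 1 * F 0 4 z + 0 * F 0 0 z = 0.
  by move=> zin; have [h1 h2 _ _ _] := jet_relations zin; have := V40 z zin; lra.
have V14 := @jet_vanish_fst 1 0 0 4 0 0 isT isT isT isT V04.
have V24 := @jet_vanish_fst 1 0 1 4 1 0 isT isT isT isT V14.
have V34 := @jet_vanish_fst 1 0 2 4 2 0 isT isT isT isT V24.
move=> [|[|[|[|//]]]] _ z zin.
- by have := V04 z zin; rewrite mul1r mul0r addr0.
- by have := V14 z zin; rewrite mul1r mul0r addr0.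
- by have := V24 z zin; rewrite mul1r mul0r addr0.
- by have := V34 z zin; rewrite mul1r mul0r addr0.
Qed.

Definition harmonic_combination (a : nat -> R) (w : R * R) : R :=
  a 0%N + a 1%N * w.1 + a 2%N * w.2 + a 3%N * (w.1 * w.2) + a 4%N * (w.1 ^+ 2 - w.2 ^+ 2)
  + a 5%N * (w.1 * w.2 ^+ 2 - w.1 ^+ 3 / 3)
  + a 6%N * (w.1 * w.2 ^+ 3 - w.1 ^+ 3 * w.2)
  + a 7%N * (w.1 ^+ 2 * w.2 - w.2 ^+ 3 / 3).

(** [taylor_bound] with bound 0 gives equalities. Of the sixteen coefficients of bidegree at most
    (3, 3), the four with both indices at least 2 vanish since [F 2 2] does, and [F 0 2], [F 3 0],
    [F 0 3], [F 3 1] are tied to others by the Laplace equation and its derivatives. *)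
Lemma jet_harmonic_combination (w : R * R) : `|w.1| < delta -> `|w.2| < delta ->
  F 0 0 (z0 + w) = harmonic_combination jet_coef w.
Proof.
move=> w1 w2; have delta0 : 0 < delta by exact: le_lt_trans w1.
have [V4 V4'] := jet_square_zero.
pose y := z0.2 + w.2.
have row i : (i <= 3)%N -> F i 0 (z0.1, y) = taylor_sum 4 (fun j => F i j z0) w.2.
  move=> i3; apply/eqP; rewrite -subr_eq0 -normr_le0.
  rewrite -[leRHS](mul0r (`|w.2| ^+ 4)).
  have := @taylor_bound _ 4 (fun j x => F i j (z0.1, x)) z0.2 w.2 0.
  rewrite -/y; case: {+}z0 y V4' => a b y V4' /=; apply.
    by move=> j x j4; apply: (jet_snd jF); rewrite ?(leq_trans i3)// (leq_trans j4).
  move=> t tw; rewrite V4' ?normr0//=; rewrite subrr normr0; split => //.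
  by rewrite addrC addKr (le_lt_trans tw).
have col : F 0 0 (z0.1 + w.1, y) = taylor_sum 4 (fun i => F i 0 (z0.1, y)) w.1.
  apply/eqP; rewrite -subr_eq0 -normr_le0 -[leRHS](mul0r (`|w.1| ^+ 4)).
  apply: (@taylor_bound _ 4 (fun i x => F i 0 (x, y))).
    by move=> i x i4; apply: (jet_fst jF) => //; rewrite (leq_trans i4).
  move=> t tw; rewrite V4 ?normr0//=; split; rewrite addrC addKr//.
  exact: le_lt_trans tw _.
have -> : F 0 0 (z0 + w) = F 0 0 (z0.1 + w.1, y) by [].
have in0 : in_square z0 by rewrite !subrr normr0.
rewrite col /taylor_sum (@sum_ord4 _ (fun i => F i 0 (z0.1, y) * (w.1 ^+ i / i`!%:R))).
rewrite !row// /taylor_sum.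
rewrite (@sum_ord4 _ (fun j => F 0%N j z0 * (w.2 ^+ j / j`!%:R))).
rewrite (@sum_ord4 _ (fun j => F 1%N j z0 * (w.2 ^+ j / j`!%:R))).
rewrite (@sum_ord4 _ (fun j => F 2%N j z0 * (w.2 ^+ j / j`!%:R))).
rewrite (@sum_ord4 _ (fun j => F 3%N j z0 * (w.2 ^+ j / j`!%:R))).
have V22 z : in_square z -> 1 * F 2 2 z + 0 * F 0 0 z = 0.
  by move=> zin; have [h1 h2 _ _ _] := jet_relations zin; have := V4 z zin; lra.
have V32 := @jet_vanish_fst 1 0 2 2 0 0 isT isT isT isT V22.
have V23 := @jet_vanish_snd 1 0 2 2 0 0 isT isT isT isT V22.
have V33 := @jet_vanish_snd 1 0 3 2 1 0 isT isT isT isT V32.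
have [_ _ h30 h21 h31] := jet_relations in0; have h20 := jet_laplace in0.
have E22 := V22 z0 in0; have E32 := V32 z0 in0; have E23 := V23 z0 in0.
have E33 := V33 z0 in0.
have [f1 f2 f3] : [/\ 1`! = 1%N, 2`! = 2%N & 3`! = 6%N] by [].
rewrite f1 f2 f3 fact0 /harmonic_combination /jet_coef /=.
have -> : F 2 2 z0 = 0 by lra.
have -> : F 3 2 z0 = 0 by lra.
have -> : F 2 3 z0 = 0 by lra.
have -> : F 3 3 z0 = 0 by lra.
have -> : F 0 2 z0 = - F 2 0 z0 by lra.
have -> : F 3 0 z0 = - F 1 2 z0 by lra.
have -> : F 0 3 z0 = - F 2 1 z0 by lra.
have -> : F 3 1 z0 = - F 1 3 z0 by lra.
by field.
Qed.

End jet_theory.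
End jets.

(** * Steklov means *)

Section average.
Context {R : realType}.
Notation mu := (@lebesgue_measure R).
Implicit Types (g : R -> R) (h : R).

Definition average h g : R := h^-1 * \int[mu]_(s in `[0, h]) g s.

Lemma average_cst h c : 0 < h -> average h (fun=> c) = c.
Proof.
move=> h0; rewrite /average Rintegral_cst//.
rewrite [X in fine X](_ : _ = h%:E)/=; first by rewrite mulrCA mulVf ?mulr1// gt_eqF.
by rewrite lebesgue_measure_itv/= lte_fin h0 -EFinB subr0.
Qed.

Lemma averageB h g1 g2 : continuous g1 -> continuous g2 ->
  average h (fun s => g1 s - g2 s) = average h g1 - average h g2.
Proof.
by move=> c1 c2; rewrite /average RintegralB ?mulrBr//; exact: continuous_itv_integrable.
Qed.

Lemma average_le h g c : 0 < h -> continuous g ->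
  (forall s, 0 <= s <= h -> g s <= c) -> average h g <= c.
Proof.
move=> h0 cg gc; rewrite -[leRHS](average_cst c h0) /average ler_wpM2l//.
  by rewrite invr_ge0 ltW.
apply: le_Rintegral => //.
- exact: continuous_itv_integrable.
- by apply: continuous_itv_integrable => x; exact: cvg_cst.
Qed.

Lemma average_dist_le h g c e : 0 < h -> continuous g ->
  (forall s, 0 <= s <= h -> `|g s - c| <= e) -> `|average h g - c| <= e.
Proof.
move=> h0 cg gc; rewrite ler_norml; apply/andP; split.
  have cN : continuous (fun s : R => c - g s) by move=> x; apply: cvgB; [exact: cvg_cst|exact: cg].
  suff : average h (fun s => c - g s) <= e.
    have cc : continuous ((fun=> c) : R -> R) by move=> x; exact: cvg_cst.
    by rewrite averageB// average_cst//; lra.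
  apply: average_le => // s /gc; rewrite distrC => gs.
  exact: le_trans (ler_norm _) gs.
rewrite lerBlDr; apply: average_le => // s /gc gs.
by rewrite -lerBlDr; exact: le_trans (ler_norm _) gs.
Qed.

Lemma average_dist2_le h g1 g2 e : 0 < h -> continuous g1 -> continuous g2 ->
  (forall s, 0 <= s <= h -> `|g1 s - g2 s| <= e) ->
  `|average h g1 - average h g2| <= e.
Proof.
move=> h0 c1 c2 g12; rewrite -averageB// -[X in `|X|]subr0.
apply: average_dist_le => // [x|s /g12]; last by rewrite subr0.
by apply: cvgB; [exact: c1|exact: c2].
Qed.

(** The mean is (P (x + h) - P x) / h for a primitive [P] of [g]. This is where a continuous
    function gains a derivative, and the derivative is again built from values of [g]. *)
Lemma is_derive_average h g (x0 : R) : 0 < h -> continuous g ->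
  is_derive x0 1 (fun x => average h (fun s => g (x + s))) ((g (x0 + h) - g x0) / h).
Proof.
(* The primitive is based at x0 - 1 and used up to x0 + h + 2: for |x - x0| < 1 the whole window
   from x to x + h is interior. *)
move=> h0 cg; pose a := x0 - 1; pose u := x0 + h + 2.
pose P y := \int[mu]_(t in `[a, y]) g t.
have ig := continuous_itv_integrable a u cg.
have dP y : a < y -> y < u -> is_derive y 1 P (g y).
  move=> ay yu; have [d e] := continuous_FTC1_closed yu ig ay (cg y).
  by split; [exact: d|rewrite -derive1E].
have dPx x y : a < x + y -> x + y < u -> is_derive y 1 (fun s => P (x + s)) (g (x + y)).
  move=> xy1 xy2; have -> : g (x + y) = g (x + y) * (0 + 1) by rewrite add0r mulr1.
  have d := is_derive_funD (is_derive_cst x y (1 : R)) (is_derive_id y (1 : R)).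
  exact: (@is_derive1_comp _ P (fun s => x + s) y _ _ (dP _ xy1 xy2) d).
have avgE x : `|x - x0| < 1 -> average h (fun s => g (x + s)) = (P (x + h) - P x) / h.
  rewrite ltr_norml => /andP[x1 x2].
  have cPx y : a < x + y -> x + y < u -> {for y, continuous (fun s => P (x + s))}.
    move=> xy1 xy2; apply/differentiable_continuous/derivable1_diffP.
    by case: (dPx x y xy1 xy2).
  have := @continuous_FTC2 _ (fun s => g (x + s)) (fun s => P (x + s)) 0 h h0.
  rewrite addr0 /average /Rintegral mulrC => ->//.
  - apply: continuous_subspaceT => s; apply: (cvg_comp (fun s => x + s) g); last exact: cg.
    by apply: cvgD; [exact: cvg_cst|exact: cvg_id].
  - split.
    + move=> s; rewrite in_itv/= => /andP[s0 sh].
      by case: (dPx x s ltac:(rewrite /a; lra) ltac:(rewrite /u; lra)).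
    + by apply/cvg_at_right_filter/cPx; rewrite ?/a ?/u; lra.
    + by apply/cvg_at_left_filter/cPx; rewrite ?/a ?/u; lra.
  - move=> s; rewrite in_itv/= => /andP[s0 sh]; rewrite derive1E.
    by case: (dPx x s ltac:(rewrite /a; lra) ltac:(rewrite /u; lra)).
apply: (near_eq_is_derive (f := fun x => (P (x + h) - P x) * h^-1)).
  apply/nbhs_ballP; exists 1 => //= x; rewrite /ball/= distrC => xx0.
  by rewrite avgE.
have d1 : is_derive x0 1 (fun x => P (h + x)) (g (h + x0)).
  by apply: dPx; rewrite ?/a ?/u; lra.
have d2 : is_derive x0 1 P (g x0) by apply: dP; rewrite ?/a ?/u; lra.
have d := is_derive_funM (is_derive_funD d1 (is_derive_funN d2)) (is_derive_cst h^-1 x0 (1 : R)).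
rewrite (_ : (fun x => _) = (fun x => (P (h + x) - P x) * cst h^-1 x)).
  by move: d; congr is_derive; rewrite mulr0 add0r mulrC [h + x0]addrC.
by apply/funext => x; rewrite [x + h]addrC.
Qed.

End average.

Section Rintegral_Fubini.
Context d1 d2 (T1 : measurableType d1) (T2 : measurableType d2) (R : realType).
Variables (m1 : {sigma_finite_measure set T1 -> \bar R})
          (m2 : {sigma_finite_measure set T2 -> \bar R}).

(** Boundedness on a product of sets of finite measure makes the extension by 0 integrable, and the
    extended Fubini theorem applies to it. *)
Lemma Rintegral_Fubini (A : set T1) (B : set T2) (f : T1 * T2 -> R) (C : R) :
  measurable A -> measurable B -> (m1 A < +oo)%E -> (m2 B < +oo)%E ->
  measurable_fun setT f -> (forall z, `|f z| <= C) ->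
  \int[m1]_(x in A) \int[m2]_(y in B) f (x, y) =
  \int[m2]_(y in B) \int[m1]_(x in A) f (x, y).
Proof.
move=> mA mB fA fB mf fC.
have mAB : measurable (A `*` B) by exact: measurableX.
pose G : T1 * T2 -> \bar R := (EFin \o f) \_ (A `*` B).
have iG : (m1 \x m2)%E.-integrable setT G.
  apply/(integrable_mkcond _ mAB); apply: measurable_bounded_integrable => //.
  - rewrite -[X in (X < _)%E]/((m1 \x m2)%E (A `*` B)) product_measure1E//.
    by rewrite lte_mul_pinfty// ge0_fin_numE.
  - exact: measurable_funTS.
  - exists C; split; first exact: num_real.
    by move=> D CD z _; apply: (le_trans (fC z)); exact: ltW.
have Fub := Fubini iG.
have bint d (T : measurableType d) (m : {measure set T -> \bar R}) (D : set T) (g : T -> R) :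
    measurable D -> (m D < +oo)%E -> measurable_fun setT g -> (forall z, `|g z| <= C) ->
    (\int[m]_(x in D) (g x)%:E)%E \is a fin_num.
  move=> mD fD mg gC; apply: integrable_fin_num => //.
  apply: measurable_bounded_integrable => //; first exact: measurable_funTS.
  exists C; split; first exact: num_real.
  by move=> E CE z _; apply: (le_trans (gC z)); exact: ltW.
have E1 : (\int[m1]_x \int[m2]_y G (x, y) =
    \int[m1]_(x in A) (\int[m2]_(y in B) f (x, y))%:E)%E.
  rewrite [RHS]integral_mkcond; apply: eq_integral => x _; rewrite patchE.
  case: ifPn => xA.
    rewrite /Rintegral fineK; last by apply: bint => //; exact: measurableT_comp.
    rewrite [RHS]integral_mkcond; apply: eq_integral => y _.
    by rewrite /G !patchE in_setX/= xA.
  by apply: integral0_eq => y _; rewrite /G patchE in_setX/= (negbTE xA).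
have E2 : (\int[m2]_y \int[m1]_x G (x, y) =
    \int[m2]_(y in B) (\int[m1]_(x in A) f (x, y))%:E)%E.
  rewrite [RHS]integral_mkcond; apply: eq_integral => y _; rewrite patchE.
  case: ifPn => yB.
    rewrite /Rintegral fineK; last by apply: bint => //; exact: measurableT_comp.
    rewrite [RHS]integral_mkcond; apply: eq_integral => x _.
    by rewrite /G !patchE in_setX/= yB andbT.
  by apply: integral0_eq => x _; rewrite /G patchE in_setX/= (negbTE yB) andbF.
by rewrite /Rintegral in E1 E2 *; rewrite -E1 -E2 Fub.
Qed.

End Rintegral_Fubini.

Section plane_sigma_finite.
Variable R : realType.
Local Notation RM := (measurableTypeR R).

Lemma plane_sigma_finite : sigma_finite setT (borel_plane_measure R).
Proof.
exists (fun n => `](- n%:R), n%:R[%classic `*` `](- n%:R), n%:R[%classic) => [|n].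
  apply/seteqP; split => // z _; exists (Num.bound (`|z.1| + `|z.2|)) => //=.
  have := @archi_boundP R (`|z.1| + `|z.2|) (addr_ge0 (normr_ge0 _) (normr_ge0 _)).
  have := normr_ge0 z.1; have := normr_ge0 z.2.
  by rewrite !in_itv/= -!ltr_norml; lra.
split; first exact: measurableX.
by rewrite plane_measure_square ?ltry// ge0_cp.
Qed.

(** Exchanging a ball integral with an average over a segment is Fubini on plane times line, which
    calls for a sigma-finite structure on the plane measure. *)
Definition plane_sigma_finite_measure :
    {sigma_finite_measure set (RM * RM)%type -> \bar R} :=
  HB.pack (Measure.sort (borel_plane_measure R))
    (Measure_isSigmaFinite.Build _ _ _ (borel_plane_measure R) plane_sigma_finite).

End plane_sigma_finite.

Section steklov.
Context {R : realType}.
Notation mu := (@lebesgue_measure R).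
Local Notation RM := (measurableTypeR R).
Local Notation M := (borel_plane_measure R).
Implicit Types (f g : R * R -> R).

(** Means, difference quotients and the swap preserve this class. The bound [B] is tracked because
    it feeds the bound of the jet; the modulus controls the distance from a function to its
    means. *)
Definition bounded_unif_continuous (B : R) f : Prop :=
  (forall z, `|f z| <= B) /\
  forall e, 0 < e -> exists2 d, 0 < d & forall z w : R * R,
    `|z.1 - w.1| < d -> `|z.2 - w.2| < d -> `|f z - f w| <= e.

Local Notation buc := bounded_unif_continuous.

(** Operators in the second variable are conjugates by this swap of those in the first, so that each
    analytic fact is proved once. *)
Definition swap_fun f : R * R -> R := fun z => f (z.2, z.1).

Lemma swap_funK f : swap_fun (swap_fun f) = f.
Proof. by apply/funext => -[]. Qed.

Lemma buc_swap B f : buc B f -> buc B (swap_fun f).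
Proof.
move=> [fB uf]; split => [z|e e0]; first exact: fB.
by have [d d0 dP] := uf e e0; exists d => // z w z1 z2; exact: dP.
Qed.

Lemma buc_continuous B f : buc B f -> continuous f.
Proof.
move=> [_ uf] z; apply/cvgrPdist_le => e e0; have [d d0 dP] := uf e e0.
apply: filterS (nbhsx_ballx z d d0) => w [zw1 zw2]; exact: dP.
Qed.

Lemma buc_tame B f : buc B f -> tame f.
Proof.
move=> bf; split; last by move=> r; exists B => w _ _; exact: (proj1 bf).
by apply: continuous_plane_measurable; exact: (buc_continuous bf).
Qed.

Lemma buc_row B f (x y : R) : buc B f -> continuous (fun s : R => f (x + s, y)).
Proof.
move=> [_ uf] s; apply/cvgrPdist_le => e e0; have [d d0 dP] := uf e e0.
apply: filterS (nbhsx_ballx s d d0) => t; rewrite /ball/= => st; apply: dP => /=.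
  by rewrite opprD addrACA subrr add0r.
by rewrite subrr normr0.
Qed.

Variable h : R.
Hypothesis h0 : 0 < h.

Definition steklov1 f : R * R -> R := fun z => average h (fun s => f (z.1 + s, z.2)).
Definition steklov2 f : R * R -> R := swap_fun (steklov1 (swap_fun f)).
Definition quotient1 f : R * R -> R := fun z => (f (z.1 + h, z.2) - f z) / h.
Definition quotient2 f : R * R -> R := swap_fun (quotient1 (swap_fun f)).

Lemma buc_steklov1 B f : buc B f -> buc B (steklov1 f).
Proof.
move=> bf; have [fB uf] := bf; split => [z|e e0].
  rewrite -[steklov1 f z]subr0; apply: average_dist_le => //; first exact: buc_row bf.
  by move=> s _; rewrite subr0.
have [d d0 dP] := uf e e0; exists d => // z w zw1 zw2.
apply: average_dist2_le => //; [exact: buc_row bf|exact: buc_row bf|move=> s _].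
by apply: dP => //=; rewrite opprD addrACA subrr addr0.
Qed.

Lemma buc_steklov2 B f : buc B f -> buc B (steklov2 f).
Proof. by move=> bf; exact/buc_swap/buc_steklov1/buc_swap. Qed.

Lemma buc_quotient1 B f : buc B f -> buc (2 / h * B) (quotient1 f).
Proof.
have hV : 0 < h^-1 by rewrite invr_gt0.
move=> [fB uf]; split => [z|e e0].
  rewrite normrM (gtr0_norm hV) (_ : 2 / h * B = (B + B) / h); last by ring.
  by rewrite ler_pM2r// (le_trans (ler_normB _ _))// lerD.
have [d d0 dP] := uf (e * h / 2) ltac:(by rewrite !mulr_gt0).
exists d => // z w zw1 zw2; rewrite /quotient1 -mulrBl normrM (gtr0_norm hV).
rewrite ler_pdivrMr//.
have -> : f (z.1 + h, z.2) - f z - (f (w.1 + h, w.2) - f w) =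
  (f (z.1 + h, z.2) - f (w.1 + h, w.2)) - (f z - f w) by ring.
rewrite (le_trans (ler_normB _ _))// [leRHS]splitr; apply: lerD; last exact: dP.
by apply: dP => //=; rewrite opprD addrACA subrr addr0.
Qed.

Lemma buc_quotient2 B f : buc B f -> buc (2 / h * B) (quotient2 f).
Proof. by move=> bf; exact/buc_swap/buc_quotient1/buc_swap. Qed.

Lemma is_derive_steklov1 B f (x y : R) : buc B f ->
  is_derive x 1 (fun x => steklov1 f (x, y)) (quotient1 f (x, y)).
Proof.
move=> bf; have cf : continuous (fun x => f (x, y)).
  rewrite (_ : (fun x => _) = (fun s => f (0 + s, y))); first exact: buc_row bf.
  by apply/funext => s; rewrite add0r.
exact: (is_derive_average x h0 cf).
Qed.

Lemma averageE (g : R -> R) : continuous g ->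
  average h g = \int[mu]_(s in `[0, h]) (h^-1 * g s).
Proof. by move=> cg; rewrite RintegralZl//; exact: continuous_itv_integrable. Qed.

Lemma segment_fin (a b : R) : (mu `[a, b] < +oo)%E.
Proof. by rewrite lebesgue_measure_itv/=; case: ifP => _; rewrite -?EFinB ltry. Qed.

Lemma buc_col B f (x y : R) : buc B f -> continuous (fun s : R => f (x, y + s)).
Proof. by move=> /buc_swap /(@buc_row _ _ y x). Qed.

Lemma steklovC B f : buc B f -> steklov1 (steklov2 f) = steklov2 (steklov1 f).
Proof.
move=> bf; apply/funext => z.
have hV : 0 < h^-1 by rewrite invr_gt0.
transitivity (h^-1 * \int[mu]_(s in `[0, h]) \int[mu]_(t in `[0, h])
    (h^-1 * f (z.1 + s, z.2 + t))).
  congr (_ * _); apply: eq_Rintegral => s _.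
  by rewrite -averageE//; exact: buc_col bf.
transitivity (h^-1 * \int[mu]_(t in `[0, h]) \int[mu]_(s in `[0, h])
    (h^-1 * f (z.1 + s, z.2 + t))); last first.
  congr (_ * _); apply: eq_Rintegral => t _.
  by rewrite -averageE//; exact: buc_row bf.
congr (_ * _).
have tf : tame (fun w => h^-1 * f (z + w)).
  by apply: tameM; [exact: tame_cst|apply: tame_translate; exact: buc_tame bf].
apply: (@Rintegral_Fubini _ _ _ _ _ mu mu _ _ (fun w => h^-1 * f (z + w)) (h^-1 * B)) => //.
- exact: segment_fin.
- exact: segment_fin.
- by case: tf.
- by move=> w; rewrite normrM gtr0_norm// ler_pM2l//; exact: (proj1 bf).
Qed.

Section mean_value.
Variable N : R * R -> R.
Hypothesis gN : symmetric_gauge N.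

(** Fubini moves the average outside the ball integral. Each translate by s in [0, h] is centred
    within delta + h of [z0], which is the loss in the square. *)
Lemma mean_value_steklov1 B f z0 delta rho : buc B f ->
  mean_value N f z0 (delta + h) rho -> mean_value N (steklov1 f) z0 delta rho.
Proof.
move=> bf mvf z z1 z2 r r0 rrho.
have hV : 0 < h^-1 by rewrite invr_gt0.
transitivity (\int[M]_(w in gauge_ball N r) \int[mu]_(s in `[0, h])
    (h^-1 * f (z.1 + w.1 + s, z.2 + w.2))).
  by apply: eq_Rintegral => w _; rewrite -averageE//; exact: buc_row bf.
have [mf fB] : measurable_fun setT (f : RM * RM -> R) /\ forall z, `|f z| <= B.
  by split; [case: (buc_tame bf)|exact: (proj1 bf)].
rewrite (@Rintegral_Fubini _ _ _ _ _ (plane_sigma_finite_measure R) mu _ _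
    (fun ws : (RM * RM) * RM => h^-1 * f (z.1 + ws.1.1 + ws.2, z.2 + ws.1.2)) (h^-1 * B))//.
- transitivity (\int[mu]_(s in `[0, h]) (fine (M (gauge_ball N r)) * (h^-1 * f (z.1 + s, z.2)))).
    apply: eq_Rintegral => s; rewrite inE/= in_itv/= => /andP[s0 sh].
    transitivity (ball_integral N r (fun w => h^-1 * f ((z.1 + s, z.2) + w))).
      by apply: eq_Rintegral => w _; congr (_ * f (_, _)) => /=; ring.
    rewrite ball_integralZ//; last by apply: tame_translate; exact: buc_tame bf.
    rewrite (mvf (z.1 + s, z.2))//=; first by ring.
    + have -> : z.1 + s - z0.1 = (z.1 - z0.1) + s by ring.
      by rewrite (le_lt_trans (ler_normD _ _))// ltr_leD// ger0_norm.
    + by rewrite (lt_trans z2)// ltrDl.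
  rewrite RintegralZl//; first by rewrite -averageE//; exact: buc_row bf.
  have cr : continuous (fun s => f (z.1 + s, z.2)) by exact: buc_row bf.
  by apply: continuous_itv_integrable => s; exact: (cvgM (cvg_cst _) (cr s)).
- exact: measurable_gauge_ball.
- exact: gauge_ball_measure_fin.
- exact: segment_fin.
- apply: measurable_funM; first exact: measurable_cst.
  apply: (measurableT_comp mf); apply/measurable_fun_pair.
    apply: measurable_funD; last exact: measurable_snd.
    apply: measurable_funD; first exact: measurable_cst.
    exact: (measurableT_comp measurable_fst measurable_fst).
  apply: measurable_funD; first exact: measurable_cst.
  exact: (measurableT_comp measurable_snd measurable_fst).
- by move=> w; rewrite normrM gtr0_norm// ler_pM2l.
Qed.

Lemma mean_value_swap f z0 delta rho : tame f -> mean_value N f z0 delta rho ->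
  mean_value N (swap_fun f) (z0.2, z0.1) delta rho.
Proof.
move=> tf mvf z z1 z2 r r0 rrho; rewrite /swap_fun -(mvf (z.2, z.1))//.
by rewrite [RHS](ball_integral_swap gN)//; exact: tame_translate.
Qed.

Lemma mean_value_steklov2 B f z0 delta rho : buc B f ->
  mean_value N f z0 (delta + h) rho -> mean_value N (steklov2 f) z0 delta rho.
Proof.
move=> bf mvf; have bs := buc_swap bf.
have := mean_value_steklov1 bs (mean_value_swap (buc_tame bf) mvf).
move=> /(mean_value_swap (buc_tame (buc_steklov1 bs))).
by case: z0 {mvf}.
Qed.

End mean_value.

(** Here [eta] is the error accumulated by earlier averages: one more average adds at most the
    oscillation [e]. *)
Lemma steklov1_dist f g B B' e d (eta : R) : buc B f -> buc B' g -> h < d ->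
  (forall z w : R * R, `|z.1 - w.1| < d -> `|z.2 - w.2| < d -> `|f z - f w| <= e) ->
  (forall z, `|g z - f z| <= eta) -> forall z, `|steklov1 g z - f z| <= eta + e.
Proof.
move=> bf bg hd fd gf z; apply: average_dist_le => //; first exact: buc_row bg.
move=> s /andP[s0 sh]; rewrite -(subrK (f (z.1 + s, z.2)) (g _)) -addrA.
rewrite (le_trans (ler_normD _ _))// lerD//; apply: fd => /=.
  by rewrite addrC addKr ger0_norm// (le_lt_trans sh).
by rewrite subrr normr0 (lt_trans h0).
Qed.

Lemma steklov2_dist f g B B' e d (eta : R) : buc B f -> buc B' g -> h < d ->
  (forall z w : R * R, `|z.1 - w.1| < d -> `|z.2 - w.2| < d -> `|f z - f w| <= e) ->
  (forall z, `|g z - f z| <= eta) -> forall z, `|steklov2 g z - f z| <= eta + e.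
Proof.
move=> bf bg hd fd gf z.
have := @steklov1_dist (swap_fun f) (swap_fun g) B B' e d eta (buc_swap bf) (buc_swap bg) hd.
move=> /(_ _ _ (z.2, z.1)); rewrite /steklov2 /swap_fun/= -surjective_pairing; apply => //.
by move=> z' w' h1 h2; exact: fd.
Qed.

End steklov.

(** * Iterated means as jets *)

Section steklov_jet.
Context {R : realType}.
Implicit Types (f g : R * R -> R) (h : R).
Local Notation buc := bounded_unif_continuous.

Lemma buc_weaken B B' f : B <= B' -> buc B f -> buc B' f.
Proof. by move=> BB' [fB uf]; split => // z; exact: le_trans BB'. Qed.

Lemma buc_ge0 B f : buc B f -> 0 <= B.
Proof. by move=> [fB _]; exact: le_trans (fB (0, 0)). Qed.

Definition partial1 f g : Prop :=
  forall x y : R, is_derive x 1 (fun x => f (x, y)) (g (x, y)).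

Variables (h : R) (h0 : 0 < h).
Local Notation S1 := (steklov1 h).
Local Notation S2 := (steklov2 h).
Local Notation D1 := (quotient1 h).
Local Notation D2 := (quotient2 h).

Lemma swap_quotient1 f : swap_fun (D1 f) = D2 (swap_fun f).
Proof. by rewrite /quotient2 swap_funK. Qed.

Lemma swap_quotient2 f : swap_fun (D2 f) = D1 (swap_fun f).
Proof. by rewrite /quotient2 swap_funK. Qed.

Lemma quotientC f : D1 (D2 f) = D2 (D1 f).
Proof. by apply/funext => z; rewrite /quotient2 /quotient1 /swap_fun/=; ring. Qed.

Lemma quotient_iterC f j : iter j D2 (D1 f) = D1 (iter j D2 f).
Proof. by elim: j => //= j ->; rewrite quotientC. Qed.

Lemma quotient_iterC' f i : iter i D1 (D2 f) = D2 (iter i D1 f).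
Proof. by elim: i => //= i ->; rewrite quotientC. Qed.

Lemma quotient_iter_iterC f i j : iter i D1 (iter j D2 f) = iter j D2 (iter i D1 f).
Proof. by elim: j => //= j <-; rewrite quotient_iterC'. Qed.

Lemma buc_iter_steklov1 B f n : buc B f -> buc B (iter n S1 f).
Proof. by move=> bf; elim: n => //= n; exact: buc_steklov1. Qed.

Lemma buc_iter_steklov2 B f n : buc B f -> buc B (iter n S2 f).
Proof. by move=> bf; elim: n => //= n; exact: buc_steklov2. Qed.

Lemma steklov_iterC B f b : buc B f -> S1 (iter b S2 f) = iter b S2 (S1 f).
Proof.
move=> bf; elim: b => //= b <-.
by rewrite (steklovC h0 (buc_iter_steklov2 b bf)).
Qed.

Lemma steklov_iter_iterC B f a b : buc B f ->
  iter a S1 (iter b S2 f) = iter b S2 (iter a S1 f).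
Proof.
move=> bf; elim: a => //= a ->.
by rewrite (steklov_iterC _ (buc_iter_steklov1 a bf)).
Qed.

(** One quotient multiplies the bound by 2 / h; enlarging this to 1 + 2 / h makes the bounds
    increase with [n], so that a single constant serves the whole jet. *)
Lemma buc_iter_quotient1 B f n : buc B f -> buc ((1 + 2 / h) ^+ n * B) (iter n D1 f).
Proof.
move=> bf; elim: n => [|n IH] /=; first by rewrite expr0 mul1r.
have := buc_quotient1 h0 IH; apply: buc_weaken.
by rewrite exprS -[leRHS]mulrA ler_wpM2r ?(buc_ge0 IH)// lerDr.
Qed.

Lemma buc_iter_quotient2 B f n : buc B f -> buc ((1 + 2 / h) ^+ n * B) (iter n D2 f).
Proof.
move=> bf; elim: n => [|n IH] /=; first by rewrite expr0 mul1r.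
have := buc_quotient2 h0 IH; apply: buc_weaken.
by rewrite exprS -[leRHS]mulrA ler_wpM2r ?(buc_ge0 IH)// lerDr.
Qed.

Lemma partial1_quotient1 f g : partial1 f g -> partial1 (D1 f) (D1 g).
Proof.
move=> fg x y.
have d1 : is_derive x 1 (fun x => f (x + h, y)) (g (x + h, y)).
  have d := is_derive_funD (is_derive_id x (1 : R)) (is_derive_cst h x (1 : R)).
  have := @is_derive1_comp _ (fun x => f (x, y)) (fun x => x + h) x _ _ (fg (x + h) y) d.
  by congr is_derive; rewrite addr0 mulr1.
have := is_derive_funM (is_derive_funD d1 (is_derive_funN (fg x y)))
  (is_derive_cst h^-1 x (1 : R)).
by congr is_derive; rewrite mulr0 add0r mulrC.
Qed.

Lemma partial1_quotient2 f g : partial1 f g -> partial1 (D2 f) (D2 g).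
Proof.
move=> fg x y.
have := is_derive_funM (is_derive_funD (fg x (y + h)) (is_derive_funN (fg x y)))
  (is_derive_cst h^-1 x (1 : R)).
by congr is_derive; rewrite mulr0 add0r mulrC.
Qed.

Lemma partial1_iter_quotient1 f g n :
  partial1 f g -> partial1 (iter n D1 f) (iter n D1 g).
Proof. by move=> fg; elim: n => //= n; exact: partial1_quotient1. Qed.

Lemma partial1_iter_quotient2 f g n :
  partial1 f g -> partial1 (iter n D2 f) (iter n D2 g).
Proof. by move=> fg; elim: n => //= n; exact: partial1_quotient2. Qed.

Lemma partial1_steklov1 B f : buc B f -> partial1 (S1 f) (D1 f).
Proof. by move=> bf x y; exact: (is_derive_steklov1 h0 x y bf). Qed.

Lemma swap_iter_quotient1 f n : swap_fun (iter n D1 f) = iter n D2 (swap_fun f).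
Proof. by elim: n => //= n <-; rewrite swap_quotient1. Qed.

Lemma swap_iter_quotient2 f n : swap_fun (iter n D2 f) = iter n D1 (swap_fun f).
Proof. by elim: n => //= n <-; rewrite swap_quotient2. Qed.

(** Differentiation replaces one average by one difference quotient, so order i leaves 6 - i
    averages in x, and likewise in y. *)
Definition steklov_jet f i j : R * R -> R :=
  iter i D1 (iter j D2 (iter (6 - i) S1 (iter (6 - j) S2 f))).

Lemma steklov_jet00 f : steklov_jet f 0 0 = iter 6 S1 (iter 6 S2 f).
Proof.
have iter0 k g : iter 0 k g = g :> (R * R -> R) by [].
by rewrite /steklov_jet subn0 !iter0.
Qed.

Lemma buc_steklov_jet B f i j : buc B f ->
  buc ((1 + 2 / h) ^+ i * ((1 + 2 / h) ^+ j * B)) (steklov_jet f i j).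
Proof.
by move=> bf; exact/buc_iter_quotient1/buc_iter_quotient2/buc_iter_steklov1/buc_iter_steklov2.
Qed.

(** The outermost [S1] is the factor that is differentiated; the resulting [D1] commutes past the
    quotients in y and joins the others. *)
Lemma partial1_steklov_jet B f i j : buc B f -> (i < 6)%N ->
  partial1 (steklov_jet f i j) (steklov_jet f i.+1 j).
Proof.
move=> bf i6; rewrite /steklov_jet (_ : 6 - i = (6 - i.+1).+1)%N; last first.
  by rewrite subnS prednK// subn_gt0.
rewrite iterS [iter i.+1 D1 _]iterSr.
rewrite -quotient_iterC; apply/partial1_iter_quotient1/partial1_iter_quotient2.
exact/partial1_steklov1/buc_iter_steklov1/buc_iter_steklov2/bf.
Qed.

Lemma steklov_jet_swap B f i j : buc B f ->
  swap_fun (steklov_jet f i j) = steklov_jet (swap_fun f) j i.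
Proof.
move=> bf; rewrite /steklov_jet swap_iter_quotient1 swap_iter_quotient2.
rewrite -quotient_iter_iterC; congr (iter _ _ (iter _ _ _)).
have sw1 g n : swap_fun (iter n S1 g) = iter n S2 (swap_fun g).
  by elim: n => //= n <-; rewrite /steklov2 swap_funK.
have sw2 g n : swap_fun (iter n S2 g) = iter n S1 (swap_fun g).
  by elim: n => //= n <-; exact: swap_funK.
by rewrite sw1 sw2 (steklov_iter_iterC _ _ (buc_swap bf)).
Qed.

Lemma jet_steklov B f : buc B f ->
  jet (steklov_jet f) ((1 + 2 / h) ^+ 6 * ((1 + 2 / h) ^+ 6 * B)).
Proof.
move=> bf; have B0 := buc_ge0 bf.
have c1 : 1 <= 1 + 2 / h by rewrite lerDl divr_ge0// ltW.
have c0 : 0 <= 1 + 2 / h by exact: le_trans c1.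
split => [i j _ _|i j z i6 j6|i j x y i6 _|i j x y _ j6].
- exact: (buc_tame (buc_steklov_jet i j bf)).
- apply: le_trans (proj1 (buc_steklov_jet i j bf) z) _.
  have ci k : (k <= 6)%N -> (1 + 2 / h) ^+ k <= (1 + 2 / h) ^+ 6.
    by move=> k6; rewrite ler_weXn2l.
  have cB k : 0 <= (1 + 2 / h) ^+ k * B by apply: mulr_ge0 => //; exact: exprn_ge0.
  by apply: ler_pM; [exact: exprn_ge0|exact: cB|exact: ci|apply: ler_wpM2r => //; exact: ci].
- exact: partial1_steklov_jet bf i6 x y.
- have := partial1_steklov_jet i (buc_swap bf) j6 y x.
  by rewrite -!(steklov_jet_swap _ _ bf).
Qed.

Section mean.
Variable N : R * R -> R.
Hypothesis gN : symmetric_gauge N.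

Lemma mean_value_iter_steklov1 B f z0 delta rho n : buc B f ->
  mean_value N f z0 (delta + n%:R * h) rho -> mean_value N (iter n S1 f) z0 delta rho.
Proof.
move=> bf; elim: n delta => [|n IH] delta; first by rewrite mul0r addr0.
move=> mv; rewrite /=; apply: (mean_value_steklov1 h0 gN (buc_iter_steklov1 n bf)).
by apply: IH; move: mv; congr mean_value; rewrite -natr1; ring.
Qed.

Lemma mean_value_iter_steklov2 B f z0 delta rho n : buc B f ->
  mean_value N f z0 (delta + n%:R * h) rho -> mean_value N (iter n S2 f) z0 delta rho.
Proof.
move=> bf; elim: n delta => [|n IH] delta; first by rewrite mul0r addr0.
move=> mv; rewrite /=; apply: (mean_value_steklov2 h0 gN (buc_iter_steklov2 n bf)).
by apply: IH; move: mv; congr mean_value; rewrite -natr1; ring.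
Qed.

(** There are twelve averages, six per coordinate, and each costs [h] in the square of centres; in
    the same way each contributes one [e] to the distance below. *)
Lemma mean_value_steklov_jet B f z0 delta rho : buc B f ->
  mean_value N f z0 (delta + 12 * h) rho ->
  mean_value N (steklov_jet f 0 0) z0 delta rho.
Proof.
move=> bf mv.
have h1 := @mean_value_iter_steklov2 B f z0 (delta + 6%:R * h) rho 6 bf.
have h2 := @mean_value_iter_steklov1 B (iter 6 S2 f) z0 delta rho 6 (buc_iter_steklov2 6 bf).
have dE : delta + 6%:R * h + 6%:R * h = delta + 12 * h by ring.
by rewrite -dE in mv; rewrite steklov_jet00; exact: h2 (h1 mv).
Qed.

End mean.

Lemma steklov_jet_dist B f e d : buc B f -> 0 <= e -> h < d ->
  (forall z w : R * R, `|z.1 - w.1| < d -> `|z.2 - w.2| < d -> `|f z - f w| <= e) ->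
  forall z, `|steklov_jet f 0 0 z - f z| <= 12 * e.
Proof.
move=> bf e0 hd fd.
have d2 n z : `|iter n S2 f z - f z| <= n%:R * e.
  elim: n z => [|n IH] z; first by rewrite /= subrr normr0 mul0r.
  rewrite -natr1 mulrDl mul1r /=.
  exact: (steklov2_dist h0 bf (buc_iter_steklov2 n bf) hd fd IH).
have d1 n z : `|iter n S1 (iter 6 S2 f) z - f z| <= n%:R * e + 6 * e.
  elim: n z => [|n IH] z; first by rewrite mul0r add0r; exact: d2.
  rewrite -natr1 mulrDl mul1r addrAC /=.
  exact: (steklov1_dist h0 bf (buc_iter_steklov1 n (buc_iter_steklov2 6 bf)) hd fd IH).
move=> z; rewrite steklov_jet00; apply: le_trans (d1 6%N z) _.
by rewrite -mulrDl -natrD.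
Qed.

End steklov_jet.

(** * From means to functions *)

Section interpolation.
Context {R : realType}.
Implicit Types (f g : R * R -> R) (a : nat -> R) (d : R).

(* Finite differences on the grid (d Z)^2 recovering the coefficients of a
   harmonic combination, as lists of weighted nodes. *)
Definition coef_nodes d (k : nat) : seq (R * (R * R)) :=
  match k with
  | 0 => [:: (1, (0, 0))]
  | 1 => [:: (8 / (12 * d), (d, 0)); (- (8 / (12 * d)), (- d, 0));
             (- (12 * d)^-1, (2 * d, 0)); ((12 * d)^-1, (- (2 * d), 0))]
  | 2 => [:: (8 / (12 * d), (0, d)); (- (8 / (12 * d)), (0, - d));
             (- (12 * d)^-1, (0, 2 * d)); ((12 * d)^-1, (0, - (2 * d)))]
  | 3 => [:: ((4 * d ^+ 2)^-1, (d, d)); (- (4 * d ^+ 2)^-1, (- d, d));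
             (- (4 * d ^+ 2)^-1, (d, - d)); ((4 * d ^+ 2)^-1, (- d, - d))]
  | 4 => [:: ((2 * d ^+ 2)^-1, (d, 0)); ((2 * d ^+ 2)^-1, (- d, 0));
             (- (d ^+ 2)^-1, (0, 0))]
  | 5 => [:: (2 / (4 * d ^+ 3), (d, 0)); (- (2 / (4 * d ^+ 3)), (- d, 0));
             (- (4 * d ^+ 3)^-1, (2 * d, 0)); ((4 * d ^+ 3)^-1, (- (2 * d), 0))]
  | 6 => [:: ((24 * d ^+ 4)^-1, (d, 2 * d)); (- (24 * d ^+ 4)^-1, (- d, 2 * d));
             (- (24 * d ^+ 4)^-1, (d, - (2 * d))); ((24 * d ^+ 4)^-1, (- d, - (2 * d)));
             (- (2 / (24 * d ^+ 4)), (d, d)); (2 / (24 * d ^+ 4), (- d, d));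
             (2 / (24 * d ^+ 4), (d, - d)); (- (2 / (24 * d ^+ 4)), (- d, - d))]
  | 7 => [:: (2 / (4 * d ^+ 3), (0, d)); (- (2 / (4 * d ^+ 3)), (0, - d));
             (- (4 * d ^+ 3)^-1, (0, 2 * d)); ((4 * d ^+ 3)^-1, (0, - (2 * d)))]
  | _ => [::]
  end.

Definition node_sum (s : seq (R * (R * R))) f : R := \sum_(n <- s) n.1 * f n.2.

Definition interpolate d f (k : nat) : R := node_sum (coef_nodes d k) f.

(** Parity in each variable separates most coefficients. Those of equal parity are separated by
    nodes at d and 2 d ([a 1] from [a 5], [a 2] from [a 7]), by subtracting the value at 0 ([a 4]
    from [a 0]), or by the vanishing of xy^3 - x^3 y on the diagonals ([a 3] from [a 6]). *)
Lemma interpolate_harmonic d a k : d != 0 -> (k < 8)%N ->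
  interpolate d (harmonic_combination a) k = a k.
Proof.
move=> d0; rewrite /interpolate /node_sum /harmonic_combination.
by case: k => [|[|[|[|[|[|[|[|//]]]]]]]] _;
  rewrite /coef_nodes !big_cons big_nil/=; field.
Qed.

Definition node_weight (s : seq (R * (R * R))) : R := \sum_(n <- s) `|n.1|.

Lemma node_sum_dist s f g e : (forall n, n \in s -> `|f n.2 - g n.2| <= e) ->
  `|node_sum s f - node_sum s g| <= node_weight s * e.
Proof.
rewrite /node_sum /node_weight; elim: s => [|n s IH] H.
  by rewrite !big_nil subrr normr0 mul0r.
rewrite !big_cons mulrDl opprD addrACA -mulrBr.
rewrite (le_trans (ler_normD _ _))// lerD//.
  by rewrite normrM ler_wpM2l// H// mem_head.
by apply: IH => m ms; apply: H; rewrite in_cons ms orbT.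
Qed.

Lemma coef_nodes_small d k n : 0 < d -> n \in coef_nodes d k ->
  `|n.2.1| <= 2 * d /\ `|n.2.2| <= 2 * d.
Proof.
move=> d0; have a0 : `|0 : R| <= 2 * d by rewrite normr0 mulr_ge0// ltW.
have a1 : `|d| <= 2 * d by rewrite gtr0_norm// ler_peMl ?ler1n// ltW.
have a2 : `|2 * d| <= 2 * d by rewrite gtr0_norm// mulr_gt0.
have a1' : `|- d| <= 2 * d by rewrite normrN.
have a2' : `|- (2 * d)| <= 2 * d by rewrite normrN.
have H : all (fun n : R * (R * R) => (`|n.2.1| <= 2 * d) && (`|n.2.2| <= 2 * d)) (coef_nodes d k).
  case: k => [|[|[|[|[|[|[|[|//]]]]]]]];
  by rewrite /coef_nodes/= ?a0 ?a1 ?a2 ?a1' ?a2'.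
by move=> /(allP H)/andP[].
Qed.

Definition basis_bound (w : R * R) : R := 1 + `|w.1| + `|w.2| + `|w.1 * w.2|
  + `|w.1 ^+ 2 - w.2 ^+ 2| + `|w.1 * w.2 ^+ 2 - w.1 ^+ 3 / 3|
  + `|w.1 * w.2 ^+ 3 - w.1 ^+ 3 * w.2| + `|w.1 ^+ 2 * w.2 - w.2 ^+ 3 / 3|.

Lemma harmonic_combination_dist a b e w :
  (forall k, (k < 8)%N -> `|a k - b k| <= e) ->
  `|harmonic_combination a w - harmonic_combination b w| <= e * basis_bound w.
Proof.
move=> ab; rewrite /basis_bound /harmonic_combination.
set p1 := w.1 * w.2; set p2 := w.1 ^+ 2 - _; set p3 := w.1 * _ - _.
set p4 := w.1 * _ - _; set p5 := w.1 ^+ 2 * _ - _.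
clearbody p1 p2 p3 p4 p5.
have -> : a 0%N + a 1%N * w.1 + a 2%N * w.2 + a 3%N * p1 + a 4%N * p2 + a 5%N * p3
    + a 6%N * p4 + a 7%N * p5 -
  (b 0%N + b 1%N * w.1 + b 2%N * w.2 + b 3%N * p1 + b 4%N * p2 + b 5%N * p3
    + b 6%N * p4 + b 7%N * p5) =
  (a 0%N - b 0%N) + (a 1%N - b 1%N) * w.1 + (a 2%N - b 2%N) * w.2 +
  (a 3%N - b 3%N) * p1 + (a 4%N - b 4%N) * p2 + (a 5%N - b 5%N) * p3
    + (a 6%N - b 6%N) * p4 + (a 7%N - b 7%N) * p5 by ring.
rewrite !mulrDr mulr1.
have T k p : (k < 8)%N -> `|(a k - b k) * p| <= e * `|p|.
  by move=> k8; rewrite normrM ler_wpM2r// ab.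
do 7 ! (apply: le_trans (ler_normD _ _) _; apply: lerD; last exact: T).
exact: ab.
Qed.

(** The coefficients are interpolated from [f] itself, so no convergent subsequence is extracted.
    Interpolation is linear in the values at finitely many nodes, hence an approximation within [e]
    has coefficients within [W * e] of the interpolated ones. *)
Lemma harmonic_combination_closed f (delta : R) : 0 < delta ->
  (forall e, 0 < e -> exists a, forall w : R * R, `|w.1| < delta -> `|w.2| < delta ->
     `|f w - harmonic_combination a w| <= e) ->
  exists a, forall w : R * R, `|w.1| < delta -> `|w.2| < delta ->
    f w = harmonic_combination a w.
Proof.
(* The nodes reach out to 2 d, which must stay below [delta]. *)
move=> delta0 fapp; pose d := delta / 3; have d0 : 0 < d by rewrite divr_gt0.
have dn0 : d != 0 by rewrite gt_eqF.
exists (interpolate d f) => w w1 w2.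
pose W := \sum_(k < 8) node_weight (coef_nodes d k).
have W0 k : 0 <= node_weight (coef_nodes d k) by apply: sumr_ge0.
have Wk k : (k < 8)%N -> node_weight (coef_nodes d k) <= W.
  by move=> k8; rewrite /W (bigD1 (Ordinal k8))//= lerDl sumr_ge0.
apply/eqP; rewrite -subr_eq0; apply/eqP.
apply: (@eq0_of_small _ _ (1 + W * basis_bound w) 1 ltr01) => e e0 _.
have [a fa] := fapp e e0.
rewrite -(subrK (harmonic_combination a w) (f w)) -addrA mulrDl mul1r.
rewrite (le_trans (ler_normD _ _))// lerD ?fa//.
rewrite mulrAC; apply: harmonic_combination_dist => k k8.
rewrite -[a k](interpolate_harmonic a dn0 k8) /interpolate.
apply: (@le_trans _ _ (node_weight (coef_nodes d k) * e)); last first.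
  by rewrite ler_wpM2r ?Wk// ltW.
apply: node_sum_dist => n /(coef_nodes_small d0)[n1 n2].
have dd : 2 * d < delta by rewrite /d; lra.
by rewrite distrC fa// (le_lt_trans _ dd).
Qed.

End interpolation.

(** * The local form of a continuous function with the mean value property *)

Section local_theorem.
Context {R : realType}.
Variable N : R * R -> R.
Hypothesis gN : symmetric_gauge N.
Hypothesis mN : monotone_slope_ratio N.

Lemma mean_value_harmonic_combination B (f : R * R -> R) (z0 : R * R) (delta rho : R) :
  0 < delta -> 0 < rho -> bounded_unif_continuous B f ->
  mean_value N f z0 (2 * delta) rho ->
  exists a, forall w : R * R, `|w.1| < delta -> `|w.2| < delta ->
    f (z0 + w) = harmonic_combination a w.
Proof.
move=> delta0 rho0 bf mvf; apply: (harmonic_combination_closed delta0) => e e0.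
have e12 : 0 < e / 12 by rewrite divr_gt0.
have [d d0 dP] := proj2 bf (e / 12) e12.
(* [h < d] limits the total error of twelve averages to 12 (e / 12) = e, and [12 * h <= delta] fits
   the enlarged square into half-side [2 * delta]. *)
pose h := Num.min (d / 2) (delta / 12).
have h0 : 0 < h by rewrite lt_min !divr_gt0.
have hd : h < d by rewrite gt_min ltr_pdivrMr// ltr_pMr// ltr1n.
have hdelta : 12 * h <= delta by rewrite -ler_pdivlMl// mulrC ge_min lexx orbT.
have mvh : mean_value N f z0 (delta + 12 * h) rho.
  move=> z z1 z2; apply: mvf.
    by apply: lt_le_trans z1 _; lra.
  by apply: lt_le_trans z2 _; lra.
have := jet_harmonic_combination (jet_steklov h0 bf) gN mN rho0
  (mean_value_steklov_jet h0 gN bf mvh) => hc.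
exists (jet_coef (steklov_jet h f) z0) => w w1 w2; rewrite -hc//.
rewrite distrC; apply: le_trans (steklov_jet_dist h0 bf (ltW e12) hd dP (z0 + w)) _.
by rewrite mulrC divfK.
Qed.

End local_theorem.

(** * Strongly harmonic functions *)

Section plane_measure.
Context {R : realType}.
Local Notation RM := (measurableTypeR R).
Local Notation M := (borel_plane_measure R).
Local Notation CT := (caratheodory_type (borel_plane_measure R)^*%mu).
Local Notation PM := (plane_measure R).

Lemma measurable_plane (A : set (RM * RM)) : measurable A -> measurable (A : set CT).
Proof. by move=> mA; exact: caratheodory_measurable_mu_ext. Qed.

Lemma plane_measureE (A : set (RM * RM)) : measurable A -> PM A = M A.
Proof. by move=> mA; exact: measurable_mu_extE. Qed.

Lemma measurable_fun_plane (f : RM * RM -> R) : measurable_fun setT f ->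
  measurable_fun setT (f : CT -> R).
Proof.
move=> mf _ Y mY; rewrite setTI.
by apply: measurable_plane; rewrite -[X in measurable X]setTI; exact: mf.
Qed.

(** The identity from the completed to the Borel sigma-algebra is measurable and pushes the
    completed measure to the Borel one, so Borel integrands do not see the completion. *)
Lemma ge0_integral_plane (D : set (RM * RM)) (f : RM * RM -> \bar R) :
  measurable D -> measurable_fun setT f -> (forall x, 0 <= f x)%E ->
  (\int[PM]_(w in D) f w = \int[M]_(w in D) f w)%E.
Proof.
move=> mD mf f0.
have mid : measurable_fun setT (id : CT -> RM * RM).
  by move=> _ Y mY; rewrite setTI; exact: measurable_plane.
transitivity (\int[pushforward PM (id : CT -> RM * RM)]_(w in D) f w)%E.
  by rewrite ge0_integral_pushforward//; exact: measurable_funTS.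
by apply: eq_measure_integral => A mA _; exact: plane_measureE.
Qed.

Lemma Rintegral_plane (D : set (RM * RM)) (f : RM * RM -> R) :
  measurable D -> measurable_fun setT f ->
  \int[PM]_(w in D) f w = \int[M]_(w in D) f w.
Proof.
move=> mD mf; have mef : measurable_fun setT (EFin \o f) by exact/measurable_EFinP.
congr fine; rewrite integralE [RHS]integralE.
rewrite ge0_integral_plane//; last exact: measurable_funepos.
by rewrite ge0_integral_plane//; exact: measurable_funeneg.
Qed.

Lemma translate_measure_preserving (z : R * R) : measure_preserving (fun w => z + w).
Proof.
have n1 : `|(1 : R)| = 1 by exact: normr1.
have := @measure_preserving_affine R (1, 1) z n1 n1; congr measure_preserving.
by apply/funext => w /=; rewrite !mul1r [w.1 + _]addrC [w.2 + _]addrC; case: z w => ? ? [].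
Qed.

Variable p : \bar R.
Hypothesis p1 : (1%:E <= p)%E.
Local Notation N := (lp_norm p).

Lemma lp_ball_preimage (z : R * R) r : (fun w => z + w) @^-1` lp_ball p z r = gauge_ball N r.
Proof.
by apply/seteqP; split => w; rewrite /lp_ball/gauge_ball/= addrC addKr.
Qed.

Lemma measurable_lp_ball (z : R * R) r : measurable (lp_ball p z r : set (RM * RM)).
Proof.
have gN := lp_norm_gauge p1.
have [mt _] := translate_measure_preserving (- z).
rewrite (_ : lp_ball p z r = setT `&` (fun w => - z + w) @^-1` gauge_ball N r).
  by apply: mt => //; exact: measurable_gauge_ball.
by rewrite setTI; apply/seteqP; split => w; rewrite /lp_ball/gauge_ball/= addrC.
Qed.

Lemma plane_measure_lp_ball (z : R * R) r : PM (lp_ball p z r) = M (gauge_ball N r).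
Proof.
rewrite plane_measureE; last exact: measurable_lp_ball.
have [_ pres] := translate_measure_preserving z.
by rewrite -pres ?lp_ball_preimage//; exact: measurable_lp_ball.
Qed.

Lemma Rintegral_lp_ball (z : R * R) r (f : R * R -> R) : tame f ->
  \int[PM]_(w in lp_ball p z r) f w = ball_integral N r (fun w => f (z + w)).
Proof.
move=> [mf _]; rewrite Rintegral_plane//; last exact: measurable_lp_ball.
rewrite (Rintegral_measure_preserving (translate_measure_preserving z))//.
  by rewrite lp_ball_preimage.
exact: measurable_lp_ball.
Qed.

Definition square (z : R * R) (e : R) : set (R * R) :=
  [set w | `|w.1 - z.1| <= e /\ `|w.2 - z.2| <= e].

Lemma squareE z e : square z e = `[z.1 - e, z.1 + e] `*` `[z.2 - e, z.2 + e].
Proof.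
apply/seteqP; split => w; rewrite /square/= !in_itv/= !ler_norml.
  by move=> [/andP[? ?] /andP[? ?]]; split; apply/andP; split; lra.
by move=> [/andP[? ?] /andP[? ?]]; split; apply/andP; split; lra.
Qed.

Lemma compact_square z e : compact (square z e).
Proof. by rewrite squareE; apply: compact_setX; exact: segment_compact. Qed.

Lemma closed_square z e : closed (square z e).
Proof. by apply: compact_closed; [exact: norm_hausdorff|exact: compact_square]. Qed.

Lemma measurable_square z e : measurable (square z e : set (RM * RM)).
Proof. by rewrite squareE; apply: measurableX; exact: measurable_itv. Qed.

Lemma lp_ball_sub_square (z z0 : R * R) r d e : `|z.1 - z0.1| <= d -> `|z.2 - z0.2| <= d ->
  r + d <= e -> lp_ball p z r `<=` square z0 e.
Proof.
move=> z1 z2 de w; rewrite /lp_ball/= => wr; have gN := lp_norm_gauge p1.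
have w1 : `|w.1 - z.1| < r by exact: gauge_ball_fst gN _ _ wr.
have w2 : `|w.2 - z.2| < r by exact: gauge_ball_snd gN _ _ wr.
split.
  have -> : w.1 - z0.1 = (w.1 - z.1) + (z.1 - z0.1) by ring.
  by rewrite (le_trans (ler_normD _ _))// (le_trans _ de)// lerD// ltW.
have -> : w.2 - z0.2 = (w.2 - z.2) + (z.2 - z0.2) by ring.
by rewrite (le_trans (ler_normD _ _))// (le_trans _ de)// lerD// ltW.
Qed.

Variables (Omega : set (R * R)) (u : Omega -> R).
Hypothesis hu : strongly_harmonic p u.
Local Notation U := ('valL_0 u).

Lemma valL0E (x : Omega) : u x = U (val x).
Proof. by rewrite -{1}(valLK 0 u). Qed.

(** [N] dominates the max norm, so the closed square contains the closure of the ball and supplies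
    both the compactness and the inclusion required by the definition. *)
Lemma strongly_harmonic_mean (z : R * R) r : 0 < r -> square z r `<=` Omega ->
  U z = (fine (M (gauge_ball N r)))^-1 * \int[PM]_(w in lp_ball p z r) U w.
Proof.
move=> r0 zr; have Oz : Omega z by apply: zr; split; rewrite subrr normr0 ltW.
have zin : z \in Omega by rewrite inE.
have cl : closure (lp_ball p z r) `<=` square z r.
  rewrite [X in _ `<=` X](closure_id _).1; last exact: closed_square.
  apply: closure_subset; apply: (@lp_ball_sub_square _ _ _ 0); rewrite ?subrr ?normr0//.
  by rewrite addr0.
have := proj2 hu (SigSub zin) r; rewrite valL0E /= => -> //.
- by rewrite plane_measure_lp_ball.
- by apply: subclosed_compact cl; [exact: closed_closure|exact: compact_square].
- exact: subset_trans cl zr.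
Qed.

(** The radius stays fixed at [e] while the centre moves within [e] of [z1]: all balls lie in the
    compact square [Q], and |U|, integrable on [Q], dominates the truncated functions. *)
Lemma strongly_harmonic_continuous (z1 : R * R) (e : R) : 0 < e ->
  square z1 (2 * e) `<=` Omega -> {for z1, continuous U}.
Proof.
move=> e0 zO; pose Q := square z1 (2 * e).
have gN := lp_norm_gauge p1.
have mQ : measurable (Q : set CT) by apply: measurable_plane; exact: measurable_square.
have iU : PM.-integrable Q (EFin \o U) by apply: (proj1 hu); [exact: compact_square|].
have mB z : measurable (lp_ball p z e : set CT).
  by apply: measurable_plane; exact: measurable_lp_ball.
have UE z : `|z.1 - z1.1| < e -> `|z.2 - z1.2| < e ->
    U z = (fine (M (gauge_ball N e)))^-1 *
      fine (\int[PM]_(w in Q) ((EFin \o U) \_ (lp_ball p z e)) w)%E.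
  move=> h1 h2; have BQ : lp_ball p z e `<=` Q.
    by apply: (@lp_ball_sub_square _ _ _ e); [exact: ltW|exact: ltW|lra].
  rewrite (@strongly_harmonic_mean z e)//; last first.
    apply: subset_trans zO => w [w1 w2]; split.
      have -> : w.1 - z1.1 = (w.1 - z.1) + (z.1 - z1.1) by ring.
      by rewrite (le_trans (ler_normD _ _))// mulr_natl mulr2n lerD// ltW.
    have -> : w.2 - z1.2 = (w.2 - z.2) + (z.2 - z1.2) by ring.
    by rewrite (le_trans (ler_normD _ _))// mulr_natl mulr2n lerD// ltW.
  congr (_ * fine _); rewrite -integral_mkcondr; congr integral.
  by rewrite setIidr.
(* Dominated convergence concerns sequences, so a discontinuity is first turned into a sequence [zn]
   tending to [z1] along which [U] stays at distance [eps]. *)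
apply: contrapT => ncU.
have [eps eps0 bad] : exists2 eps : R, 0 < eps & forall n : nat, exists z : R * R,
    [/\ `|z.1 - z1.1| < e / n.+1%:R, `|z.2 - z1.2| < e / n.+1%:R & eps <= `|U z1 - U z|].
  apply: contrapT => h; apply: ncU; apply/cvgrPdist_lt => eps eps0.
  apply: contrapT => h2; apply: h; exists eps => // n.
  apply: contrapT => h3; apply: h2.
  have en : 0 < e / n.+1%:R by rewrite divr_gt0.
  apply: filterS (nbhsx_ballx z1 _ en) => w [/= w1 w2].
  rewrite ltNge; apply/negP => h4; apply: h3; exists w; split => //.
    by rewrite distrC.
  by rewrite distrC.
have [zn znP] := choice bad.
have zcvg (w : R * R) : N (w - zn n) @[n --> \oo] --> N (w - z1).
  have cN : continuous N by exact: gauge_continuous gN.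
  apply/cvgrPdist_lt => d d0.
  have /cvgrPdist_lt/(_ d d0)/nbhs_ballP[r /= r0 rP] := cN (w - z1).
  near=> n; apply: rP; have [h1 h2 _] := znP n.
  have enr : e / n.+1%:R < r.
    rewrite ltr_pdivrMr// mulrC -ltr_pdivrMr//.
    apply: (@lt_trans _ _ n%:R); last by rewrite ltr_nat.
    by near: n; exact: nbhs_infty_gtr.
  split; rewrite /= /ball/= opprB addrC addrA subrK.
    exact: lt_trans h1 enr.
  exact: lt_trans h2 enr.
pose F n := (EFin \o U) \_ (lp_ball p (zn n) e).
pose F1 := (EFin \o U) \_ (lp_ball p z1 e).
have mF z : measurable_fun (Q : set CT) ((EFin \o U) \_ (lp_ball p z e)).
  apply: (iffLR (measurable_restrict (EFin \o U : CT -> \bar R) (mB z) mQ)).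
  by apply: measurable_funS (measurable_int PM iU) => //; exact: subIsetl.
have mS : measurable ([set w | N (w - z1) = e] : set (RM * RM)).
  have [mt _] := translate_measure_preserving (- z1).
  rewrite (_ : [set w | _] = setT `&` (fun w => - z1 + w) @^-1` [set w | N w = e]).
    apply: mt => //; rewrite -[X in measurable X]setTI.
    exact: (measurable_gauge gN measurableT (measurable_set1 e)).
  by rewrite setTI; apply/seteqP; split => w /=; rewrite addrC.
(* Off the sphere of radius [e] about [z1], membership in the moving balls is eventually
   constant. *)
have Fcvg : {ae PM, forall w, Q w -> F n w @[n --> \oo] --> F1 w}.
  exists [set w | N (w - z1) = e]; split.
  - apply: measurable_plane; exact: mS.
  - rewrite plane_measureE//; have [_ <-//] := translate_measure_preserving z1.
    rewrite -[RHS](gauge_sphere_null gN e); congr (M _).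
    by apply/seteqP; split => w /=; rewrite addrC addKr.
  move=> w /=; apply: contraPP => /eqP wne; apply; move=> _.
  have memE z : (w \in lp_ball p z e) = (N (w - z) < e).
    by apply/idP/idP; rewrite inE.
  apply: cvg_near_cst.
  have [lt|gt|we] := ltgtP (N (w - z1)) e; last by rewrite we eqxx in wne.
    near=> n; rewrite /F /F1 !patchE !memE lt ifT//.
    by near: n; exact: (cvgr_lt _ (zcvg w)).
  near=> n; rewrite /F /F1 !patchE !memE [N (w - z1) < e]ltNge (ltW gt)/= ifF//.
  apply/negbTE; rewrite -leNgt; apply: ltW.
  by near: n; exact: (cvgr_gt _ (zcvg w)).
have dom : {ae PM, forall w n, Q w -> (`|F n w| <= `|(EFin \o U) w|)%E}.
  apply: aeW => w n _; rewrite /F patchE; case: ifPn => // _.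
  by rewrite abse0 abse_ge0.
have [iF1 _ lim] := dominated_convergence mQ (fun n => mF (zn n)) (mF z1) Fcvg
  (integrable_abse iU) dom.
have /fine_cvg limf : (\int[PM]_(w in Q) F n w)%E @[n --> \oo] -->
    (fine (\int[PM]_(w in Q) F1 w)%E)%:E.
  by rewrite fineK//; exact: integrable_fin_num iF1.
have : U (zn n) @[n --> \oo] --> U z1.
  rewrite UE ?subrr ?normr0//.
  rewrite (_ : (fun n => U (zn n)) = (fun n => (fine (M (gauge_ball N e)))^-1 *
      fine (\int[PM]_(w in Q) F n w)%E)); first exact: cvgMr limf.
  apply/funext => n; have [h1 h2 _] := znP n.
  have le_e : e / n.+1%:R <= e by rewrite ler_pdivrMr// ler_peMr ?(ltW e0)// ler1n.
  by apply: UE; [exact: lt_le_trans h1 le_e|exact: lt_le_trans h2 le_e].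
move=> /cvgrPdist_lt/(_ _ eps0)[n _ /(_ n (leqnn n))].
by have [_ _ h] := znP n; rewrite /= ltNge h.
Unshelve. all: by end_near. Qed.

End plane_measure.

(** * Projection onto a closed square *)

Section clamp.
Context {R : realType}.
Implicit Types (c e s t : R) (z w : R * R).

Definition clamp c e t : R := Num.max (c - e) (Num.min (c + e) t).

Lemma clamp_dist_le c e s t : `|clamp c e s - clamp c e t| <= `|s - t|.
Proof.
have h1 : s - t <= `|s - t| by exact: ler_norm.
have h2 : t - s <= `|s - t| by rewrite distrC; exact: ler_norm.
have h3 : 0 <= `|s - t| by exact: normr_ge0.
rewrite ler_norml; move: `|s - t| h1 h2 h3 => d h1 h2 h3.
rewrite /clamp /Num.max /Num.min; do ![case: ifPn => /=]; rewrite -?leNgt => *;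
  apply/andP; split; lra.
Qed.

Lemma clamp_near c e t : 0 <= e -> `|clamp c e t - c| <= e.
Proof.
by move=> e0; rewrite ler_norml /clamp /Num.max /Num.min; do ![case: ifPn => /=];
  rewrite -?leNgt => *; apply/andP; split; lra.
Qed.

Lemma clamp_id c e t : `|t - c| <= e -> clamp c e t = t.
Proof.
by rewrite ler_norml /clamp /Num.max /Num.min => /andP[? ?];
  do ![case: ifPn => /=]; rewrite -?leNgt => *; lra.
Qed.

Definition clamp_plane z0 e z : R * R := (clamp z0.1 e z.1, clamp z0.2 e z.2).

Lemma clamp_plane_square z0 e z : 0 <= e -> square z0 e (clamp_plane z0 e z).
Proof. by move=> e0; split; exact: clamp_near. Qed.

Lemma clamp_plane_id z0 e z : square z0 e z -> clamp_plane z0 e z = z.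
Proof. by case: z => z1 z2 [h1 h2]; rewrite /clamp_plane !clamp_id. Qed.

(** The projection is 1-Lipschitz in each coordinate and lands in a compact square, where continuity
    gives a bound and a uniform modulus (Heine and Cantor). *)
Lemma bounded_unif_continuous_clamp (U : R * R -> R) z0 e : 0 < e ->
  (forall z, square z0 e z -> {for z, continuous U}) ->
  exists B, bounded_unif_continuous B (U \o clamp_plane z0 e).
Proof.
move=> e0 cU; have e0' := ltW e0.
have /compact_near_coveringP nc := @compact_square R z0 e.
have [B UB] : exists B : R, forall z, square z0 e z -> `|U z| <= B.
  have /filter_ex[B BP] : \forall B \near +oo, square z0 e `<=` (fun z => `|U z| <= B).
    apply: nc => z zQ.
    have /cvgrPdist_lt/(_ 1 ltr01) Uz := cU z zQ.
    exists ([set w | `|U z - U w| < 1], [set B | `|U z| + 1 < B]) => /=.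
      by split => //; exact: nbhs_pinfty_gt.
    move=> [w B] /= [h1 h2]; rewrite -(subrK (U z) (U w)).
    apply: le_trans (ler_normD _ _) _; rewrite distrC.
    by apply: ltW; apply: lt_trans h2; rewrite addrC ltrD2l.
  by exists B.
exists B; split => [z|eps eps0]; first by apply: UB; exact: clamp_plane_square.
pose P (d : R) z := forall w, `|z.1 - w.1| < d -> `|z.2 - w.2| < d -> `|U z - U w| <= eps.
have : \forall d \near 0^'+, square z0 e `<=` P d.
  apply: nc => z zQ.
  have /cvgrPdist_lt/(_ (eps / 2)) := cU z zQ.
  rewrite divr_gt0// => /(_ isT)/nbhs_ballP[r /= r0 rP].
  have r20 : 0 < r / 2 by rewrite divr_gt0.
  exists (ball z (r / 2), [set d | d < r / 2]) => /=.
    by split; [exact: nbhsx_ballx|exact: nbhs_right_lt].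
  move=> [x d] /= [[x1 x2] dr] w w1 w2.
  have xr : `|U z - U x| < eps / 2.
    apply: rP; split; [apply: lt_le_trans x1 _|apply: lt_le_trans x2 _]; lra.
  have wr : `|U z - U w| < eps / 2.
    apply: rP; move: x1 x2; rewrite /ball/= => x1 x2; split; rewrite /ball/=.
      rewrite -(subrKA x.1) (le_lt_trans (ler_normD _ _))//; lra.
    rewrite -(subrKA x.2) (le_lt_trans (ler_normD _ _))//; lra.
  rewrite -(subrKA (U z)) (le_trans (ler_normD _ _))// [`|U x - _|]distrC; lra.
move=> nP; have nP2 : \forall d \near 0^'+, square z0 e `<=` P d /\ 0 < d.
  by apply: filterI nP _; exact: nbhs_right_gt.
have [d [dP d0]] := @filter_ex _ _ (at_right_proper_filter 0) _ nP2.
exists d => // z w h1 h2; apply: dP; first exact: clamp_plane_square.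
  exact: le_lt_trans (clamp_dist_le _ _ _ _) h1.
exact: le_lt_trans (clamp_dist_le _ _ _ _) h2.
Qed.

End clamp.

Section locally_harmonic_combination.
Context {R : realType}.
Local Notation M := (borel_plane_measure R).
Local Notation PM := (plane_measure R).
Variables (p : \bar R) (Omega : set (R * R)) (u : Omega -> R).
Hypotheses (p1 : (1%:E <= p)%E) (pn2 : p <> 2%:E) (hu : strongly_harmonic p u).
Local Notation N := (lp_norm p).
Local Notation U := ('valL_0 u).

Lemma square_sub (z z0 : R * R) r d e : `|z.1 - z0.1| <= d -> `|z.2 - z0.2| <= d ->
  r + d <= e -> square z r `<=` square z0 e.
Proof.
move=> z1 z2 de w [w1 w2]; split.
  rewrite -(subrKA z.1) (le_trans (ler_normD _ _))//; lra.
rewrite -(subrKA z.2) (le_trans (ler_normD _ _))//; lra.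
Qed.

(** The local theorem needs centres within 2 delta; radii below delta then stay in the square of
    half-side 3 delta, where the clamped function equals [U]. Continuity at the points of that
    square asks for 2 delta more, hence 5 delta. *)
Lemma strongly_harmonic_local (z0 : R * R) (delta : R) : 0 < delta ->
  square z0 (5 * delta) `<=` Omega ->
  exists a, forall w : R * R, `|w.1| < delta -> `|w.2| < delta ->
    U (z0 + w) = harmonic_combination a w.
Proof.
move=> d0 sO; have gN := lp_norm_gauge p1.
have d30 : 0 < 3 * delta by exact: mulr_gt0.
have [|B bf] := bounded_unif_continuous_clamp (U := U) (z0 := z0) d30.
  move=> z [z1 z2]; apply: (@strongly_harmonic_continuous _ _ p1 _ _ hu z delta d0).
  by apply: subset_trans sO; apply: square_sub z1 z2 _; lra.
set f := U \o _ in bf.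
have fE z : square z0 (3 * delta) z -> f z = U z by move=> h; rewrite /f/= clamp_plane_id.
have mv : mean_value N f z0 (2 * delta) delta.
  move=> z z1 z2 r r0 rd.
  have zs : square z r `<=` square z0 (3 * delta).
    by apply: (@square_sub _ _ _ (2 * delta)); [exact: ltW|exact: ltW|lra].
  have zb : lp_ball p z r `<=` square z0 (3 * delta).
    by apply: (@lp_ball_sub_square _ _ p1 _ _ _ (2 * delta)); [exact: ltW|exact: ltW|lra].
  have zsO : square z r `<=` Omega.
    apply: subset_trans sO; apply: subset_trans zs _.
    by apply: (@square_sub _ _ _ 0); rewrite ?subrr ?normr0//; lra.
  rewrite fE; last by apply: zs; split; rewrite subrr normr0 ltW.
  rewrite (strongly_harmonic_mean p1 hu r0 zsO) -Rintegral_lp_ball//; last exact: buc_tame bf.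
  rewrite mulVKf ?gt_eqF//; last exact: gauge_ball_measure_gt0.
  by apply: eq_Rintegral => w; rewrite inE => /zb; exact: fE.
have [a aP] := mean_value_harmonic_combination gN (lp_monotone_slope_ratio p1 pn2)
  d0 d0 bf mv.
exists a => w w1 w2; rewrite -aP// fE//; split.
  by rewrite addrAC subrr add0r; lra.
by rewrite addrAC subrr add0r; lra.
Qed.

End locally_harmonic_combination.

Section harmonic_combinations.
Context {R : realType}.
Implicit Types (a b : nat -> R) (z w : R * R).
Local Notation hc := harmonic_combination.

(** The Taylor coefficients at [z] in the eight-polynomial basis: the span is invariant under
    translation, and the constant coefficient is the value at [z]. *)
Definition translate_coef a z : nat -> R := nth 0 [:: hc a z;
  a 1%N + a 3%N * z.2 + 2 * a 4%N * z.1 + a 5%N * (z.2 ^+ 2 - z.1 ^+ 2)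
    + a 6%N * (z.2 ^+ 3 - 3 * z.1 ^+ 2 * z.2) + 2 * a 7%N * z.1 * z.2;
  a 2%N + a 3%N * z.1 - 2 * a 4%N * z.2 + 2 * a 5%N * z.1 * z.2
    + a 6%N * (3 * z.1 * z.2 ^+ 2 - z.1 ^+ 3) + a 7%N * (z.1 ^+ 2 - z.2 ^+ 2);
  a 3%N + 2 * a 5%N * z.2 + 3 * a 6%N * (z.2 ^+ 2 - z.1 ^+ 2) + 2 * a 7%N * z.1;
  a 4%N - a 5%N * z.1 - 3 * a 6%N * z.1 * z.2 + a 7%N * z.2;
  a 5%N + 3 * a 6%N * z.2; a 6%N; a 7%N - 3 * a 6%N * z.1].

Lemma harmonic_combination_translate a z w : hc (translate_coef a z) w = hc a (z + w).
Proof. by rewrite /translate_coef /hc/=; field. Qed.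

Lemma harmonic_combinationB a b z :
  hc (fun k => a k - b k) z = hc a z - hc b z.
Proof. by rewrite /hc; ring. Qed.

Lemma harmonic_combination_coef0 a (delta : R) : 0 < delta ->
  (forall w, `|w.1| < delta -> `|w.2| < delta -> hc a w = 0) ->
  forall k, (k < 8)%N -> a k = 0.
Proof.
move=> d0 a0 k k8; have d30 : 0 < delta / 3 by rewrite divr_gt0.
rewrite -(interpolate_harmonic a (lt0r_neq0 d30) k8) /interpolate /node_sum.
apply: big1_seq => n /= ns; have [n1 n2] := coef_nodes_small d30 ns.
have dd : 2 * (delta / 3) < delta by lra.
by rewrite a0 ?mulr0// (le_lt_trans _ dd).
Qed.

(** Unique continuation: recentred at [z0], the polynomial has all eight coefficients zero by
    interpolation on the small square. *)
Lemma harmonic_combination_eq0 a z0 (delta : R) : 0 < delta ->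
  (forall w, `|w.1 - z0.1| < delta -> `|w.2 - z0.2| < delta -> hc a w = 0) ->
  forall z, hc a z = 0.
Proof.
move=> d0 a0 z; have t0 k : (k < 8)%N -> translate_coef a z0 k = 0.
  apply: (harmonic_combination_coef0 d0) => w w1 w2.
  by rewrite harmonic_combination_translate; apply: a0; rewrite addrAC subrr add0r.
by rewrite -(subrKC z0 z) -harmonic_combination_translate /hc !t0//; ring.
Qed.

Lemma tame_harmonic_combination a : tame (hc a).
Proof.
rewrite /hc; have t1 := @tame_fst R; have t2 := @tame_snd R.
by do ![apply: tameB|apply: tameD|apply: tameM|apply: tameX|exact: tame_cst|exact: t1|exact: t2].
Qed.

Variable N : R * R -> R.
Hypothesis gN : symmetric_gauge N.
Local Notation M := (borel_plane_measure R).

(* Averaging over the eight symmetries of the square leaves only the constant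
   term. *)
Lemma ball_integral_harmonic_combination a r :
  ball_integral N r (hc a) = fine (M (gauge_ball N r)) * a 0%N.
Proof.
have tb := tame_harmonic_combination a.
pose g2 w : R := hc a w + hc a (-1 * w.1, 1 * w.2).
pose g4 w : R := g2 w + g2 (1 * w.1, -1 * w.2).
pose g8 w : R := g4 w + g4 (w.2, w.1).
have sgn (f : R * R -> R) (c : R * R) : `|c.1| = 1 -> `|c.2| = 1 -> tame f ->
    tame (fun w => f w + f (c.1 * w.1, c.2 * w.2)) /\
    ball_integral N r (fun w => f w + f (c.1 * w.1, c.2 * w.2)) = 2 * ball_integral N r f.
  move=> c1 c2 tf; have tf' := tame_affine c 0 tf.
  have cE : (fun w : R * R => f (c.1 * w.1 + (0 : R * R).1, c.2 * w.2 + (0 : R * R).2)) =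
    (fun w => f (c.1 * w.1, c.2 * w.2)) by apply/funext => w; rewrite !addr0.
  rewrite cE in tf'; split; first exact: tameD.
  by rewrite (ball_integralD gN)// -(ball_integral_sign gN)// mulr_natl mulr2n.
have n1 : `|1 : R| = 1 by exact: normr1.
have m1 : `|-1 : R| = 1 by rewrite normrN.
have [t2 i2] := sgn (hc a) (-1, 1) m1 n1 tb.
have [t4 i4] := sgn g2 (1, -1) n1 m1 t2.
have t4' : tame (fun w => g4 (w.2, w.1)).
  have [mp _] := @measure_preserving_swap R; have [mg bg] := t4.
  split; first exact: (measurableT_comp mg mp).
  by move=> q; have [C gC] := bg q; exists C => w w1 w2; exact: gC.
have i8 : ball_integral N r g8 = 2 * ball_integral N r g4.
  by rewrite (ball_integralD gN)// -(ball_integral_swap gN)// mulr_natl mulr2n.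
have g8E : g8 = fun=> 8 * a 0%N.
  by apply/funext => w; rewrite /g8 /g4 /g2 /hc/=; field.
have := i8; rewrite /g4 i4 /g2 i2 g8E (ball_integral_cst gN) => H.
lra.
Qed.

End harmonic_combinations.

Section harmonic_combination_space.
Context {R : realType}.
Local Notation RM := (measurableTypeR R).
Local Notation M := (borel_plane_measure R).
Local Notation CT := (caratheodory_type (borel_plane_measure R)^*%mu).
Local Notation PM := (plane_measure R).
Variables (Omega : set (R * R)) (p : \bar R).
Hypotheses (oO : open Omega) (p1 : (1%:E <= p)%E).
Local Notation N := (lp_norm p).
Local Notation hc := harmonic_combination.

Lemma valL_sigL_in (f : R * R -> R) z : Omega z -> 'valL_0 (sigL Omega f) z = f z.
Proof.
move=> Oz; have zin : z \in Omega by rewrite inE.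
by have := valL0E (sigL Omega f) (SigSub zin); rewrite /= => <-.
Qed.

Lemma tame_locally_integrable f : tame f ->
  locally_integrable_on (sigL Omega f).
Proof.
move=> [mf bf] K cK KO.
have mK : measurable (K : set (RM * RM)).
  rewrite -[K]setCK; apply: measurableC; apply: open_plane_measurable.
  by apply: closed_openC; apply: compact_closed => //; exact: norm_hausdorff.
have mKC : measurable (K : set CT) by exact: measurable_plane.
have [r Kr] : exists r : R, forall w, K w -> `|w.1| < r /\ `|w.2| < r.
  have /pinfty_ex_gt0[r r0 rP] := compact_bounded cK.
  exists (r + 1) => w /rP /= wr; move: wr; rewrite /Num.norm/= /Num.norm/= ge_max.
  by move=> /andP[w1 w2]; split; rewrite (le_lt_trans w1, le_lt_trans w2)// ltrDl.
apply: (eq_integrable mKC (EFin \o f)).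
  by move=> w; rewrite inE => /KO wO; congr EFin; exact: esym (valL_sigL_in _ wO).
apply: measurable_bounded_integrable => //.
- rewrite plane_measureE//; apply: (@le_lt_trans _ _ (M (`]- `|r|, `|r|[ `*` `]- `|r|, `|r|[))).
    apply: le_measure; rewrite ?inE//; first exact: measurableX.
    have rr : r <= `|r| by exact: ler_norm.
    move=> w /Kr[w1 w2]; split => /=; rewrite in_itv/= -ltr_norml.
      exact: lt_le_trans w1 rr.
    exact: lt_le_trans w2 rr.
  by rewrite plane_measure_square ?ltry// ge0_cp.
- by apply: measurable_funTS; exact: measurable_fun_plane.
have [C fC] := bf r; exists C; split; first exact: num_real.
by move=> D CD w /Kr[w1 w2]; apply: (le_trans (fC w (ltW w1) (ltW w2))); exact: ltW.
Qed.

(** Translating the centre to 0 leaves a combination with coefficients [translate_coef], whose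
    integral sees only the constant one, namely the value at the centre. *)
Lemma strongly_harmonic_combination a : strongly_harmonic p (sigL Omega (hc a)).
Proof.
have gN := lp_norm_gauge p1; have tb := tame_harmonic_combination a.
split; first exact: tame_locally_integrable.
move=> z r B r0 _ BO; have {}BO : B `<=` Omega := subset_trans (@subset_closure _ B) BO.
rewrite (_ : Rintegral _ _ _ = \int[PM]_(w in B) hc a w); last first.
  by apply: eq_Rintegral => w; rewrite inE => /BO; exact: valL_sigL_in.
rewrite /B Rintegral_lp_ball// plane_measure_lp_ball//.
rewrite (_ : (fun w => _) = hc (translate_coef a (val z))); last first.
  by apply/funext => w; rewrite harmonic_combination_translate.
by rewrite ball_integral_harmonic_combination// mulKf// gt_eqF// gauge_ball_measure_gt0.
Qed.

Hypotheses (cO : connected Omega) (pn2 : p <> 2%:E).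

(** [rep a z] says that u coincides with one fixed combination near [z], in absolute coordinates.
    The set of such [z] is open, and it is closed in Omega because combinations agreeing on a small
    square agree everywhere; connectedness finishes. *)
Lemma strongly_harmonic_global (u : Omega -> R) : Omega !=set0 -> strongly_harmonic p u ->
  exists a, forall x : Omega, u x = hc a (val x).
Proof.
move=> [z0 Oz0] hu; pose U := 'valL_0 u.
pose rep a z := exists2 d : R, 0 < d & forall w : R * R,
  `|w.1 - z.1| < d -> `|w.2 - z.2| < d -> U w = hc a w.
have rep_open a : open [set z | rep a z].
  rewrite openE => z [d d0 dP] /=; have d20 : 0 < d / 2 by rewrite divr_gt0.
  apply: filterS (nbhsx_ballx z _ d20) => z' [z1 z2].
  exists (d / 2) => // w w1 w2; move: z1 z2; rewrite /ball/= => z1 z2; apply: dP.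
    rewrite -(subrKA z'.1) (le_lt_trans (ler_normD _ _))// [`|z'.1 - _|]distrC; lra.
  rewrite -(subrKA z'.2) (le_lt_trans (ler_normD _ _))// [`|z'.2 - _|]distrC; lra.
have rep_ex z : Omega z -> exists a, rep a z.
  move=> Oz; have [e e0 eO] := open_rect oO Oz.
  (* The local lemma needs a closed square of half-side 5 (e / 6), which is less than e. *)
  have e6 : 0 < e / 6 by rewrite divr_gt0.
  have [|a aP] := strongly_harmonic_local p1 pn2 hu (z0 := z) e6.
    by move=> w [w1 w2]; apply: eO; [apply: le_lt_trans w1 _|apply: le_lt_trans w2 _]; lra.
  (* Translation by [- z] turns coefficients relative to [z] into absolute ones. *)
  exists (translate_coef a (- z)); exists (e / 6) => // w w1 w2.
  rewrite harmonic_combination_translate addrC -aP ?subrKC//=.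
have rep_eq a b z : Omega z -> rep a z -> closure [set z | rep b z] z -> rep b z.
  move=> Oz [d d0 dP] cz.
  have [z' [[d' d'0 d'P] [z1 z2]]] := cz _ (nbhsx_ballx z _ d0).
  move: z1 z2; rewrite /ball/= => z1 z2.
  (* A square about [z'] contained in both neighbourhoods: there [hc a] and [hc b] both equal
     [U]. *)
  pose e := Num.min d' (Num.min (d - `|z.1 - z'.1|) (d - `|z.2 - z'.2|)).
  have e0 : 0 < e by rewrite !lt_min d'0 !subr_gt0 z1 z2.
  have ab : forall w, hc (fun k => a k - b k) w = 0.
    apply: (harmonic_combination_eq0 (z0 := z') e0) => w; rewrite !lt_min.
    move=> /and3P[w1 w1' _] /and3P[w2 _ w2'].
    rewrite harmonic_combinationB -d'P// -dP ?subrr//.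
      rewrite -(subrKA z'.1) (le_lt_trans (ler_normD _ _))// [`|z'.1 - _|]distrC; lra.
    rewrite -(subrKA z'.2) (le_lt_trans (ler_normD _ _))// [`|z'.2 - _|]distrC; lra.
  exists d => // w w1 w2; rewrite dP//; apply/eqP.
  by rewrite -subr_eq0 -harmonic_combinationB ab.
have [a az0] := rep_ex z0 Oz0.
have OE : Omega `&` [set z | rep a z] = Omega.
  apply: cO; first by exists z0.
    by exists [set z | rep a z].
  exists (closure [set z | rep a z]); first exact: closed_closure.
  apply/seteqP; split => z [Oz az]; split => //; first exact: subset_closure.
  by have [b bz] := rep_ex z Oz; exact: rep_eq Oz bz az.
exists a => x; rewrite valL0E.
have : (Omega `&` [set z | rep a z]) (val x) by rewrite OE; exact: set_valP.
by move=> [_ [d d0 dP]]; apply: dP; rewrite subrr normr0.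
Qed.

End harmonic_combination_space.

(** * Harmonicity and linear independence of the polynomials *)

Section harmonicity.
Context {R : realType}.
Implicit Types (a b : nat -> R) (z v w : R * R).
Local Notation hc := harmonic_combination.
Local Notation e1 := (e1 R).
Local Notation e2 := (e2 R).

Lemma is_derive_linear_plane (l : R * R -> R) z v :
  (forall c w w', l (c *: w + w') = c * l w + l w') -> is_derive z v l (l v).
Proof.
move=> ll; have H : h^-1 *: ((l \o shift z) (h *: v) - l z) @[h --> 0^'] --> l v.
  apply: cvg_near_cst; near=> h; rewrite /= ll addrK.
  by rewrite [LHS]mulKf//; near: h; exact: nbhs_dnbhs_neq.
by split; [apply/cvg_ex; exists (l v)|exact: cvg_lim H].
Unshelve. all: by end_near. Qed.

Lemma is_derive_harmonic_combination a z v : is_derive z v (hc a)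
  (v.1 * (a 1%N + a 3%N * z.2 + 2 * a 4%N * z.1 + a 5%N * (z.2 ^+ 2 - z.1 ^+ 2)
     + a 6%N * (z.2 ^+ 3 - 3 * z.1 ^+ 2 * z.2) + 2 * a 7%N * z.1 * z.2)
   + v.2 * (a 2%N + a 3%N * z.1 - 2 * a 4%N * z.2 + 2 * a 5%N * z.1 * z.2
     + a 6%N * (3 * z.1 * z.2 ^+ 2 - z.1 ^+ 3) + a 7%N * (z.1 ^+ 2 - z.2 ^+ 2))).
Proof.
have d1 : is_derive z v fst v.1 by exact: (@is_derive_linear_plane fst).
have d2 : is_derive z v snd v.2 by exact: (@is_derive_linear_plane snd).
have dc (c : R) : is_derive z v (fun=> c) 0 by exact: is_derive_cst.
have m (k : R) (f : R * R -> R) (df : R) : is_derive z v f df ->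
    is_derive z v (fun w => k * f w) (k * df + f z * 0).
  by move=> h; exact: is_derive_funM (dc k) h.
have q (f : R * R -> R) (df : R) : is_derive z v f df ->
    is_derive z v (fun w => f w / 3) (f z * 0 + 3^-1 * df).
  by move=> h; exact: is_derive_funM h (dc 3^-1).
have x1 n := is_derive_funX n d1; have x2 n := is_derive_funX n d2.
have b4 := is_derive_funD (x1 2) (is_derive_funN (x2 2)).
have b5 := is_derive_funD (is_derive_funM d1 (x2 2)) (is_derive_funN (q _ _ (x1 3))).
have b6 := is_derive_funD (is_derive_funM d1 (x2 3)) (is_derive_funN (is_derive_funM (x1 3) d2)).
have b7 := is_derive_funD (is_derive_funM (x1 2) d2) (is_derive_funN (q _ _ (x2 3))).
have h3 := is_derive_funD (is_derive_funD (is_derive_funD (dc (a 0%N)) (m (a 1%N) _ _ d1))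
  (m (a 2%N) _ _ d2)) (m (a 3%N) _ _ (is_derive_funM d1 d2)).
have := is_derive_funD (is_derive_funD (is_derive_funD (is_derive_funD h3
  (m (a 4%N) _ _ b4)) (m (a 5%N) _ _ b5)) (m (a 6%N) _ _ b6)) (m (a 7%N) _ _ b7).
by congr is_derive; rewrite /=; field.
Qed.

(** The span is stable under partial derivatives. Expressing them on coefficients makes continuous
    second derivatives automatic and reduces the Laplace equation to an identity between
    coefficients. *)
Definition coef_dx a : nat -> R :=
  nth 0 [:: a 1%N; 2 * a 4%N; a 3%N; 2 * a 7%N; - a 5%N; 0; 0; - (3 * a 6%N)].

Definition coef_dy a : nat -> R :=
  nth 0 [:: a 2%N; a 3%N; - (2 * a 4%N); 2 * a 5%N; a 7%N; 3 * a 6%N; 0; 0].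

Lemma is_derive_harmonic_combination_e1 a z : is_derive z e1 (hc a) (hc (coef_dx a) z).
Proof.
have := is_derive_harmonic_combination a z e1; congr is_derive.
by rewrite /hc /coef_dx/=; field.
Qed.

Lemma is_derive_harmonic_combination_e2 a z : is_derive z e2 (hc a) (hc (coef_dy a) z).
Proof.
have := is_derive_harmonic_combination a z e2; congr is_derive.
by rewrite /hc /coef_dy/=; field.
Qed.

Lemma continuous_harmonic_combination a : continuous (hc a).
Proof.
move=> z; have c1 : fst @ z --> z.1 by exact: cvg_fst.
have c2 : snd @ z --> z.2 by exact: cvg_snd.
have D (f g : R * R -> R) (l k : R) : f @ z --> l -> g @ z --> k ->
    f w + g w @[w --> z] --> l + k by exact: cvgD.
have B (f g : R * R -> R) (l k : R) : f @ z --> l -> g @ z --> k ->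
    f w - g w @[w --> z] --> l - k by exact: cvgB.
have M (f g : R * R -> R) (l k : R) : f @ z --> l -> g @ z --> k ->
    f w * g w @[w --> z] --> l * k by exact: cvgM.
have cst (k : R) : k @[w --> z] --> k by exact: cvg_cst.
have m (k : R) (f : R * R -> R) (l : R) : f @ z --> l -> k * f w @[w --> z] --> k * l.
  exact: M (cst k).
have q (f : R * R -> R) (l : R) : f @ z --> l -> f w / 3 @[w --> z] --> l / 3.
  by move=> h; exact: M h (cst _).
have x1 n : w.1 ^+ n @[w --> z] --> z.1 ^+ n.
  apply: (@cvg_comp _ _ _ (fun w : R * R => w.1) (fun t : R => t ^+ n) _ _ _ c1).
  exact: exprn_continuous.
have x2 n : w.2 ^+ n @[w --> z] --> z.2 ^+ n.
  apply: (@cvg_comp _ _ _ (fun w : R * R => w.2) (fun t : R => t ^+ n) _ _ _ c2).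
  exact: exprn_continuous.
have b4 := B _ _ _ _ (x1 2%N) (x2 2%N).
have b5 := B _ _ _ _ (M _ _ _ _ c1 (x2 2%N)) (q _ _ (x1 3%N)).
have b6 := B _ _ _ _ (M _ _ _ _ c1 (x2 3%N)) (M _ _ _ _ (x1 3%N) c2).
have b7 := B _ _ _ _ (M _ _ _ _ (x1 2%N) c2) (q _ _ (x2 3%N)).
have h3 := D _ _ _ _ (D _ _ _ _ (D _ _ _ _ (cst (a 0%N)) (m (a 1%N) _ _ c1)) (m (a 2%N) _ _ c2))
  (m (a 3%N) _ _ (M _ _ _ _ c1 c2)).
have h7 := D _ _ _ _ (D _ _ _ _ (D _ _ _ _ (D _ _ _ _ h3 (m (a 4%N) _ _ b4)) (m (a 5%N) _ _ b5))
  (m (a 6%N) _ _ b6)) (m (a 7%N) _ _ b7).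
exact: h7.
Qed.

Lemma harmonic_function_combination a : harmonic_function (hc a).
Proof.
have D v : v \in [:: e1; e2] -> exists d : (nat -> R) -> nat -> R,
    (forall a z, derivable (hc a) z v) /\ (forall a, 'D_v (hc a) = hc (d a)).
  rewrite !inE => /orP[]/eqP->; [exists coef_dx|exists coef_dy];
  split => [b z|b]; do ?apply/funext => z.
  - by have [] := is_derive_harmonic_combination_e1 b z.
  - by have [] := is_derive_harmonic_combination_e1 b z.
  - by have [] := is_derive_harmonic_combination_e2 b z.
  - by have [] := is_derive_harmonic_combination_e2 b z.
split.
  move=> v w /D[dv [vd vE]] /D[dw [wd wE]]; rewrite vE wE.
  by split => //; exact: continuous_harmonic_combination.
have E1 b : 'D_e1 (hc b) = hc (coef_dx b).
  by apply/funext => z; have [] := is_derive_harmonic_combination_e1 b z.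
have E2 b : 'D_e2 (hc b) = hc (coef_dy b).
  by apply/funext => z; have [] := is_derive_harmonic_combination_e2 b z.
have lap z : hc (coef_dx (coef_dx a)) z + hc (coef_dy (coef_dy a)) z = 0.
  by rewrite /hc /coef_dx /coef_dy/=; ring.
move=> z; rewrite (E1 a) (E2 a) -[RHS](lap z); congr (_ + _).
  by have [_ ->] := is_derive_harmonic_combination_e1 (coef_dx a) z.
by have [_ ->] := is_derive_harmonic_combination_e2 (coef_dy a) z.
Qed.

End harmonicity.

Section harmonic_polynomials.
Context {R : realType}.
Implicit Type z : R * R.
Local Notation hc := harmonic_combination.
Local Notation P := (harmonic_polynomials R).

Lemma harmonic_combinationE (a : nat -> R) z : hc a z = \sum_(i < 8) a i * tnth P i z.
Proof. by rewrite !big_ord_recl big_ord0 !(tnth_nth (fun=> 0)) /hc/=; ring. Qed.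

Lemma tnth_harmonic_polynomials i : tnth P i = hc (fun k => (k == i :> nat)%:R).
Proof.
apply/funext => z; rewrite harmonic_combinationE (bigD1 i)//= eqxx mul1r big1 ?addr0//.
by move=> j /negbTE ji; rewrite -val_eqE/= in ji; rewrite ji mul0r.
Qed.

Variable Omega : set (R * R).

(** [inord] extends the finite family to a sequence; its default beyond index 7 is never read by
    [hc]. *)
Lemma harmonic_polynomials_on_sum (c : 'I_8 -> R) (x : Omega) :
  (\sum_(i < 8) c i *: tnth (harmonic_polynomials_on Omega) i) x =
  hc (fun k => c (inord k)) (val x).
Proof.
rewrite harmonic_combinationE fct_sumE; apply: eq_bigr => i _.
by rewrite tnth_map inord_val.
Qed.

Lemma harmonic_polynomials_on_span (u : Omega -> R) :
  linear_span (harmonic_polynomials_on Omega) u <->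
  exists a, u = sigL Omega (hc a).
Proof.
split=> [[c ->]|[a ->]].
  exists (fun k => c (inord k)); apply/funext => x.
  by rewrite harmonic_polynomials_on_sum.
exists (fun i => a i); apply/funext => x; rewrite harmonic_polynomials_on_sum.
rewrite [LHS]harmonic_combinationE [RHS]harmonic_combinationE.
by apply: eq_bigr => i _; rewrite inord_val.
Qed.

(** A nonempty open set contains a square, on which a vanishing combination already has zero
    coefficients. *)
Lemma harmonic_polynomials_on_independent : open Omega -> Omega !=set0 ->
  linearly_independent (harmonic_polynomials_on Omega).
Proof.
move=> oO [z0 Oz0] c c0 i; have [e e0 eO] := open_rect oO Oz0.
pose a k := c (inord k); have aE w : Omega w -> hc a w = 0.
  move=> Ow; have win : w \in Omega by rewrite inE.
  by have := congr1 (fun f => f (SigSub win)) c0; rewrite harmonic_polynomials_on_sum.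
have a0 z : hc a z = 0.
  by apply: (harmonic_combination_eq0 (z0 := z0) e0) => w w1 w2; apply/aE/eO.
have := harmonic_combination_coef0 ltr01 (fun w _ _ => a0 w) (ltn_ord i).
by rewrite /a inord_val.
Qed.

End harmonic_polynomials.

Theorem mainTheorem6 (R : realType) (Omega : set (R * R)) (p : \bar R)
    (Omega_open : open Omega)
    (Omega_nonempty : Omega !=set0)
    (Omega_connected : connected Omega)
    (p_ge1 : (1%:E <= p)%E)
    (p_neq2 : (p <> 2%:E)%E) :
  [/\ forall i, harmonic_function (tnth (harmonic_polynomials R) i),
      linearly_independent (harmonic_polynomials_on Omega),
      @strongly_harmonic_space R p Omega
        = linear_span (harmonic_polynomials_on Omega) &
      has_dimension (@strongly_harmonic_space R p Omega) 8].
Proof.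
have indep := harmonic_polynomials_on_independent Omega_open Omega_nonempty.
have span : strongly_harmonic_space p (Omega := Omega) =
    linear_span (harmonic_polynomials_on Omega).
  apply/seteqP; split => u.
    move=> /(strongly_harmonic_global Omega_open p_ge1 Omega_connected p_neq2 Omega_nonempty).
    move=> [a ua]; apply/harmonic_polynomials_on_span; exists a.
    by apply/funext => x; rewrite ua.
  move=> /harmonic_polynomials_on_span[a ->].
  exact: strongly_harmonic_combination.
split=> //; last by exists (harmonic_polynomials_on Omega).
by move=> i; rewrite tnth_harmonic_polynomials; exact: harmonic_function_combination.
Qed.
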